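(* Let $1<p<\infty$, $w\in A_p$, $a\in BMO$, and let the pair $(\varphi_1,\varphi_2)$ of weights satisfy, with a constant $C_1$ independent of $x$ and $r$, $$\int_r^\infty\Big(1+\ln\frac tr\Big)\frac{\operatorname*{ess\,inf}_{t<s<\infty}\varphi_1(x,s)\,w(B_s(x))^{\frac1p}}{w(B_t(x))^{\frac1p}}\,\frac{dt}{t}\le C_1\,\varphi_2(x,r)\qquad\text{for all }x\in\mathbb{R}^n_+,\ r>0.$$ Let $\widetilde T$ be a sub-linear operator such that $|\widetilde T f(x)|\le C_0\int_{\mathbb{R}^n_+}\frac{|f(y)|}{|\tilde x-y|^n}\,dy$ for any $f\in L_1(\mathbb{R}^n_+)$ with compact support, and let $\widetilde T_a f=a\,\widetilde T f-\widetilde T(af)$. Suppose that $\widetilde T_a$ is a sub-linear operator satisfying $$|\widetilde T_a f(x)|\le C_0\int_{\mathbb{R}^n_+}|a(x)-a(y)|\,\frac{|f(y)|}{|\tilde x-y|^n}\,dy$$ for any $f\in L_1(\mathbb{R}^n_+)$ with compact support and $x\notin\operatorname{supp}f$, and that $\widetilde T_a$ is bounded on $L_{p,w}(\mathbb{R}^n_+)$ with $$\|\widetilde T_a f\|_{p,w;\mathbb{R}^n_+}\le C_0\,[w]_{A_p}^{\frac1p}\,\|a\|_*\,\|f\|_{p,w;\mathbb{R}^n_+},$$ where $C_0$ is independent of $f$, $a$ and $x$. Then $\widetilde T_a$ is bounded from $M_{p,\varphi_1}(\mathbb{R}^n_+,w)$ to $M_{p,\varphi_2}(\mathbb{R}^n_+,w)$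 and $$\|\widetilde T_a f\|_{p,\varphi_2,w;\mathbb{R}^n_+}\le C\,[w]_{A_p}^{\frac1p}\,\|a\|_*\,\|f\|_{p,\varphi_1,w;\mathbb{R}^n_+}$$ with a constant $C$ independent of $f$ and $a$.
   Context: $\mathbb{R}^n_+=\{x\in\mathbb{R}^n: x_n>0\}$, and for $x\in\mathbb{R}^n_+$, $\tilde x=(x_1,\dots,x_{n-1},-x_n)$. $B_r(x)$ is the open ball of center $x$ and radius $r$, and $B_r^+(x)=B_r(x)\cap\mathbb{R}^n_+$. A weight is a non-negative locally integrable function on its domain; $w(E)=\int_E w(x)\,dx$ for a weight $w$ on $\mathbb{R}^n$. The weight $w$ belongs to the Muckenhoupt class $A_p$, $1<p<\infty$, if $$[w]_{A_p}=\sup_{B}\left(\frac1{|B|}\int_B w\,dx\right)\left(\frac1{|B|}\int_B w^{-\frac1{p-1}}\,dx\right)^{p-1}<\infty,$$ the supremum being over all balls $B\subset\mathbb{R}^n$. For measurable $A$, $\|f\|_{p,w;A}=\left(\int_A|f|^pw\,dy\right)^{1/p}$, and $L_{p,w}(A)$ is the space of measurable $f$ with $\|f\|_{p,w;A}<\infty$. $BMO$ is the space of $a\in L_1^{\rm loc}(\mathbb{R}^n)$ with $\|a\|_*=\sup_B\frac1{|B|}\int_B|a(y)-a_B|\,dy<\infty$, where $a_B=\frac1{|B|}\int_B a\,dx$ and the supremum is over all balls. For a weight $\varphi(x,r)$ with values in $\mathbb{R}_+=(0,\infty)$, $M_{p,\varphi}(\mathbb{R}^n_+,w)$ (generalized weighted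 Morrey space) consists of all $f\in L_{p,w}^{\rm loc}(\mathbb{R}^n_+)$ with $$\|f\|_{p,\varphi,w;\mathbb{R}^n_+}=\sup_{x\in\mathbb{R}^n_+,\,r>0}\varphi(x,r)^{-1}\left(w(B_r^+(x))^{-1}\int_{B_r^+(x)}|f(y)|^pw(y)\,dy\right)^{\frac1p}<\infty.$$
   Formalization: Added assumption: for f in M_{p,φ1}, T̃_a f is defined and |T̃_a f| is the a.e. limit of |T̃_a| on truncations of f to compact sets exhausting the half-space; without such a link the stated estimates do not control T̃_a f for general Morrey f. *)

(* Defs.v *)
From HB Require Import structures.
From mathcomp Require Import all_boot all_order all_algebra.
From mathcomp Require Import all_classical all_reals all_analysis.
From mathcomp Require Import ess_sup_inf.

Set Implicit Arguments.
Unset Strict Implicit.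
Unset Printing Implicit Defensive.

Import Order.TTheory GRing.Theory Num.Theory.
Import numFieldNormedType.Exports.

Local Open Scope classical_set_scope.
Local Open Scope ring_scope.

(* The sigma-algebra on 'rV[R]_n is the one generated by the coordinates, as
   for n.-tuple R in the library; it coincides with the Borel sigma-algebra
   of the topology that 'rV[R]_n already carries. *)
Definition measure_rV_display : measure_display.
Proof. exact: default_measure_display. Qed.

Section measurable_rV.
Variables (R : realType) (n : nat).

Let coor (i : 'I_n) (x : 'rV[R]_n) : measurableTypeR R := x 0 i.

Let rV_set0 : g_sigma_preimage coor set0.
Proof. exact: sigma_algebra0. Qed.

Let rV_setC A : g_sigma_preimage coor A -> g_sigma_preimage coor (~` A).
Proof. exact: sigma_algebraC. Qed.

Let rV_bigcup (F : _^nat) : (forall i, g_sigma_preimage coor (F i)) ->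
  g_sigma_preimage coor (\bigcup_i (F i)).
Proof. exact: sigma_algebra_bigcup. Qed.

HB.instance Definition _ := @isMeasurable.Build measure_rV_display
  'rV[R]_n (g_sigma_preimage coor) rV_set0 rV_setC rV_bigcup.

Lemma measurable_coor (i : 'I_n) : measurable_fun setT (coor i).
Proof.
move=> _ Y mY; rewrite setTI; apply: sub_sigma_algebra => /=.
rewrite -bigcup_seq/=; exists i => /=; first by rewrite mem_index_enum.
by exists Y => //; rewrite setTI.
Qed.

Lemma measurable_fun_rV d (T : measurableType d) (f : T -> 'rV[R]_n) :
  (forall i, measurable_fun setT (coor i \o f)) -> measurable_fun setT f.
Proof.
move=> mf _ Y mY; rewrite setTI.
suff : (g_sigma_preimage coor) `<=` [set B | measurable (f @^-1` B)] by exact.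
apply: smallest_sub.
  split=> /=.
  - by rewrite preimage_set0.
  - by move=> B mB; rewrite setTD -preimage_setC; exact: measurableC.
  - by move=> F mF; rewrite preimage_bigcup; exact: bigcup_measurable.
rewrite -bigcup_seq => B [i _] [A mA <-] /=; rewrite setTI.
by have := mf i measurableT _ mA; rewrite setTI.
Qed.

End measurable_rV.

Definition rV_rcons (R : realType) n (z : 'rV[R]_n * measurableTypeR R) :
    'rV[R]_n.+1 :=
  \row_i (if unlift ord_max i is Some j then z.1 0 j else z.2).

Lemma measurable_rV_rcons (R : realType) n :
  measurable_fun setT (@rV_rcons R n).
Proof.
apply: measurable_fun_rV => i /=; case: (unliftP ord_max i) => [j ->|->].
  rewrite (_ : _ \o _ = (fun x : 'rV[R]_n => x 0 j : measurableTypeR R) \o fst).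
    by apply: measurableT_comp => //; exact: measurable_coor.
  by apply/funext => z /=; rewrite mxE liftK.
rewrite (_ : _ \o _ = snd) //.
by apply/funext => z /=; rewrite mxE unlift_none.
Qed.

(* n-dimensional Lebesgue measure: the n-fold product of the Lebesgue measure
   on R, transported to row vectors. *)
Fixpoint lebesgue_rV (R : realType) (n : nat) :
    {measure set 'rV[R]_n -> \bar R} :=
  if n is m.+1 then
    measure_function_pushforward__canonical__measure_function_Measure
      ((lebesgue_rV R m \x @lebesgue_measure R)%E) (@measurable_rV_rcons R m)
  else \d_(0 : 'rV[R]_0).

Lemma lebesgue_rV_box (R : realType) n (A : 'I_n -> set (measurableTypeR R)) :
  (forall i, measurable (A i)) ->
  lebesgue_rV R n [set x | forall i, A i (x 0 i)] =
  (\prod_(i < n) lebesgue_measure (A i))%E.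
Proof.
elim: n A => [|n IHn] A mA /=.
  rewrite big_ord0 diracE mem_set //; by case.
rewrite big_ord_recr /= /pushforward.
set A' := fun i : 'I_n => A (widen_ord (leqnSn n) i).
have wE (j : 'I_n) : widen_ord (leqnSn n) j = lift ord_max j.
  by apply/val_inj; rewrite /= /bump leqNgt ltn_ord.
rewrite (_ : _ @^-1` _ =
    [set x : 'rV[R]_n | forall i, A' i (x 0 i)] `*` A ord_max); last first.
  apply/seteqP; split=> [[x t] /= h|[x t] /= [h ht] i].
    split=> [i|]; last by have := h ord_max; rewrite mxE unlift_none.
    by have := h (lift ord_max i); rewrite mxE liftK /A' wE.
  rewrite mxE; case: (unliftP ord_max i) => [j|] -> //=.
  by have := h j; rewrite /A' wE.
rewrite product_measure1E //; first by rewrite IHn // => i; exact: mA.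
rewrite (_ : [set x | _] = \bigcap_(i in [set: 'I_n])
    [set x : 'rV[R]_n | A' i (x 0 i)]); last first.
  by apply/seteqP; split=> x /= h i; [move=> _|]; exact: h.
apply: fin_bigcap_measurable => // i _.
have := @measurable_coor R n i measurableT _ (mA (widen_ord (leqnSn n) i)).
by rewrite setTI; exact.
Qed.

(* The dimension is n.+1 >= 1, and the distinguished coordinate is ord_max. *)
Section euclidean.
Variables (R : realType) (n : nat).
Implicit Types (x y : 'rV[R]_n.+1) (r : R).

(* The norm that the library puts on 'rV[R]_n is the sup norm. *)
Definition enorm x : R := Num.sqrt (\sum_i x 0 i ^+ 2).

Definition eball x r : set 'rV[R]_n.+1 := [set y | enorm (y - x) < r].

Definition halfspace : set 'rV[R]_n.+1 := [set x | 0 < x 0 ord_max].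

Definition mirror x : 'rV[R]_n.+1 :=
  \row_i (if i == ord_max then - x 0 i else x 0 i).

Definition half_ball x r := eball x r `&` halfspace.

End euclidean.
Arguments halfspace {R n}.

Section function_spaces.
Variables (R : realType) (n : nat).
Local Notation Rn := 'rV[R]_n.+1.
Local Notation mu := (lebesgue_rV R n.+1).
Local Notation leb := (@lebesgue_measure R).
Implicit Types (p r t : R) (w a f g : Rn -> R) (x y : Rn).
Implicit Types (phi : Rn -> R -> R) (A B : set Rn).

Definition locally_integrable_rV A f :=
  measurable_fun A f /\
  forall K, compact K -> K `<=` A -> mu.-integrable K (EFin \o f).

Definition weight w :=
  (forall x, 0 <= w x) /\ locally_integrable_rV setT w.

(* Weights of the two variables x and r: the domain is the product of the
   half-space and ]0, +oo[. *)
Definition weight_xr phi :=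
  let D := halfspace `*` [set r : measurableTypeR R | 0 < r] in
  let F z := phi z.1 z.2 in
  [/\ (forall x r, halfspace x -> 0 < r -> 0 < phi x r),
      measurable_fun D F &
      forall K : set (Rn * R), compact K -> K `<=` D ->
        (mu \x leb)%E.-integrable K (EFin \o F)].

Local Open Scope ereal_scope.

Definition wmeas w A : \bar R := \int[mu]_(y in A) (w y)%:E.

Definition average B (h : Rn -> \bar R) : \bar R :=
  (mu B)^-1 * \int[mu]_(y in B) h y.

(* The power w^(-1/(p-1)) is taken in \bar R, as (1/w)^(1/(p-1)), so that it
   is +oo where w vanishes; the real power powR would give 0 there. *)
Definition Ap_const p w : \bar R :=
  ereal_sup [set q | exists x r, (0 < r)%R /\
    q = average (eball x r) (fun y => (w y)%:E) *
        (average (eball x r)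
           (fun y => ((w y)%:E^-1) `^ (p - 1)^-1)) `^ (p - 1)].

Definition Muckenhoupt p w := weight w /\ Ap_const p w < +oo.

Definition mean a B : R := fine (average B (fun y => (a y)%:E)).

Definition bmo_norm a : \bar R :=
  ereal_sup [set q | exists x r, (0 < r)%R /\
    q = average (eball x r) (fun y => `|a y - mean a (eball x r)|%:E)].

Definition BMO a := locally_integrable_rV setT a /\ bmo_norm a < +oo.

Definition wLp_norm p w A f : \bar R :=
  (\int[mu]_(y in A) (`|f y| `^ p * w y)%:E) `^ p^-1.

Definition wLp p w A f := measurable_fun A f /\ wLp_norm p w A f < +oo.

Definition wLp_loc p w A f :=
  measurable_fun A f /\ forall K, compact K -> K `<=` A ->
    wLp_norm p w K f < +oo.

Definition morrey_norm p phi w f : \bar R :=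
  ereal_sup [set q | exists x r, [/\ halfspace x, (0 < r)%R &
    q = ((phi x r)^-1)%:E *
        ((wmeas w (half_ball x r))^-1 *
         \int[mu]_(y in half_ball x r) (`|f y| `^ p * w y)%:E) `^ p^-1]].

Definition morrey p phi w f :=
  wLp_loc p w halfspace f /\ morrey_norm p phi w f < +oo.

Definition leb_above t := mrestr leb (measurable_itv `]t, +oo[).

Definition weight_pair_cond p w (phi1 phi2 : Rn -> R -> R) (C1 : R) :=
  forall x r, halfspace x -> (0 < r)%R ->
    \int[leb]_(t in `]r, +oo[)
      ((1 + ln (t / r))%:E *
       (ess_inf (leb_above t)
          (fun s => (phi1 x s)%:E * (wmeas w (eball x s)) `^ p^-1) /
        (wmeas w (eball x t)) `^ p^-1) * (t^-1)%:E)
    <= (C1 * phi2 x r)%:E.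

End function_spaces.

Section operators.
Variables (R : realType) (n : nat).
Local Notation Rn := 'rV[R]_n.+1.
Local Notation mu := (lebesgue_rV R n.+1).
Implicit Types (f g a : Rn -> R) (S T : (Rn -> R) -> (Rn -> R)).
Implicit Types (D : set (Rn -> R)).

(* Functions on the half-space are represented by total functions, of which
   only the values on the half-space matter. *)
Definition supp f : set Rn := closure [set x | halfspace x /\ f x != 0].

(* L_1 functions on the half-space whose support is a compact subset of the
   (open) half-space. *)
Definition L1_compact f :=
  [/\ mu.-integrable halfspace (EFin \o f), compact (supp f) &
      supp f `<=` halfspace].

(* An operator S with linear domain D, sending measurable functions on the
   half-space to measurable functions on the half-space. Since functions are
   considered up to null sets, pointwise relations hold almost everywhere. *)
Definition sublinear_operator D S :=
  [/\ (forall f, D f ->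
         measurable_fun halfspace f /\ measurable_fun halfspace (S f)),
      (forall f g, D f -> D g -> D (fun y => f y + g y) /\
         {ae mu, forall x, halfspace x ->
            `|S (fun y => f y + g y) x| <= `|S f x| + `|S g x|}) &
      (forall (c : R) f, D f -> D (fun y => c * f y) /\
         {ae mu, forall x, halfspace x ->
            `|S (fun y => c * f y) x| = `|c| * `|S f x|})].

Definition commutator a T f : Rn -> R :=
  fun x => a x * T f x - T (fun y => a y * f y) x.

Definition commutator_dom a D : set (Rn -> R) :=
  [set f | D f /\ D (fun y => a y * f y)].

(* The restriction of f to a compact subset of the half-space; these subsets
   exhaust the half-space when k grows. A function of a Morrey space is in
   general neither compactly supported nor in L_{p,w}: the value of an operator
   at f is then understood as the limit of its values at the truncations. *)
Definition truncate f (k : nat) : Rn -> R :=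
  f \* \1_[set y | enorm y <= k%:R /\ k.+1%:R^-1 <= y 0 ord_max].

End operators.

(* Main.v *)
(** Fix a half ball B_r^+(x), let G_j be the cube with centre x and half-side
    2^j r, and split each truncation of f into its part in G_1 and its part
    outside.  On the first part the L_{p,w} bound applies; on the second one
    the kernel is at most a constant times (2^j r)^{-n} on G_{j+2} \ G_{j+1},
    where |a(x) - a(y)| is compared with
    |a(x) - a_0| + (j+2) L + |a(y) - a_{j+2}|, a_j being the mean of a over a
    ball of radius comparable to 2^j r.  Hoelder's inequality with w and the
    dual weight w^{-1/(p-1)} reduces everything to weighted mean oscillations
    of a and to the sum of the (j+2) e_j, where e_j is the L_{p,w} norm of f on
    G_{j+2} over w(G_{j+2})^{1/p}.  The condition on (phi_1, phi_2) bounds this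
    sum by phi_2(x,r), because the norm of f on B_t^+(x), divided by its Morrey
    norm, is below the essential infimum over s > t.

    The weighted mean oscillations with respect to w and to the dual weight are
    controlled without reverse Hoelder inequality: A_p alone yields theta < 1
    with w(E) <= theta w(Q) whenever E lies in a cube Q and |E| <= |Q|/2, and
    iterating a Calderon-Zygmund stopping time gives the geometric decay of
    w({|a - a_Q| > k t}).

    Fatou's lemma passes from the truncations to f.  The constant may depend on
    w, so the factor [w]^{1/p} is simply divided out. *)
Require Import Defs.
From HB Require Import structures.
From mathcomp Require Import all_boot all_order all_algebra.
From mathcomp Require Import all_classical all_reals all_analysis.
From mathcomp Require Import ess_sup_inf measurable_realfun ring lra.
Import Order.TTheory GRing.Theory Num.Theory.
Import numFieldNormedType.Exports.
Set Implicit Arguments.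
Unset Strict Implicit.
Unset Printing Implicit Defensive.
Local Open Scope classical_set_scope.
Local Open Scope ring_scope.

(** Cubes replace balls because half-open cubes split exactly into dyadic subcubes; the hypotheses
    on balls pass to cubes at the price of a dimensional constant. The reflection makes the kernel
    harmless: for x and y in the half-space each coordinate of x~ - y is at least as large in
    modulus as that of x - y. The near part lives in a cube of half-side 2r, so that the points of
    the half ball stay off the support of the far part, as the kernel bound demands. The logarithm
    in the condition on the pair pays for the factor j+2: at scale j, 1 + ln(t/r) is at least (j+2)
    ln 2.

    C is fixed before a. The estimates are therefore proved for arbitrary positive bounds A of the
    BMO norm of a and M of the Morrey norm of f, and are homogeneous in A and M; norms that may
    vanish are reached by letting A and M decrease to them.

    Since w^(-1/(p-1)) is +oo at the zeros of w, there are two kinds of weights: either w is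
    positive almost everywhere and its A_p constant is positive, or w is zero almost everywhere and
    all Morrey norms vanish. *)

Lemma lee_poweR2 (R : realType) (s : R) (x y : \bar R) :
  (0 <= s)%R -> (0 <= x)%E -> (x <= y)%E -> (x `^ s <= y `^ s)%E.
Proof.
move=> s0 x0 xy; apply: gt0_ler_poweR => //; rewrite in_itv/= leey andbT//.
exact: le_trans xy.
Qed.

(** * Integrals of nonnegative functions and Hoelder's inequality *)

Section integrals.
Context d (T : measurableType d) (R : realType).
Variable mu : {measure set T -> \bar R}.
Local Open Scope ereal_scope.

(** The integral of a nonnegative function is a supremum over the simple functions below it; a
    larger integrand only admits more of them, measurable or not. *)
Lemma le_ge0_integral (D : set T) (f g : T -> \bar R) :
  (forall x, D x -> 0 <= f x) -> (forall x, D x -> f x <= g x) ->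
  \int[mu]_(x in D) f x <= \int[mu]_(x in D) g x.
Proof.
move=> f0 fg; have g0 x : D x -> 0 <= g x.
  by move=> Dx; rewrite (le_trans (f0 _ Dx)) ?fg.
rewrite !ge0_integralE//; apply: le_ereal_sup => _ [h hf <-]; exists h => // x.
by apply: (le_trans (hf x)); exact: lee_restrict.
Qed.

Lemma subset_ge0_integral (A B : set T) (f : T -> \bar R) :
  (forall x, B x -> 0 <= f x) -> A `<=` B ->
  \int[mu]_(x in A) f x <= \int[mu]_(x in B) f x.
Proof.
move=> f0 AB; rewrite [leLHS]integral_mkcond [leRHS]integral_mkcond.
apply: le_ge0_integral => x _.
  by apply: erestrict_ge0 => y /AB; exact: f0.
rewrite /patch; case: ifPn => [|_]; first by rewrite !inE => /AB; rewrite -inE => ->.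
by case: ifPn => //; rewrite inE => /f0.
Qed.

Lemma ae_le_ge0_integral (D : set T) (f g : T -> \bar R) :
  measurable D -> measurable_fun D f ->
  (forall x, D x -> 0 <= f x) -> (forall x, D x -> 0 <= g x) ->
  {ae mu, forall x, D x -> f x <= g x} ->
  \int[mu]_(x in D) f x <= \int[mu]_(x in D) g x.
Proof.
move=> mD mf f0 g0 [N [mN N0 DN]].
rewrite (ge0_negligible_integral mN)//.
apply: (@le_trans _ _ (\int[mu]_(x in D `\` N) g x)).
  apply: le_ge0_integral => x [Dx Nx]; first exact: f0.
  by apply: contrapT => nfg; apply: Nx; apply: DN => /= /(_ Dx).
by apply: subset_ge0_integral => //; exact: subDsetl.
Qed.

Lemma ge0_integral_eq0 (D : set T) (f : T -> \bar R) :
  measurable D -> measurable_fun D f -> (forall x, D x -> 0 <= f x) ->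
  \int[mu]_(x in D) f x = 0 -> {ae mu, forall x, D x -> f x = 0}.
Proof.
move=> mD mf f0 If; apply/(ae_eq_integral_abs mu mD mf).
by rewrite -[RHS]If; apply: eq_integral => x /[!inE] Dx; rewrite gee0_abs ?f0.
Qed.

(** This is Hoelder for F^a and G^b, extended by 0 outside D, with exponents 1/a and 1/b: the norm
    of F^a with exponent 1/a is the a-th power of the integral of F. The powers then sit on the
    integrals, as in the A_p condition. *)
Lemma hoelder_integral (D : set T) (F G : T -> R) (a b : R) :
  measurable D -> measurable_fun D F -> measurable_fun D G ->
  (forall x, D x -> 0 <= F x)%R -> (forall x, D x -> 0 <= G x)%R ->
  (0 < a)%R -> (0 < b)%R -> (a + b = 1)%R ->
  \int[mu]_(x in D) ((F x `^ a) * (G x `^ b))%:E <=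
  (\int[mu]_(x in D) (F x)%:E) `^ a * (\int[mu]_(x in D) (G x)%:E) `^ b.
Proof.
move=> mD mF mG F0 G0 a0 b0 ab.
pose pw (H : T -> R) (c : R) x := ((H \_ D) x `^ c)%R.
have mpw (H : T -> R) (c : R) :
    measurable_fun D H -> measurable_fun setT (pw H c).
  move=> mH; apply: (measurableT_comp (measurable_powR c)) => //.
  exact/(measurable_restrictT _ _).1.
have := @hoelder _ T R mu (pw F a) (pw G b) a^-1 b^-1
  (mpw F a mF) (mpw G b mG).
rewrite !invr_gt0 !invrK => /(_ a0 b0 ab); rewrite Lnorm1.
have NE (H : T -> R) (c : R) : (0 < c)%R -> (forall x, D x -> 0 <= H x)%R ->
    'N[mu]_(c^-1)%:E[EFin \o pw H c] = (\int[mu]_(x in D) (H x)%:E) `^ c.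
  move=> c0 H0; rewrite unlock invrK; congr (_ `^ _).
  rewrite [RHS]integral_mkcond; apply: eq_integral => x _ /=.
  rewrite /pw /patch ger0_norm ?powR_ge0// -powRrM mulfV ?gt_eqF//.
  by case: ifPn => [/[!inE] /H0 ?|_]; rewrite powRr1.
rewrite !NE//; apply: le_trans; rewrite [leLHS]integral_mkcond.
apply: le_ge0_integral => x _; rewrite /patch.
  by case: ifPn => // _; rewrite lee_fin mulr_ge0// powR_ge0.
case: ifPn => Dx; last exact: abse_ge0.
by rewrite /= /pw /patch Dx lee_fin ler_norm.
Qed.

End integrals.

(** * Dyadic stopping times *)

Section dyadic_cells.
Context d (T : measurableType d) (R : realType).
Variables (mu : {measure set T -> \bar R}) (I : countType) (idx : nat -> T -> I).
Hypothesis nest : forall m x y, idx m.+1 x = idx m.+1 y -> idx m x = idx m y.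
Local Open Scope ereal_scope.

(** The fibres of [idx m] form the m-th of a nested sequence of partitions. Labels lie in a
    countable type so that the cells can be enumerated. *)
Definition dcell m x : set T := [set y | idx m y = idx m x].

(** The measurable open sets of the topology that has the cells as a base. *)
Definition dopen (U : set T) :=
  measurable U /\ forall x, U x -> exists m, dcell m x `<=` U.

Hypothesis mdcell : forall m x, measurable (dcell m x).

Lemma dcell_refl m x : dcell m x x. Proof. by []. Qed.

Lemma nest_le j m x y : (j <= m)%N -> idx m x = idx m y -> idx j x = idx j y.
Proof.
elim: m => [|m IHm]; first by rewrite leqn0 => /eqP ->.
by rewrite leq_eqVlt => /predU1P[->//|]; rewrite ltnS => /IHm jm /nest.
Qed.

Lemma dcell_subset j m x : (j <= m)%N -> dcell m x `<=` dcell j x.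
Proof. by move=> jm y; exact: nest_le. Qed.

Lemma dopenI U V : dopen U -> dopen V -> dopen (U `&` V).
Proof.
move=> [mU oU] [mV oV]; split; first exact: measurableI.
move=> x [/oU[j jU] /oV[k kV]]; exists (maxn j k) => y xy; split.
  by apply: jU; exact: dcell_subset (leq_maxl _ _) _ xy.
by apply: kV; exact: dcell_subset (leq_maxr _ _) _ xy.
Qed.

Lemma dopen_bigcup (U : nat -> set T) :
  (forall i, dopen (U i)) -> dopen (\bigcup_i U i).
Proof.
move=> oU; split; first by apply: bigcup_measurable => i _; have [] := oU i.
move=> x [i _ Ux]; have [_ /(_ _ Ux)[m mU]] := oU i.
by exists m => y /mU Uy; exists i.
Qed.

Lemma dopenT : dopen setT.
Proof. by split => // x _; exists 0%N. Qed.

Lemma dopen_bigcap (U : nat -> set T) N :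
  (forall i, dopen (U i)) -> dopen (\bigcap_(i < N) U i).
Proof.
move=> oU; elim: N => [|N IHN]; first by rewrite bigcap_mkord big_ord0; exact: dopenT.
by rewrite bigcap_mkord big_ord_recr /= -bigcap_mkord; exact: dopenI.
Qed.

Section regularity.
Variable Q : set T.
Hypotheses (mQ : measurable Q) (Qfin : mu Q < +oo).

(* The family of dyadically regular sets is a sigma-algebra; it serves in place of
   the Lebesgue differentiation theorem, points of the set being covered by
   cells of an open set of almost the same measure. *)
Definition dregular (A : set T) := forall e : R, (0 < e)%R ->
  exists U V, [/\ dopen U, dopen V, A `<=` U, ~` A `<=` V &
                  mu (Q `&` (U `&` V)) <= e%:E].

Lemma dregular0 : dregular set0.
Proof.
move=> e e0; exists set0, setT; split => //.
- exact: dopenT.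
by rewrite set0I setI0 measure0 lee_fin ltW.
Qed.

Lemma dregularC A : dregular A -> dregular (~` A).
Proof.
move=> rA e e0; have [U [V [oU oV AU AV UV]]] := rA e e0.
by exists V, U; rewrite setCK; split => //; rewrite (setIC V).
Qed.

(** The sets U_i unite to an open set, but only finitely many V_i can be intersected. The overlap
    [W N] left after N of them decreases to a subset of the union of the U_i [&] V_i inside Q, of
    measure at most e/2; continuity from above, Q being of finite measure, gives an N whose overlap
    is below e. *)
Lemma dregular_bigcup (A : nat -> set T) :
  (forall i, dregular (A i)) -> dregular (\bigcup_i A i).
Proof.
move=> rA e e0.
have e20 : (0 < e / 2)%R by rewrite divr_gt0.
have ei0 i : (0 < e / 2 / (2 ^ i.+1)%:R)%R.
  by rewrite divr_gt0// ltr0n expn_gt0.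
have /choice[U] : forall i, exists U, exists V, [/\ dopen U, dopen V, A i `<=` U,
   ~` A i `<=` V & mu (Q `&` (U `&` V)) <= (e / 2 / (2 ^ i.+1)%:R)%:E].
  by move=> i; exact: rA.
move=> /choice[V UV].
have oU i : dopen (U i) by have [] := UV i.
have oV i : dopen (V i) by have [] := UV i.
pose W N := Q `&` ((\bigcup_i U i) `&` \bigcap_(i < N) V i).
have mW N : measurable (W N).
  apply: measurableI => //; apply: measurableI.
    by have [] := dopen_bigcup oU.
  by have [] := @dopen_bigcap V N oV.
have WE : \bigcap_N W N `<=` \bigcup_i (Q `&` (U i `&` V i)).
  move=> x Wx; have [Qx [[i _ Ux] _]] := Wx 0%N Logic.I.
  exists i => //; split => //; split => //.
  by have [_ [_ /(_ i)]] := Wx i.+1 Logic.I; apply => /=.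
have mWE : mu (\bigcap_N W N) <= (e / 2)%:E.
  apply: (@le_trans _ _ (\sum_(i <oo) mu (Q `&` (U i `&` V i)))).
    apply: measure_sigma_subadditive => //.
    - move=> i; apply: measurableI => //.
      by have [] := dopenI (oU i) (oV i).
    - by apply: bigcapT_measurable => i; exact: mW.
  apply: le_trans (epsilon_trick0 xpredT (ltW e20)).
  by apply: lee_nneseries => // i _; case: (UV i).
have := @nonincreasing_cvg_mu _ _ _ mu W.
have W0 : mu (W 0%N) < +oo.
  apply: le_lt_trans Qfin; apply: le_measure; rewrite ?inE//.
  exact: subIsetl.
have niW : nonincreasing_seq W.
  move=> n m nm; apply/subsetPset => x [Qx [Ux Vx]]; split => //; split => //.
  by move=> i /= ni; apply: Vx => /=; exact: leq_trans ni nm.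
move=> /(_ W0 mW (bigcapT_measurable mW) niW) cW.
have [N WN] : exists N, mu (W N) < e%:E.
  apply: contrapT => /forallNP nW.
  suff : e%:E <= mu (\bigcap_N W N).
    move/le_trans => /(_ _ mWE); rewrite lee_fin leNgt ltr_pdivrMr//.
    by rewrite ltr_pMr// ltr1n.
  have /cvg_lim <- // := cW; apply: lime_ge; first by apply/cvg_ex; eexists; exact: cW.
  by apply: nearW => N /=; rewrite leNgt; apply/negP.
exists (\bigcup_i U i), (\bigcap_(i < N) V i); split.
- exact: dopen_bigcup.
- exact: dopen_bigcap.
- by move=> x [i _ Aix]; exists i => //; have [_ _ + _ _] := UV i; apply.
- move=> x nAx i _; have [_ _ _ + _] := UV i; apply => Aix.
  by apply: nAx; exists i.
- exact: ltW.
Qed.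

End regularity.

Section stopping.
Hypothesis cell_gt0 : forall m x, 0 < mu (dcell m x).
Hypothesis cell_fin : forall m x, mu (dcell m x) < +oo.
Variables (x0 : T) (U : set T).
Hypotheses (oU : dopen U) (UQ : U `<=` dcell 0 x0).
Hypothesis Usmall : 2%:E * mu U <= mu (dcell 0 x0).

Let dense m x := mu (dcell m x) < 2%:E * mu (U `&` dcell m x).
Let stop m x := dense m x /\ forall j, (j < m)%N -> ~ dense j x.
(** Stopping cells are numbered by the code of the pair (generation, label); the remaining integers
    get the empty set. *)
Let F i : set T := if @pickle_inv (nat * I)%type i is Some (m, k) then
  [set x | [/\ dcell 0 x0 x, idx m x = k & stop m x]] else set0.

Let dcell_eq j m x y : (j <= m)%N -> dcell m x y -> dcell j y = dcell j x.
Proof.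
move=> jm xy; rewrite /dcell (nest_le jm xy); by [].
Qed.

Let stop_cell m x y : dcell m x y -> stop m x -> stop m y.
Proof.
move=> xy [bx nbx]; split; first by rewrite /dense (dcell_eq (leqnn m) xy).
by move=> j jm; rewrite /dense (dcell_eq (ltnW jm) xy); exact: nbx.
Qed.

Let FE i x : F i x -> exists m, [/\ pickle (m, idx m x) = i,
  dcell 0 x0 x, stop m x & F i = dcell m x].
Proof.
rewrite /F; have := @pickle_invK (nat * I)%type i.
case: pickle_inv => // -[m k] /= pk [Qx xk sx]; exists m; split => //.
  by rewrite xk.
apply/seteqP; split => [y [_ yk _]|y xy]; first by rewrite /dcell/= yk xk.
split; [|by rewrite -xk|exact: stop_cell sx].
by rewrite /dcell/= (nest_le (leq0n m) xy).
Qed.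

Let Fmk m x : dcell 0 x0 x -> stop m x -> F (pickle (m, idx m x)) x.
Proof. by move=> Qx sx; rewrite /F pickleK_inv. Qed.

(** The F i are the maximal cells more than half filled by U. A point of U has a cell inside U,
    hence filled, so it is covered; each F i weighs at most twice its part in U, which sums to the
    bound on the union. By maximality the parent of an F i is at most half filled, and [Usmall]
    excludes stopping at generation 0, so that a parent exists. *)
Lemma stopping_cells : exists F : nat -> set T,
  [/\ trivIset setT F, forall i, measurable (F i), U `<=` \bigcup_i F i,
      \bigcup_i F i `<=` dcell 0 x0 /\ mu (\bigcup_i F i) <= 2%:E * mu U &
      forall i, F i = set0 \/ exists m x, [/\ dcell 0 x0 x, F i = dcell m.+1 x &
        2%:E * mu (U `&` dcell m x) <= mu (dcell m x)]].
Proof.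
have mF i : measurable (F i).
  have [->|/set0P[x /FE[m [_ _ _ ->]]]] := eqVneq (F i) set0; first by [].
  exact: mdcell.
have tF : trivIset setT F.
  apply/trivIsetP => i j _ _ ij; rewrite -subset0 => x [].
  move=> /FE[m [mi _ [bm nm] _]] /FE[k [kj _ [bk nk] _]].
  case: (ltngtP m k) => [/nk|/nm|mk]; [exact..|].
  by move: ij; rewrite -mi -kj mk eqxx.
exists F; split => //.
- move=> x Ux; have [_ /(_ _ Ux)[m mU]] := oU.
  have : exists m, `[< dense m x >].
    exists m; apply/asboolP; rewrite /dense setIidr//.
    have := cell_gt0 m x; have := cell_fin m x.
    by case: (mu _) => // r _ r0; rewrite lte_fin ltr_pMl// ltr1n.
  move=> /ex_minnP[k /asboolP bk mk].
  exists (pickle (k, idx k x)) => //; apply: Fmk; first exact: UQ.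
  by split => // j jk bj; move: jk; rewrite ltnNge mk//; exact/asboolP.
- split; first by move=> x [i _ /FE[m [_ + _ _]]].
  rewrite measure_bigcup//=.
  have mU : measurable U by have [] := oU.
  apply: (@le_trans _ _ (\sum_(i <oo | i \in setT) 2%:E * mu (U `&` F i))).
    apply: lee_nneseries => // i _.
    have [->|/set0P[x Fx]] := eqVneq (F i) set0.
      by rewrite setI0 measure0 mule0.
    by have [m [_ _ [bx _] ->]] := FE Fx; exact: ltW.
  rewrite nneseriesZl//; apply: lee_wpmul2l => //.
  have mUF i : measurable (U `&` F i) by exact: measurableI.
  rewrite -measure_bigcup//=; last exact: trivIset_setIl.
  apply: le_measure; rewrite ?inE//.
    by apply: bigcup_measurable => i _; exact: measurableI.
  by move=> x [i _ []].
- move=> i; have [->|/set0P[x Fx]] := eqVneq (F i) set0; first by left.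
  right; have [[|m] [_ Qx [bx nb] Fm]] := FE Fx; last first.
    by exists m, x; split => //; rewrite leNgt; apply/negP; exact: nb.
  move: bx; rewrite /dense (dcell_eq (leqnn 0) Qx) ltNge => /negP[].
  by rewrite setIidl.
Qed.

End stopping.
End dyadic_cells.

(** * Half-open cubes and their dyadic grid *)

Section cubes.
Variables (R : realType) (n : nat).
Local Notation Rn := 'rV[R]_n.
Local Notation mu := (lebesgue_rV R n).
Implicit Types (c x y : Rn) (l : R).

(** The point c is the lower corner, not the centre. *)
Definition cube c l : set Rn :=
  [set x | forall i, (`[c 0 i, c 0 i + l[%classic : set R) (x 0 i)].

Lemma cubeP c l x :
  cube c l x <-> forall i, c 0 i <= x 0 i < c 0 i + l.
Proof. by split => h i; have := h i; rewrite /= in_itv. Qed.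

Lemma measurable_coor_itv (i : 'I_n) (A : set (measurableTypeR R)) :
  measurable A -> measurable [set x : Rn | A (x 0 i)].
Proof.
by move=> mA; have := measurable_coor i measurableT mA; rewrite setTI.
Qed.

Lemma measurable_cube c l : measurable (cube c l).
Proof.
rewrite (_ : cube c l = \bigcap_(i in [set: 'I_n])
    [set x : Rn | (`[c 0 i, c 0 i + l[%classic : set R) (x 0 i)]); last first.
  by apply/seteqP; split => x h i; [move=> _|]; exact: h.
by apply: fin_bigcap_measurable => // i _; exact: measurable_coor_itv.
Qed.

Lemma lebesgue_cube c l : 0 <= l -> mu (cube c l) = (l ^+ n)%:E.
Proof.
move=> l0; rewrite [LHS](lebesgue_rV_box
  (A := fun i => `[c 0 i, c 0 i + l[%classic))//.
rewrite (eq_bigr (fun=> l%:E)) => [|i _]; last first.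
  rewrite lebesgue_measure_itv /= lte_fin ltrDl; case: ltP => [_|l1].
    by rewrite -EFinB addrC addKr.
  by congr EFin; apply/eqP; rewrite eq_le l0 l1.
by rewrite prodEFin prodr_const card_ord.
Qed.

Section grid.
Variables (c : Rn) (l : R).
Hypothesis l0 : 0 < l.

(** Integer coordinates of x in the grid of mesh l / 2^m anchored at c; the grid covers the whole
    space and [cube c l] is its cell of generation 0 at c. *)
Definition gidx m x : {ffun 'I_n -> int} :=
  [ffun i => Num.floor ((x 0 i - c 0 i) / l * 2 ^+ m)].

(** An even integer is at most 2t exactly when it is at most the floor of 2t, so the floor of 2t
    determines that of t. *)
Lemma gidx_nest m x y : gidx m.+1 x = gidx m.+1 y -> gidx m x = gidx m y.
Proof.
move=> /ffunP xy; apply/ffunP => i; have := xy i; rewrite !ffunE !exprS.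
set a := (_ / l); set b := (_ / l) => ab.
apply/esym/eqP; rewrite floor_eq; apply/andP; split.
  have h : (Num.floor (a * 2 ^+ m) * 2)%:~R <= b * (2 * 2 ^+ m) :> R.
    rewrite -floor_ge_int -ab floor_ge_int intrM.
    have := floor_le (a * 2 ^+ m); lra.
  move: h; rewrite intrM; lra.
have h : a * (2 * 2 ^+ m) < ((Num.floor (b * 2 ^+ m) + 1) * 2)%:~R.
  rewrite -floor_lt_int ab floor_lt_int intrM.
  have := floorD1_gt (b * 2 ^+ m); lra.
have h' : b * 2 ^+ m < ((Num.floor (a * 2 ^+ m) + 1))%:~R.
  rewrite ltNge; apply/negP => h1.
  have h2 : ((Num.floor (a * 2 ^+ m) + 1) * 2)%:~R <= b * (2 * 2 ^+ m).
    by rewrite intrM; lra.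
  move: h2; rewrite -floor_ge_int -ab floor_ge_int intrM.
  by have := floorD1_gt (a * 2 ^+ m); lra.
exact: h'.
Qed.

Lemma gcellE m x : dcell gidx m x = cube
  (\row_i (c 0 i + (gidx m x i)%:~R * (l / 2 ^+ m))) (l / 2 ^+ m).
Proof.
have m0 : 0 < 2 ^+ m :> R by rewrite exprn_gt0.
have scale (y : Rn) i (k : int) :
    (Num.floor ((y 0 i - c 0 i) / l * 2 ^+ m) == k) =
    (c 0 i + k%:~R * (l / 2 ^+ m) <= y 0 i <
     c 0 i + k%:~R * (l / 2 ^+ m) + l / 2 ^+ m).
  rewrite floor_eq intrD; congr (_ && _).
    by rewrite -ler_pdivrMr// ler_pdivlMr// lerBrDl [in RHS]mulrA -mulrAC.
  by rewrite -ltr_pdivlMr// ltr_pdivrMr// ltrBlDl -addrA; congr (_ < _ + _); lra.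
apply/seteqP; split => [y xy|y /cubeP xy].
  by apply/cubeP => i; rewrite mxE -scale -xy ffunE.
apply/ffunP => i; have := xy i; rewrite mxE -scale => /eqP <-.
by rewrite ffunE.
Qed.

Lemma gcell0 : dcell gidx 0 c = cube c l.
Proof.
rewrite gcellE expr0 divr1; congr cube; apply/rowP => i.
by rewrite mxE ffunE subrr mul0r mul0r floor0 mul0r addr0.
Qed.

Lemma measurable_gcell m x : measurable (dcell gidx m x).
Proof. by rewrite gcellE; exact: measurable_cube. Qed.

Lemma gcell_side_gt0 m : 0 < l / 2 ^+ m :> R.
Proof. by rewrite divr_gt0// exprn_gt0. Qed.

Lemma lebesgue_gcell m x : mu (dcell gidx m x) = ((l / 2 ^+ m) ^+ n)%:E.
Proof. by rewrite gcellE lebesgue_cube// ltW// gcell_side_gt0. Qed.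

Lemma gcell_near m x y i :
  dcell gidx m x y -> `|y 0 i - x 0 i| < l / 2 ^+ m.
Proof.
move=> xy; have := dcell_refl gidx m x; move: xy.
rewrite gcellE => /cubeP/(_ i) xy /cubeP/(_ i) xx.
by rewrite ltr_norml; lra.
Qed.

Lemma gcell_side_lt (e : R) : 0 < e -> exists m, l / 2 ^+ m < e.
Proof.
move=> e0; exists (Num.Def.trunc (l / e)).+1.
rewrite ltr_pdivrMr ?exprn_gt0// -ltr_pdivrMl// mulrC.
have le0 : 0 <= l / e by rewrite divr_ge0 // ltW.
have := truncnS_gt (l / e) => /lt_le_trans; apply.
by rewrite -natrX ler_nat ltnW// ltn_expl.
Qed.

Lemma dopen_gt i (r : R) : dopen gidx [set x : Rn | r < x 0 i].
Proof.
split.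
  have := @measurable_coor_itv i `]r, +oo[%classic (measurable_itv _).
  by congr measurable; apply/seteqP; split => x /=; rewrite in_itv/= andbT.
move=> x /= rx; have [|m lm] := @gcell_side_lt (x 0 i - r); first by rewrite subr_gt0.
by exists m => y /(gcell_near i) /=; rewrite ltr_norml; lra.
Qed.

Lemma dopen_lt i (r : R) : dopen gidx [set x : Rn | x 0 i < r].
Proof.
split.
  have := @measurable_coor_itv i `]-oo, r[%classic (measurable_itv _).
  by congr measurable; apply/seteqP; split => x /=; rewrite in_itv.
move=> x /= rx; have [|m lm] := @gcell_side_lt (r - x 0 i); first by rewrite subr_gt0.
by exists m => y /(gcell_near i) /=; rewrite ltr_norml; lra.
Qed.

Local Open Scope ereal_scope.

(** The set is itself a union of cells, and its complement is covered by the open sets x_i < r +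
    1/(k+1); the overlaps shrink to the empty set. *)
Lemma dregular_gt i (r : R) :
  dregular mu gidx (cube c l) [set x : Rn | (r < x 0 i)%R].
Proof.
move=> e e0.
pose W k := cube c l `&` ([set x : Rn | (r < x 0 i)%R] `&`
   [set x : Rn | (x 0 i < r + k.+1%:R^-1)%R]).
have mW k : measurable (W k).
  apply: measurableI; first exact: measurable_cube.
  by apply: measurableI; [exact: (dopen_gt i r).1|exact: (dopen_lt i _).1].
have W0 : mu (W 0%N) < +oo.
  apply: (@le_lt_trans _ _ (mu (cube c l))).
    apply: le_measure; rewrite ?inE//; [exact: measurable_cube|exact: subIsetl].
  by rewrite lebesgue_cube ?ltry// ltW.
have niW : nonincreasing_seq W.
  move=> j k jk; apply/subsetPset => x [Qx [/= rx xk]]; split => //; split => //=.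
  by apply: lt_le_trans xk _; rewrite lerD2l lef_pV2 ?posrE// ler_nat.
have WE : \bigcap_k W k = set0.
  rewrite -subset0 => x Wx; have [_ [/= rx _]] := Wx 0%N Logic.I.
  have xr : (0 < x 0 i - r)%R by rewrite subr_gt0.
  have [_ [_ /= ]] := Wx (Num.Def.trunc (x 0 i - r)^-1)%R Logic.I.
  rewrite -ltrBlDl => /(lt_trans _) h; have := truncnS_gt ((x 0 i - r)^-1)%R.
  by rewrite invf_plt ?posrE// => /h; rewrite ltxx.
have cW := nonincreasing_cvg_mu W0 mW (bigcapT_measurable mW) niW.
have [k Wk] : exists k, mu (W k) < e%:E.
  apply: contrapT => /forallNP nW.
  suff : e%:E <= mu (\bigcap_k W k).
    by rewrite WE measure0 lee_fin leNgt e0.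
  have /cvg_lim <- // := cW; apply: lime_ge; first by apply/cvg_ex; eexists; exact: cW.
  by apply: nearW => N /=; rewrite leNgt; apply/negP.
exists [set x : Rn | (r < x 0 i)%R], [set x : Rn | (x 0 i < r + k.+1%:R^-1)%R]; split => //.
- exact: dopen_gt.
- exact: dopen_lt.
- move=> x /= /negP; rewrite -leNgt => xr; apply: (le_lt_trans xr).
  by rewrite ltrDl.
- exact: ltW.
Qed.

(** Regular sets being closed under complements and countable unions, it is enough to treat
    generators: preimages of Borel sets under the coordinates, and among Borel sets the open
    half-lines. *)
Lemma dregular_measurable (A : set Rn) :
  measurable A -> dregular mu gidx (cube c l) A.
Proof.
have mQ := measurable_cube c l.
have Qf : mu (cube c l) < +oo by rewrite lebesgue_cube ?ltry// ltW.
have setsig (B : set (set Rn)) : B `<=` dregular mu gidx (cube c l) ->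
    <<s B >> `<=` dregular mu gidx (cube c l).
  move=> BD; apply: smallest_sub => //; split.
  - exact: dregular0.
  - by move=> C rC; rewrite setTD; exact: dregularC.
  - move=> F rF; apply: (dregular_bigcup gidx_nest) => //.
move: A; apply: (@setsig) => A; rewrite -bigcup_seq => -[i _] [B mB <-].
rewrite setTI.
suff : <<s RGenOInfty.G (R := R) >> `<=`
  [set B | dregular mu gidx (cube c l) [set x : Rn | B (x ord0 i)]].
  by apply; move: mB; rewrite RGenOInfty.measurableE.
apply: smallest_sub => [|C [r ->]]; last first.
  have := @dregular_gt i r; congr dregular.
  by apply/seteqP; split => x /=; rewrite in_itv/= andbT.
split => /=.
- exact: dregular0.
- move=> C rC; have := dregularC rC; congr (dregular _ _ _).
  by apply/seteqP; split => x /=; [split|case].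
- by move=> F rF; exact: (dregular_bigcup gidx_nest mQ Qf rF).
Qed.

End grid.
End cubes.

(** * The John-Nirenberg inequality for A-infinity weights *)

Section mean_oscillation.
Context d (T : measurableType d) (R : realType).
Variable mu : {measure set T -> \bar R}.
Local Open Scope ereal_scope.

Lemma markov_integral (D : set T) (f : T -> R) (r : R) :
  measurable D -> measurable_fun D f -> (forall x, D x -> 0 <= f x)%R ->
  (0 <= r)%R ->
  r%:E * mu (D `&` [set x | r < f x]%R) <= \int[mu]_(x in D) (f x)%:E.
Proof.
move=> mD mf f0 r0; set E := D `&` _.
have mE : measurable E.
  rewrite (_ : E = D `&` f @^-1` `]r, +oo[%classic); first exact: mf.
  by apply/seteqP; split => x /= []; rewrite in_itv/= andbT.
rewrite -integral_cst//.
apply: (@le_trans _ _ (\int[mu]_(x in E) (f x)%:E)).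
  by apply: le_ge0_integral => x //= [Dx /ltW].
by apply: subset_ge0_integral => [x /f0//|]; exact: subIsetl.
Qed.

(** Integrate |u - v| <= |a - u| + |a - v| over S. Constants attached to neighbouring cubes are
    compared in this way, on a set S common to both. *)
Lemma constants_close (S : set T) (a : T -> R) (u v X Y z : R) :
  measurable S -> measurable_fun S a ->
  \int[mu]_(x in S) (`|a x - u|)%:E <= X%:E ->
  \int[mu]_(x in S) (`|a x - v|)%:E <= Y%:E ->
  z%:E <= mu S -> (`|u - v| * z <= X + Y)%R.
Proof.
move=> mS ma aX aY zS; rewrite -lee_fin EFinD.
have mn (t : R) : measurable_fun S (fun x => (`|a x - t|)%:E).
  apply/measurable_EFinP; apply: measurableT_comp => //.
  exact: measurable_funB.
apply: (@le_trans _ _ (\int[mu]_(x in S) (`|a x - u|)%:E + \int[mu]_(x in S) (`|a x - v|)%:E)).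
  rewrite -ge0_integralD//.
  apply: (@le_trans _ _ (`|u - v|%:E * mu S)).
    by rewrite EFinM; apply: lee_wpmul2l.
  rewrite -integral_cst//; apply: le_ge0_integral => x _ //=.
  rewrite -EFinD lee_fin (_ : u - v = (a x - v) - (a x - u))%R; last by lra.
  by rewrite [leRHS]addrC; exact: ler_normB.
exact: leeD.
Qed.

End mean_oscillation.

Section john_nirenberg.
Variables (R : realType) (n : nat).
Local Notation Rn := 'rV[R]_n.
Local Notation mu := (lebesgue_rV R n).
Variables (a : Rn -> R) (u : Rn -> R -> R) (A : R).
Hypotheses (A0 : 0 < A) (ma : measurable_fun setT a).
Local Open Scope ereal_scope.
Hypothesis osc : forall c l, (0 < l)%R ->
  \int[mu]_(x in cube c l) (`|a x - u c l|)%:E <= (A * l ^+ n)%:E.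

(** 18 A is the cost of passing from the initial cube to the parent of a stopping cell, and (1 +
    2^n) A that of passing from the parent to the cell. *)
Definition jn_step : R := ((19 + 2 ^+ n) * A)%R.

Let mnorm (S : set Rn) (t : R) : measurable_fun S (fun x => `|a x - t|%R).
Proof.
apply: measurableT_comp => //; apply: measurable_funB => //.
exact: measurable_funTS.
Qed.

Let mosc (S : set Rn) (t r : R) : measurable S ->
  measurable (S `&` [set x | (r < `|a x - t|)%R]).
Proof.
move=> mS; rewrite (_ : [set x | _] = (fun x => `|a x - t|%R) @^-1` `]r, +oo[%classic).
  exact: mnorm.
by apply/seteqP; split => x /=; rewrite in_itv/= andbT.
Qed.

(* The stopping cells cover an open neighbourhood of the exceptional set. Each of
   them has a parent at least half of which lies outside that neighbourhood, and
   this bounds the oscillation between the cell and the initial cube. *)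
Lemma calderon_zygmund c l : (0 < l)%R -> exists F : nat -> set Rn,
  [/\ trivIset setT F, forall i, measurable (F i),
   cube c l `&` [set x | (8 * A < `|a x - u c l|)%R] `<=` \bigcup_i F i,
   \bigcup_i F i `<=` cube c l /\ mu (\bigcup_i F i) <= (l ^+ n / 2)%:E &
   forall i, F i = set0 \/ exists c' l',
     [/\ (0 < l')%R, F i = cube c' l' & (`|u c' l' - u c l| <= jn_step)%R]].
Proof.
move=> l0; set E := cube c l `&` [set x | (8 * A < `|a x - u c l|)%R].
have mQ := measurable_cube c l.
have mE : measurable E by exact: mosc.
have ln0 : (0 < l ^+ n)%R by rewrite exprn_gt0.
have muE : mu E <= (l ^+ n / 8)%:E.
  have := @markov_integral _ _ _ mu _ (fun x => `|a x - u c l|)%R (8 * A)%R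
    mQ (mnorm _) (fun x _ => normr_ge0 _).
  have A8 : (0 < 8 * A)%R by rewrite mulr_gt0.
  move=> /(_ (ltW A8))/le_trans => /(_ _ (osc c l0)).
  have Efin : mu E \is a fin_num.
    rewrite ge0_fin_numE//; apply: (@le_lt_trans _ _ (mu (cube c l))).
      by apply: le_measure; rewrite ?inE//; exact: subIsetl.
    by rewrite lebesgue_cube ?ltry// ltW.
  rewrite -/E -(fineK Efin) -EFinM !lee_fin -mulrA mulrCA ler_pM2l//.
  by rewrite ler_pdivlMr// mulrC.
(* The level 8A gives [E] at most 1/8 of the cube by Markov. A tolerance of another 1/8 keeps the
   open neighbourhood within 1/4, hence the stopping cells within 1/2. *)
have [|U [V [oU oV EU EV UV]]] := @dregular_measurable R n c l l0 E mE (l ^+ n / 8)%R.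
  by rewrite divr_gt0.
have oQ : dopen (gidx c l) (cube c l).
  split => // x; rewrite -gcell0// => Qx; exists 0%N => y.
  by rewrite /dcell/= Qx.
pose W := U `&` cube c l.
have oW : dopen (gidx c l) W by apply: dopenI => //; exact: gidx_nest.
have EW : E `<=` W by move=> x Ex; split; [exact: EU|case: Ex].
have muW : mu W <= (l ^+ n / 4)%:E.
  apply: (@le_trans _ _ (mu (E `|` cube c l `&` (U `&` V)))).
    apply: le_measure; rewrite ?inE//.
      by case: oW.
      by apply: measurableU => //; apply: measurableI => //; apply: measurableI;
        [case: oU|case: oV].
    move=> x [Ux Qx]; have [Ex|/EV Vx] := pselect (E x); first by left.
    by right.
  apply: le_trans (measureU2 _ _ _) _ => //.
    by apply: measurableI => //; apply: measurableI; [case: oU|case: oV].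
  apply: (le_trans (leeD muE UV)); rewrite -EFinD lee_fin; lra.
have muQ : mu (cube c l) = (l ^+ n)%:E by rewrite lebesgue_cube// ltW.
have cfin m x : mu (dcell (gidx c l) m x) < +oo.
  by rewrite lebesgue_gcell// ltry.
have cgt0 m x : 0 < mu (dcell (gidx c l) m x).
  by rewrite lebesgue_gcell// lte_fin exprn_gt0// gcell_side_gt0.
have WQ : W `<=` dcell (gidx c l) 0 c by rewrite gcell0//; exact: subIsetr.
have Wsmall : 2%:E * mu W <= mu (dcell (gidx c l) 0 c).
  rewrite gcell0// muQ (le_trans (lee_wpmul2l _ muW))//.
  by rewrite -EFinM lee_fin; lra.
have [F [tF mF WF [FQ muF] cF]] := stopping_cells (@gidx_nest _ _ c l)
  (measurable_gcell c l0) cgt0 cfin oW WQ Wsmall.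
exists F; split => //.
- exact: subset_trans EW WF.
- split; first by move: FQ; rewrite gcell0.
  rewrite (le_trans muF)// (le_trans (lee_wpmul2l _ muW))//.
  by rewrite -EFinM lee_fin; lra.
move=> i; have [->|[m [x [Qx -> Pm]]]] := cF i; [by left|right].
set k := (l / 2 ^+ m)%R; have k0 : (0 < k)%R by exact: gcell_side_gt0.
have k20 : (0 < k / 2)%R by rewrite divr_gt0.
have kS : (l / 2 ^+ m.+1 = k / 2)%R by rewrite exprS invfM mulrCA mulrC.
move: (lebesgue_gcell c l0 m x) (measurable_gcell c l0 m x).
have := @dcell_subset _ _ _ _ (@gidx_nest _ _ c l) m m.+1 x (leqnSn m).
have := @dcell_subset _ _ _ _ (@gidx_nest _ _ c l) 0 m x (leq0n m).
rewrite (_ : dcell _ 0 x = cube c l); last first.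
  by rewrite -(gcell0 c l0) /dcell /= Qx.
move: Pm; rewrite !gcellE// kS -/k.
set c2 := (\row__ _); set c3 := (\row__ _).
move=> Pm PQ CP muP mP; exists c3, (k / 2)%R; split => //.
(* Child against parent, compared on the child: the parent is 2^n times larger. *)
have S2 : (`|u c3 (k / 2) - u c2 k| * (k / 2) ^+ n <= A * (k / 2) ^+ n + A * k ^+ n)%R.
  apply: (@constants_close _ _ _ mu (cube c3 (k / 2)) a).
  - exact: measurable_cube.
  - exact: measurable_funTS.
  - exact: osc.
  - apply: le_trans (osc c2 k0); exact: subset_ge0_integral.
  - by rewrite lebesgue_cube// ltW.
(* Parent against initial cube, compared on the parent minus W: this is at least half of the parent,
   and there |a - u c l| <= 8A because W contains the exceptional set. *)
have S1 : (`|u c2 k - u c l| * (k ^+ n / 2) <= A * k ^+ n + 8 * A * k ^+ n)%R.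
  apply: (@constants_close _ _ _ mu (cube c2 k `\` W) a).
  - by apply: measurableD => //; case: oW.
  - exact: measurable_funTS.
  - by apply: le_trans (osc c2 k0); apply: subset_ge0_integral => //; exact: subDsetl.
  - apply: (@le_trans _ _ (\int[mu]_(x in cube c2 k) (8 * A)%:E)).
      apply: (@le_trans _ _ (\int[mu]_(x in cube c2 k `\` W) (8 * A)%:E)).
        apply: le_ge0_integral => // y [Py nWy]; rewrite lee_fin leNgt.
        by apply/negP => Ey; apply: nWy; apply: EW; split => //; exact: PQ.
      apply: subset_ge0_integral; last exact: subDsetl.
      by move=> y _; rewrite lee_fin mulr_ge0// ltW.
    by rewrite integral_cst// muP -EFinM.
  - have mW : measurable W by case: oW.
    have PW : mu (cube c2 k) = mu (cube c2 k `&` W) + mu (cube c2 k `\` W).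
      by rewrite addeC -measureDI.
    move: Pm PW; rewrite setIC muP.
    have f1 : mu (cube c2 k `&` W) \is a fin_num.
      rewrite ge0_fin_numE//; apply: (@le_lt_trans _ _ (mu (cube c2 k))).
        by apply: le_measure; rewrite ?inE//; exact: measurableI.
      by rewrite muP ltry.
    have f2 : mu (cube c2 k `\` W) \is a fin_num.
      rewrite ge0_fin_numE//; apply: (@le_lt_trans _ _ (mu (cube c2 k))).
        by apply: le_measure; rewrite ?inE//; exact: measurableD.
      by rewrite muP ltry.
    rewrite -(fineK f1) -(fineK f2) -EFinM -EFinD lee_fin => + [].
    by rewrite lee_fin; lra.
have kn0 : (0 < k ^+ n)%R by rewrite exprn_gt0.
have {}S1 : (`|u c2 k - u c l| <= 18 * A)%R.
  rewrite -(ler_pM2r kn0); lra.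
have {}S2 : (`|u c3 (k / 2) - u c2 k| <= A + 2 ^+ n * A)%R.
  have k2n0 : (0 < (k / 2) ^+ n)%R by rewrite exprn_gt0.
  rewrite -(ler_pM2r k2n0); apply: (le_trans S2).
  by rewrite mulrDl lerD2l mulrAC -exprMn mulrC (mulrC 2%R) divfK.
rewrite (_ : u c3 (k / 2) - u c l =
  (u c3 (k / 2) - u c2 k) + (u c2 k - u c l))%R; last by lra.
apply: (le_trans (ler_normD _ _)); apply: (le_trans (lerD S2 S1)).
by rewrite /jn_step mulrDl; lra.
Qed.

Variables (w : Rn -> R) (th : R).
Hypotheses (w0 : forall x, (0 <= w x)%R) (mw : measurable_fun setT w).
Hypotheses (th0 : (0 <= th)%R).
Hypothesis wth : forall c l (E : set Rn), (0 < l)%R -> measurable E ->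
  E `<=` cube c l -> mu E <= (l ^+ n / 2)%:E ->
  \int[mu]_(x in E) (w x)%:E <= th%:E * \int[mu]_(x in cube c l) (w x)%:E.

(** Induction on k for all cubes at once. A point of level k+1 lies in a stopping cell, whose
    constant differs from that of the cube by at most one step; it thus has level k relative to the
    cell. The cells fill at most half of the cube, which yields one factor th. *)
Lemma john_nirenberg_decay k c l : (0 < l)%R ->
  \int[mu]_(x in cube c l `&` [set x | (k%:R * jn_step < `|a x - u c l|)%R]) (w x)%:E
  <= (th ^+ k)%:E * \int[mu]_(x in cube c l) (w x)%:E.
Proof.
have mwE (S : set Rn) : measurable_fun S (EFin \o w).
  by apply/measurable_EFinP; exact: measurable_funTS.
have w0E (S : set Rn) x : S x -> 0 <= (EFin \o w) x by rewrite lee_fin.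
have K8 : (8 * A <= jn_step)%R.
  rewrite /jn_step ler_pM2r//; have : (0 <= 2 ^+ n :> R)%R by rewrite exprn_ge0.
  by lra.
elim: k c l => [|k IHk] c l l0.
  rewrite expr0 mul1e; apply: subset_ge0_integral => //; exact: w0E.
have [F [tF mF EF [FQ muF] cF]] := calderon_zygmund c l0.
set G := _ `&` _.
have mG : measurable G by apply: mosc; exact: measurable_cube.
have GF : G `<=` \bigcup_i (F i `&` G).
  move=> x Gx; have [i _ Fx] : (\bigcup_i F i) x.
    apply: EF; case: Gx => Qx /= Kx; split => //=; apply: le_lt_trans Kx.
    rewrite (le_trans K8)// ler_peMl ?ler1n//.
    by apply: le_trans K8; rewrite mulr_ge0// ltW.
  by exists i.
apply: (@le_trans _ _ (\int[mu]_(x in \bigcup_i (F i `&` G)) (w x)%:E)).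
  by apply: subset_ge0_integral => //; exact: w0E.
have mFG i : measurable (F i `&` G) by exact: measurableI.
rewrite ge0_integral_bigcup//=; last exact: trivIset_setIr.
have Fk i : \int[mu]_(x in F i `&` G) (w x)%:E <=
    (th ^+ k)%:E * \int[mu]_(x in F i) (w x)%:E.
  have [->|[c' [l' [l'0 -> uK]]]] := cF i.
    by rewrite set0I !integral_set0 mule0.
  apply: le_trans (IHk _ _ l'0); apply: subset_ge0_integral; first exact: w0E.
  move=> x [Fx [_ /= Kx]]; split => //=; move: Kx.
  rewrite -natr1 mulrDl mul1r => Kx.
  have : (`|a x - u c l| <= `|a x - u c' l'| + `|u c' l' - u c l|)%R.
    by rewrite (le_trans _ (ler_normD _ _))// addrA subrK.
  by lra.
apply: (@le_trans _ _ (\sum_(i <oo) (th ^+ k)%:E * \int[mu]_(x in F i) (w x)%:E)).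
  apply: lee_nneseries => [i _ _|i _]; last exact: Fk.
  by apply: integral_ge0 => x _; rewrite lee_fin.
rewrite nneseriesZl; last first.
  by move=> i _; apply: integral_ge0 => x _; rewrite lee_fin.
rewrite -ge0_integral_bigcup//.
rewrite exprSr EFinM -muleA; apply: lee_wpmul2l; first by rewrite lee_fin exprn_ge0.
  by apply: wth => //; exact: bigcup_measurable.
all: by move=> x _; rewrite lee_fin.
Qed.

End john_nirenberg.

(** From y <= exp y one gets k^s <= de^(-s) rho^k with rho = exp(s de). The choice of de makes rho
    equal to t^(-1/2), so that the terms stay below a geometric sequence of ratio q, the square root
    of t. *)
Lemma powR_geometric_bounded (R : realType) (s th : R) :
  0 < s -> 0 <= th < 1 -> exists2 S : R, 0 <= S &
  forall N, \sum_(0 <= k < N) (k.+1%:R `^ s * th ^+ k) <= S.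
Proof.
move=> s0 /andP[th0 th1].
(* Between th and 1, and positive even for th = 0, so that ln t makes sense. *)
pose t := (1 + th) / 2; have t01 : 0 < t < 1 by rewrite /t; lra.
have [t0 t1] := andP t01.
have lt0 : ln t < 0 by rewrite ln_lt0.
pose q := expR (ln t / 2); have q1 : q < 1 by rewrite expR_lt1; lra.
have q0 : 0 < q by exact: expR_gt0.
pose de := - ln t / (2 * s); have de0 : 0 < de.
  by rewrite divr_gt0 ?oppr_gt0// mulr_gt0.
pose rho := expR (s * de).
have rhot : rho * t = q.
  rewrite /rho /q -[X in _ * X](lnK (x := t)) ?posrE// -expRD; congr expR.
  by rewrite /de; field; rewrite gt_eqF.
exists (de `^ (- s) * rho / (1 - q)).
  by rewrite divr_ge0 ?mulr_ge0 ?powR_ge0 ?expR_ge0// subr_ge0 ltW.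
move=> N; have := @geometric_le_lim R N (de `^ (- s) * rho) q.
rewrite mulr_ge0 ?powR_ge0 ?expR_ge0// q0 ger0_norm ?(ltW q0)// => /(_ isT isT q1).
apply: le_trans; rewrite /series /=; apply: ler_sum => k _.
have y0 : 0 <= k.+1%:R :> R by [].
have h1 : k.+1%:R `^ s <= de `^ (- s) * rho ^+ k.+1.
  have : k.+1%:R <= de^-1 * expR (de * k.+1%:R).
    rewrite mulrC ler_pdivlMr// mulrC.
    by apply: le_trans (expR_ge1Dx _); rewrite lerDr.
  move=> /(@ge0_ler_powR _ s (ltW s0)); rewrite !nnegrE => /(_ y0).
  rewrite mulr_ge0 ?invr_ge0 ?expR_ge0 ?(ltW de0)// => /(_ isT)/le_trans; apply.
  rewrite powRM ?invr_ge0 ?expR_ge0 ?(ltW de0)// -powR_inv1 ?(ltW de0)// -powRrM mulN1r.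
  by rewrite ler_pM2l ?powR_gt0// -expRM -expRM_natr /rho -mulrA mulrC mulrA.
have h2 : th ^+ k <= t ^+ k.
  by apply: lerXn2r; rewrite ?nnegrE// ?(ltW t0)// /t; lra.
apply: le_trans (ler_pM (powR_ge0 _ _) (exprn_ge0 _ th0) h1 h2) _.
by rewrite exprS -!mulrA -exprMn rhot.
Qed.

Section moments.
Variables (R : realType) (n : nat).
Local Notation Rn := 'rV[R]_n.
Local Notation mu := (lebesgue_rV R n).
Local Open Scope ereal_scope.

(** Layer decomposition: with k least such that |a - u| <= (k+1) K, a point where |a - u| > 0 lies
    in [G k] and |a - u|^s is at most the k-th term ((k+1) K)^s. Integrating the series of these
    terms against w and using the geometric decay leaves the sum bounded by S. *)
Lemma john_nirenberg_moment (s th S A : R) (a w : Rn -> R) (u : Rn -> R -> R) :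
  (0 < s)%R -> (0 <= th)%R -> (0 <= S)%R ->
  (forall N, \sum_(0 <= k < N) (k.+1%:R `^ s * th ^+ k) <= S)%R ->
  (0 < A)%R -> measurable_fun setT a ->
  (forall c l, (0 < l)%R ->
    \int[mu]_(x in cube c l) (`|a x - u c l|)%:E <= (A * l ^+ n)%:E) ->
  (forall x, (0 <= w x)%R) -> measurable_fun setT w ->
  (forall c l (E : set Rn), (0 < l)%R -> measurable E ->
    E `<=` cube c l -> mu E <= (l ^+ n / 2)%:E ->
    \int[mu]_(x in E) (w x)%:E <= th%:E * \int[mu]_(x in cube c l) (w x)%:E) ->
  forall c l, (0 < l)%R ->
  \int[mu]_(x in cube c l) (`|a x - u c l| `^ s * w x)%:E <=
  (jn_step n A `^ s * S)%:E * \int[mu]_(x in cube c l) (w x)%:E.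
Proof.
move=> s0 th0 S0 thS A0 ma osc w0 mw wth c l l0.
set K := jn_step n A; set f := fun x => (`|a x - u c l|)%R.
have K0 : (0 < K)%R.
  by rewrite mulr_gt0// addr_gt0// exprn_gt0.
have mQ := measurable_cube c l.
pose G k := [set x : Rn | (k%:R * K < f x)%R].
pose ck k : R := ((k.+1%:R * K) `^ s)%R.
have ck0 k : (0 <= ck k)%R by exact: powR_ge0.
pose g k := (fun x => (ck k * w x)%:E) \_ (G k).
have g0 k x : 0 <= g k x.
  by rewrite /g /patch; case: ifP => // _; rewrite lee_fin mulr_ge0.
have mf : measurable_fun setT f.
  by apply: measurableT_comp => //; exact: measurable_funB.
have mG k : measurable (G k).
  rewrite (_ : G k = setT `&` f @^-1` `]k%:R * K, +oo[%classic)%R; first exact: mf.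
  by rewrite setTI; apply/seteqP; split => x /=; rewrite in_itv/= andbT.
have mg k : measurable_fun (cube c l) (g k).
  apply: measurable_funTS; apply/(measurable_restrictT _ _).1 => //.
  apply/measurable_EFinP; apply: measurable_funM => //.
  exact: measurable_funTS.
apply: (@le_trans _ _ (\int[mu]_(x in cube c l) \sum_(k <oo) g k x)).
  apply: le_ge0_integral => x Qx; first by rewrite lee_fin mulr_ge0// powR_ge0.
  rewrite -/(f x); have [fx|fx] := eqVneq (f x) 0%R.
    rewrite fx powR0 ?gt_eqF// mul0r; exact: nneseries_ge0.
  have fx0 : (0 < f x)%R by rewrite lt_neqAle eq_sym fx /f /=.
  have : exists k, (f x <= k.+1%:R * K)%R.
    exists (Num.Def.trunc (f x / K)); rewrite -ler_pdivrMr//.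
    exact/ltW/truncnS_gt.
  move=> /ex_minnP[k fk mk].
  have Gk : G k x.
    rewrite /G /=; case: k fk mk => [|k] fk mk; first by rewrite mul0r.
    by rewrite ltNge; apply/negP => /mk; rewrite ltnn.
  apply: (@le_trans _ _ (g k x)).
    rewrite /g patchE mem_set// lee_fin ler_wpM2r// /ck.
    by apply: ge0_ler_powR => //; rewrite ?nnegrE ?(ltW s0)// ?(ltW fx0)// mulr_ge0 ?(ltW K0).
  apply: le_trans (nneseries_lim_ge k.+1 _) => //.
  by rewrite big_nat_recr//= leeDr// sume_ge0.
rewrite integral_nneseries//.
have nQ0 : 0 <= \int[mu]_(x in cube c l) (w x)%:E.
  by apply: integral_ge0 => x _; rewrite lee_fin.
have gk k : \int[mu]_(x in cube c l) g k x <=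
    (K `^ s * (k.+1%:R `^ s * th ^+ k))%:E * \int[mu]_(x in cube c l) (w x)%:E.
  rewrite /g -integral_mkcondr.
  under eq_integral do rewrite EFinM.
  rewrite ge0_integralZl_EFin//; last 2 first.
  - by move=> x _; rewrite lee_fin.
  - by apply/measurable_EFinP; exact: measurable_funTS.
  rewrite /ck powRM// ?(ltW K0)// mulrA (mulrC (K `^ s)%R).
  rewrite (EFinM (_ * _)%R (th ^+ k)%R) -[leRHS]muleA.
  apply: lee_wpmul2l; first by rewrite lee_fin mulr_ge0// powR_ge0.
  exact: (john_nirenberg_decay A0 ma osc w0 mw th0 wth).
  exact: measurableI.
apply: (@le_trans _ _ (\sum_(k <oo) ((K `^ s * (k.+1%:R `^ s * th ^+ k))%:E *
    \int[mu]_(x in cube c l) (w x)%:E))).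
  by apply: lee_nneseries => [k _ _|k _]; [exact: integral_ge0|exact: gk].
apply: lime_le.
  apply: is_cvg_nneseries => k _ _; rewrite mule_ge0// lee_fin.
  by rewrite !mulr_ge0// ?powR_ge0// exprn_ge0.
apply: nearW => N; rewrite -ge0_sume_distrl; last first.
  by move=> k _; rewrite lee_fin !mulr_ge0// ?powR_ge0// exprn_ge0.
apply: lee_wpmul2r => //.
by rewrite sumEFin lee_fin -mulr_sumr ler_wpM2l// powR_ge0.
Qed.

End moments.

(** * Muckenhoupt weights *)

Section weight_pairs.
Variables (R : realType) (n : nat).
Local Notation Rn := 'rV[R]_n.
Local Notation mu := (lebesgue_rV R n).
Local Open Scope ereal_scope.

(* The A_p condition with al = 1/p, f = w and g = w^(-1/(p-1)); in this form
   it is symmetric under exchanging (f, al) and (g, 1 - al). *)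
Definition Ap_pair (al K : R) (f g : Rn -> R) :=
  [/\ (forall x, 0 <= f x)%R /\ (forall x, 0 <= g x)%R,
      measurable_fun setT f /\ measurable_fun setT g,
      {ae mu, forall x, (f x `^ al * g x `^ (1 - al) = 1)%R},
      (forall c l, (0 < l)%R -> \int[mu]_(x in cube c l) (f x)%:E < +oo /\
                                \int[mu]_(x in cube c l) (g x)%:E < +oo) &
      (forall c l, (0 < l)%R ->
        (\int[mu]_(x in cube c l) (f x)%:E) `^ al *
        (\int[mu]_(x in cube c l) (g x)%:E) `^ (1 - al) <= (K * l ^+ n)%:E)].

Lemma Ap_pair_sym al K f g : Ap_pair al K f g -> Ap_pair (1 - al) K g f.
Proof.
move=> [[f0 g0] [mf mg] fg fin Kfg]; split => //.
- by apply: filterS fg => x; rewrite subKr mulrC.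
- by move=> c l /(fin c)[].
- by move=> c l l0; rewrite subKr muleC; exact: Kfg.
Qed.

(* Hoelder: |F| <= f(F)^al g(Q)^(1-al), to be compared with the A_p condition. *)
Lemma Ap_pair_subset al K f g (c : Rn) (l z : R) (F : set Rn) :
  (0 < al < 1)%R -> (0 < K)%R -> Ap_pair al K f g -> (0 < l)%R -> measurable F ->
  F `<=` cube c l -> (0 < z)%R -> z%:E <= mu F ->
  \int[mu]_(x in cube c l) (f x)%:E <=
  ((K * l ^+ n / z) `^ al^-1)%:E * \int[mu]_(x in F) (f x)%:E.
Proof.
move=> /andP[al0 al1] K0 [[f0 g0] [mf mg] fg fin Kfg] l0 mF FQ z0 zF.
have [finf fing] := fin c l l0; have := Kfg c l l0.
set X := \int[mu]_(x in cube c l) (f x)%:E.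
set Y := \int[mu]_(x in cube c l) (g x)%:E => XY.
set Z := \int[mu]_(x in F) (f x)%:E.
have X0 : 0 <= X by apply: integral_ge0 => x _; rewrite lee_fin.
have Y0 : 0 <= Y by apply: integral_ge0 => x _; rewrite lee_fin.
have Z0 : 0 <= Z by apply: integral_ge0 => x _; rewrite lee_fin.
have ZX : Z <= X by apply: subset_ge0_integral => // x _; rewrite lee_fin.
have be0 : (0 < 1 - al)%R by rewrite subr_gt0.
have zXZ : z%:E <= Z `^ al * Y `^ (1 - al).
  apply: (le_trans zF).
  apply: (@le_trans _ _ (\int[mu]_(x in F) (f x `^ al * g x `^ (1 - al))%:E)).
    rewrite -[leLHS]mul1e -integral_cst//; apply: ae_le_ge0_integral => //.
      by move=> x _; rewrite lee_fin mulr_ge0// powR_ge0.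
    by apply: filterS fg => x /= -> _.
  have := @hoelder_integral _ _ _ mu F f g al (1 - al) mF
    (measurable_funTS mf) (measurable_funTS mg) (fun x _ => f0 x) (fun x _ => g0 x) al0 be0.
  rewrite addrC subrK => /(_ erefl) /le_trans; apply.
  apply: lee_wpmul2l; first exact: poweR_ge0.
  have YF : \int[mu]_(x in F) (g x)%:E <= Y.
    by apply: subset_ge0_integral => // x _; rewrite lee_fin.
  apply: gt0_ler_poweR => //; rewrite ?ltW// in_itv/= leey andbT//.
  by apply: integral_ge0 => x _; rewrite lee_fin.
have Xfin : X \is a fin_num by rewrite ge0_fin_numE.
have Yfin : Y \is a fin_num by rewrite ge0_fin_numE.
have Zfin : Z \is a fin_num by rewrite ge0_fin_numE// (le_lt_trans ZX).
move: XY zXZ X0 Y0 Z0; rewrite -(fineK Xfin) -(fineK Yfin) -(fineK Zfin).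
rewrite !poweR_EFin -!EFinM !lee_fin; clear ZX Xfin Yfin Zfin finf fing.
move: (fine X) (fine Y) (fine Z) => {}X {}Y {}Z.
move=> XY zZY X0 Y0 Z0.
have Z1 : (0 < Z `^ al)%R.
  rewrite lt_neqAle powR_ge0 andbT eq_sym; apply/eqP => Z1; move: zZY.
  by rewrite Z1 mul0r leNgt z0.
have Y1 : (0 < Y `^ (1 - al))%R.
  rewrite lt_neqAle powR_ge0 andbT eq_sym; apply/eqP => Y1; move: zZY.
  by rewrite Y1 mulr0 leNgt z0.
have ln0 : (0 < K * l ^+ n)%R by rewrite mulr_gt0// exprn_gt0.
have h : (X `^ al <= (K * l ^+ n / z) * Z `^ al)%R.
  rewrite mulrAC ler_pdivlMr//.
  apply: (@le_trans _ _ (X `^ al * (Z `^ al * Y `^ (1 - al)))%R).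
    by rewrite ler_wpM2l// powR_ge0.
  by rewrite mulrCA mulrC ler_wpM2r// ltW.
have := @ge0_ler_powR _ al^-1 _ _ _ _ _ h.
rewrite !nnegrE invr_ge0 powR_ge0 mulr_ge0 ?powR_ge0 ?divr_ge0 ?(ltW ln0) ?(ltW z0) ?(ltW al0)//.
move=> /(_ isT isT isT).
by rewrite powRM ?powR_ge0 ?divr_ge0 ?(ltW ln0) ?(ltW z0)// -!powRrM mulfV ?gt_eqF// !powRr1.
Qed.

(** Apply the comparison of measures to the complement of E, which is at least half of the cube:
    f(Q) <= D f(Q minus E) with D = (2K)^(1/al), hence f(E) <= (1 - 1/D) f(Q). The assumption K >= 1
    gives D >= 1. *)
Lemma Ap_pair_Ainfty al K f g : (0 < al < 1)%R -> (1 <= K)%R -> Ap_pair al K f g ->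
  exists2 th : R, (0 <= th < 1)%R &
  forall c l (E : set Rn), (0 < l)%R -> measurable E ->
    E `<=` cube c l -> mu E <= (l ^+ n / 2)%:E ->
    \int[mu]_(x in E) (f x)%:E <= th%:E * \int[mu]_(x in cube c l) (f x)%:E.
Proof.
move=> al01 K1 Kfg; have [[f0 g0] [mf mg] fg fin _] := Kfg.
have K0 : (0 < K)%R by rewrite (lt_le_trans _ K1).
set D := ((K * 2) `^ al^-1)%R.
have D1 : (1 <= D)%R.
  apply: (@le_trans _ _ (1 `^ al^-1)%R); first by rewrite powR1.
  apply: ge0_ler_powR; rewrite ?nnegrE//; try lra.
  by rewrite invr_ge0 ltW//; case/andP: al01.
exists (1 - D^-1)%R.
  rewrite subr_ge0 invf_le1 ?(lt_le_trans _ D1)// D1/= ltrBlDl ltrDr invr_gt0.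
  exact: lt_le_trans D1.
move=> c l E l0 mE EQ muE.
have mQ := measurable_cube c l.
have muQ : mu (cube c l) = (l ^+ n)%:E by rewrite lebesgue_cube// ltW.
have ln0 : (0 < l ^+ n)%R by rewrite exprn_gt0.
have mQE : measurable (cube c l `\` E) by exact: measurableD.
have muF : (l ^+ n / 2)%:E <= mu (cube c l `\` E).
  have : mu (cube c l) = mu E + mu (cube c l `\` E).
    by rewrite -[X in mu X + _](setIidr EQ) addeC -measureDI.
  have Efin : mu E \is a fin_num by rewrite ge0_fin_numE// (le_lt_trans muE)// ltry.
  move: muE; rewrite -(fineK Efin) muQ lee_fin => h.
  case: (mu (cube c l `\` E)) => [r||]//.
  by rewrite -EFinD => -[] ?; rewrite lee_fin; lra.
have l20 : (0 < l ^+ n / 2)%R by rewrite divr_gt0.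
have := Ap_pair_subset al01 K0 Kfg l0 mQE (@subDsetl _ _ _) l20 muF.
rewrite (_ : (K * l ^+ n / (l ^+ n / 2) = K * 2)%R); last by field; rewrite gt_eqF.
have -> : \int[mu]_(x in cube c l) (f x)%:E =
    \int[mu]_(x in E) (f x)%:E + \int[mu]_(x in cube c l `\` E) (f x)%:E.
  rewrite -ge0_integral_setU//.
  - by rewrite setDUK.
  - by apply/measurable_EFinP; exact: measurable_funTS.
  - by move=> x _; rewrite lee_fin.
  - by apply/disj_setPS => x [Ex []].
have Qfin := (fin c l l0).1.
have efin (S : set Rn) : S `<=` cube c l -> \int[mu]_(x in S) (f x)%:E \is a fin_num.
  move=> SQ; rewrite ge0_fin_numE; last by apply: integral_ge0 => x _; rewrite lee_fin.
  by apply: le_lt_trans Qfin; apply: subset_ge0_integral => // x _; rewrite lee_fin.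
rewrite -(fineK (efin _ EQ)) -(fineK (efin _ (@subDsetl _ _ E))).
rewrite -EFinD -!EFinM !lee_fin -/D; move: (fine _) (fine _) => X Y h.
rewrite mulrBl mul1r lerBrDl addrC -lerBrDl mulrC ler_pdivrMr; last first.
  exact: lt_le_trans D1.
by rewrite mulrC; lra.
Qed.

End weight_pairs.

(** * Balls, half balls and cubes *)

Section euclidean_geometry.
Variables (R : realType) (n : nat).
Local Notation Rn := 'rV[R]_n.+1.
Local Notation mu := (lebesgue_rV R n.+1).
Local Notation dim := (n.+1%:R : R).
Implicit Types (c x y : Rn) (l r : R).

Lemma norm_coor_le_enorm x i : `|x 0 i| <= enorm x.
Proof.
rewrite -sqrtr_sqr; apply: ler_wsqrtr.
by rewrite (bigD1 i)//= lerDl sumr_ge0// => j _; exact: sqr_ge0.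
Qed.

Lemma enorm_le x l : (forall i, `|x 0 i| <= l) -> enorm x <= dim * l.
Proof.
move=> xl; have l0 : 0 <= l by exact: le_trans (xl ord0).
have dl0 : 0 <= dim * l by rewrite mulr_ge0.
rewrite -[leRHS]ger0_norm// -sqrtr_sqr; apply: ler_wsqrtr.
apply: (@le_trans _ _ (\sum_(i < n.+1) l ^+ 2)).
  by apply: ler_sum => i _; rewrite -real_normK ?num_real// ler_sqr ?nnegrE.
rewrite sumr_const card_ord exprMn -[leLHS]mulr_natl ler_wpM2r ?sqr_ge0//.
by rewrite expr2 ler_peMl// ler1n.
Qed.

Definition ccube x r : set Rn := cube (x - const_mx r) (2 * r).

Lemma ccubeP x r y :
  ccube x r y <-> forall i, x 0 i - r <= y 0 i < x 0 i + r.
Proof.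
rewrite /ccube; split => [/cubeP h i|h]; last apply/cubeP => i.
  by have := h i; rewrite !mxE; lra.
by have := h i; rewrite !mxE; lra.
Qed.

Lemma eball_subset_ccube x r : eball x r `<=` ccube x r.
Proof.
move=> y yr; apply/ccubeP => i.
have := le_lt_trans (norm_coor_le_enorm (y - x) i) yr.
by rewrite !mxE ltr_norml; lra.
Qed.

Lemma cube_subset_eball c l r : 0 < l -> dim * l < r -> cube c l `<=` eball c r.
Proof.
move=> l0 lr y /cubeP yc; apply: le_lt_trans lr.
by apply: enorm_le => i; have := yc i; rewrite !mxE ler_norml; lra.
Qed.

Lemma ccube_subset_eball x r s : 0 < r -> dim * r < s -> ccube x r `<=` eball x s.
Proof.
move=> r0 rs y /ccubeP yc; apply: le_lt_trans rs.
by apply: enorm_le => i; have := yc i; rewrite !mxE ler_norml; lra.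
Qed.

(** As x is the lower corner, the cube extends upwards in the last coordinate and stays in the
    half-space however close x is to the boundary. A half ball therefore contains a fixed proportion
    of the ball. *)
Lemma cube_subset_half_ball x r : halfspace x -> 0 < r ->
  cube x (r / (2 * dim)) `<=` half_ball x r.
Proof.
move=> x0 r0; have d0 : 0 < dim by [].
have l0 : 0 < r / (2 * dim) by rewrite divr_gt0// mulr_gt0.
move=> y yc; split.
  apply: cube_subset_eball yc => //.
  by rewrite (_ : _ * _ = r / 2); [lra|field; rewrite gt_eqF].
rewrite /halfspace /= in x0 *; move/cubeP: yc => /(_ ord_max) /andP[+ _].
exact: lt_le_trans.
Qed.

Lemma measurable_coordinate (i : 'I_n.+1) :
  measurable_fun setT (fun x : Rn => x 0 i : R).
Proof. exact: measurable_coor. Qed.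

Lemma measurable_enorm x : measurable_fun setT (fun y => enorm (y - x)).
Proof.
rewrite (_ : (fun y => _) =
    (fun y => (\sum_i (y 0 i - x 0 i) ^+ 2) `^ 2^-1)); last first.
  apply/funext => y; rewrite powR12_sqrt; last first.
    by apply: sumr_ge0 => i _; exact: sqr_ge0.
  by congr Num.sqrt; apply: eq_bigr => i _; rewrite !mxE.
apply: (measurableT_comp (measurable_powR _)) => //.
apply: measurable_sum => i; apply: measurable_funX.
by apply: measurable_funB => //; exact: measurable_coordinate.
Qed.

Lemma measurable_eball x r : measurable (eball x r).
Proof.
have := measurable_enorm x measurableT (measurable_itv `]-oo, r[).
by congr measurable; apply/seteqP; split => y /=; rewrite in_itv/= ?setTI; [case|].
Qed.

Lemma measurable_halfspace : measurable (@halfspace R n).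
Proof.
have := @measurable_coor_itv R n.+1 ord_max `]0, +oo[%classic (measurable_itv _).
by congr measurable; apply/seteqP; split => y /=; rewrite in_itv/= andbT.
Qed.

Lemma measurable_half_ball x r : measurable (half_ball x r).
Proof. by apply: measurableI; [exact: measurable_eball|exact: measurable_halfspace]. Qed.

Lemma lebesgue_eball_le x r : 0 <= r -> (mu (eball x r) <= ((2 * r) ^+ n.+1)%:E)%E.
Proof.
move=> r0; rewrite -(@lebesgue_cube R n.+1 (x - const_mx r)) ?mulr_ge0//.
apply: le_measure; rewrite ?inE; [exact: measurable_eball|exact: measurable_cube|].
exact: eball_subset_ccube.
Qed.

Lemma lebesgue_eball_gt0 x r : 0 < r -> (0 < mu (eball x r))%E.
Proof.
move=> r0; have d0 : 0 < dim by [].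
have l0 : 0 < r / (2 * dim) by rewrite divr_gt0// mulr_gt0.
apply: (@lt_le_trans _ _ (mu (cube x (r / (2 * dim))))).
  by rewrite lebesgue_cube ?(ltW l0)// lte_fin exprn_gt0.
apply: le_measure; rewrite ?inE; [exact: measurable_cube|exact: measurable_eball|].
by apply: cube_subset_eball => //; rewrite (_ : _ * _ = r / 2); [lra|field; rewrite gt_eqF].
Qed.

Definition box (M : R) : set Rn := [set v | forall i, `[- M, M]%classic (v ord0 i)].

Lemma compact_box M : compact (box M).
Proof.
by apply: (@rV_compact _ _ (fun=> `[- M, M]%classic)) => i; exact: segment_compact.
Qed.

Lemma measurable_box M : measurable (box M).
Proof.
rewrite (_ : box M = \bigcap_(i in [set: 'I_n.+1])
    [set x : Rn | `[- M, M]%classic (x 0 i)]); last first.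
  by apply/seteqP; split => x h i; [move=> _|]; exact: h.
by apply: fin_bigcap_measurable => // i _; exact: measurable_coor_itv.
Qed.

Lemma cube_subset_box c l : exists M, cube c l `<=` box M.
Proof.
exists (\sum_i `|c 0 i| + `|l|) => y /cubeP yc i; have := yc i; rewrite /= in_itv/=.
have : `|c 0 i| <= \sum_i `|c 0 i| by rewrite (bigD1 i)//= lerDl sumr_ge0.
have := ler_norm (c 0 i); have := ler_norm (- c 0 i); rewrite normrN.
have := ler_norm l; have := normr_ge0 l.
move: (\sum_i _) (`|c 0 i|) (`|l|) => S a b; lra.
Qed.

Lemma box_subset_eball M : exists2 r, 0 < r & box M `<=` eball 0 r.
Proof.
exists (dim * `|M| + 1); first by rewrite ltr_wpDl// mulr_ge0.
move=> y yM; apply: (@le_lt_trans _ _ (dim * `|M|)); last by rewrite ltrDl.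
apply: enorm_le => i; have := yM i; rewrite /= in_itv/= subr0 ler_norml.
by have := ler_norm M; lra.
Qed.

Lemma box_subset M N : M <= N -> box M `<=` box N.
Proof. by move=> MN y yM i; have := yM i; rewrite /= !in_itv/=; lra. Qed.

Lemma locally_integrable_cube (f : Rn -> R) c l :
  locally_integrable_rV setT f -> mu.-integrable (cube c l) (EFin \o f).
Proof.
move=> [mf fK]; have [M cM] := cube_subset_box c l.
apply: (@integrableS _ _ _ mu (box M)) => //.
- exact: measurable_box.
- exact: measurable_cube.
- by apply: fK => //; exact: compact_box.
Qed.

End euclidean_geometry.

(** * From the A_p condition on balls to a pair of weights on cubes *)

Section muckenhoupt.
Variables (R : realType) (n : nat) (p : R) (w : 'rV[R]_n.+1 -> R).
Local Notation Rn := 'rV[R]_n.+1.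
Local Notation mu := (lebesgue_rV R n.+1).
Hypotheses (p1 : 1 < p) (Apw : Muckenhoupt p w).
Local Open Scope ereal_scope.

(** Real-valued, so 0 where w vanishes, whereas [sigE] below is +oo there, as in [Ap_const]; the two
    agree wherever w is positive. *)
Definition dual_weight (y : Rn) : R := (w y `^ (- (p - 1)^-1))%R.

Let sigE (y : Rn) : \bar R := ((w y)%:E^-1) `^ (p - 1)^-1.

Let w0 y : (0 <= w y)%R. Proof. by case: Apw => -[]. Qed.

Let mw : measurable_fun setT w. Proof. by case: Apw => -[_ []]. Qed.

Let p10 : (0 < p - 1)%R. Proof. by rewrite subr_gt0. Qed.

Let sigE_ge0 y : 0 <= sigE y. Proof. exact: poweR_ge0. Qed.

Let dual_weight_le y : (dual_weight y)%:E <= sigE y.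
Proof.
rewrite /dual_weight /sigE; have [wy|wy] := eqVneq (w y) 0%R.
  rewrite wy powR0; first exact: poweR_ge0.
  by rewrite oppr_eq0 invr_eq0 gt_eqF.
by rewrite inver (negbTE wy) poweR_EFin lee_fin -(powR_inv1 (w0 y)) -powRrM mulN1r.
Qed.

Let sigE_fin y : sigE y < +oo -> (0 < w y)%R.
Proof.
move=> sy; rewrite lt_neqAle eq_sym [X in _ && X]w0 andbT; apply/eqP => wy; move: sy.
by rewrite /sigE wy inve0 poweRyr ?ltxx// invr_eq0 gt_eqF.
Qed.

Let msigE : measurable_fun setT sigE.
Proof.
apply: (measurableT_comp (measurable_poweR _)).
rewrite (_ : (fun y => _) = (fun y => if w y == 0%R then +oo else ((w y)^-1)%:E)); last first.
  by apply/funext => y; rewrite inver.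
apply: measurable_fun_ifT => //.
  by apply: measurable_fun_eqr.
apply/measurable_EFinP.
rewrite (_ : (fun y => _) = (fun y => w y `^ (-1))%R); last first.
  by apply/funext => y; rewrite powR_inv1.
exact: (measurableT_comp (measurable_powR _)).
Qed.

Let mwE (S : set Rn) : measurable_fun S (EFin \o w).
Proof. by apply/measurable_EFinP; exact: measurable_funTS. Qed.

Lemma measurable_dual_weight : measurable_fun setT dual_weight.
Proof. exact: (measurableT_comp (measurable_powR _)). Qed.

Lemma integral_weight_fin (c : Rn) l : \int[mu]_(y in cube c l) (w y)%:E < +oo.
Proof.
have [[_ lw] _] := Apw; have /integrableP[_] := locally_integrable_cube c l lw.
apply: le_lt_trans; apply: le_ge0_integral => y _; first by rewrite lee_fin.
by rewrite /= lee_fin ler_norm.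
Qed.

Lemma wmeas_eball_fin x r : wmeas w (eball x r) < +oo.
Proof.
apply: (le_lt_trans _ (integral_weight_fin (x - const_mx r) (2 * r))).
by apply: subset_ge0_integral => [y _|]; [rewrite lee_fin|exact: eball_subset_ccube].
Qed.

Let lebesgue_eball x r : (0 < r)%R ->
  exists2 m, (0 < m <= (2 * r) ^+ n.+1)%R & mu (eball x r) = m%:E.
Proof.
move=> r0; have := lebesgue_eball_gt0 x r0.
have := lebesgue_eball_le x (ltW r0).
case: (mu _) => [m||]//; rewrite lee_fin lte_fin => h1 h2.
by exists m => //; rewrite h1 h2.
Qed.

(** With w(B) > 0, an infinite integral of [sigE] would make the A_p constant infinite. The
    inequality is the p-th root of the A_p condition; the powers 1/p and 1 - 1/p of 1/|B| multiply
    to 1/|B|. *)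
Let ap_ball x r : (0 < r)%R -> 0 < wmeas w (eball x r) ->
  \int[mu]_(y in eball x r) sigE y < +oo /\
  (wmeas w (eball x r)) `^ p^-1 *
    (\int[mu]_(y in eball x r) sigE y) `^ (1 - p^-1) <=
    ((fine (Ap_const p w)) `^ p^-1 * (2 * r) ^+ n.+1)%:E.
Proof.
move=> r0 X0; have [m /andP[m0 mr] mE] := lebesgue_eball x r0.
have : average (eball x r) (fun y => (w y)%:E) *
        (average (eball x r) sigE) `^ (p - 1) <= Ap_const p w.
  by apply: ereal_sup_ubound; exists x, r.
rewrite /average mE inver gt_eqF// -/(wmeas _ _).
have Apfin : Ap_const p w < +oo by case: Apw.
have Y0 : 0 <= \int[mu]_(y in eball x r) sigE y.
  by apply: integral_ge0 => y _; exact: sigE_ge0.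
have := wmeas_eball_fin x r; move: X0 Y0.
set X := wmeas _ _; set Y := \int[mu]_(y in _) _.
case: X => [X||]//; rewrite lte_fin => X0.
case: Y => [Y||]// Y0 _; last first.
  rewrite gt0_muley ?lte_fin ?invr_gt0// poweRyr ?gt_eqF//.
  rewrite -EFinM gt0_muley ?lte_fin ?mulr_gt0 ?invr_gt0// leye_eq => /eqP Ay.
  by rewrite Ay ltxx in Apfin.
rewrite ltry => H; split => //; move: H Apfin; rewrite lee_fin in Y0.
rewrite -!EFinM.
case: (Ap_const p w) => [A||]//= H _.
have p0 : (0 < p)%R by exact: lt_trans p1.
have be0 : (0 < 1 - p^-1)%R by rewrite subr_gt0 invf_lt1.
rewrite lee_fin; rewrite lee_fin in H.
have mX0 : (0 <= m^-1 * X)%R by rewrite mulr_ge0 ?invr_ge0 ?(ltW m0) ?(ltW X0).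
have mY0 : (0 <= m^-1 * Y)%R by rewrite mulr_ge0 ?invr_ge0 ?(ltW m0).
have A0 : (0 <= A)%R by rewrite (le_trans _ H)// mulr_ge0// powR_ge0.
have := @ge0_ler_powR _ p^-1%R _ _ _ _ _ H.
rewrite !nnegrE invr_ge0 A0 mulr_ge0 ?powR_ge0 ?(ltW p0)// => /(_ isT isT isT).
rewrite powRM ?powR_ge0// -powRrM (_ : (p - 1) * p^-1 = 1 - p^-1)%R; last first.
  by rewrite mulrBl mul1r mulfV// gt_eqF.
rewrite !powRM ?invr_ge0 ?(ltW m0) ?(ltW X0)// mulrACA -powRD; last first.
  by rewrite subrKC oner_eq0.
rewrite subrKC powRr1 ?invr_ge0 ?(ltW m0)// mulrC ler_pdivrMr// => /le_trans; apply.
by rewrite ler_wpM2l// powR_ge0.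
Qed.

Hypothesis w_neq0 : exists x r, 0 < wmeas w (eball x r).

Let eball_subset_box x r : exists M, eball x r `<=` @box R n M.
Proof.
have [M cM] := cube_subset_box (x - const_mx r) (2 * r).
by exists M => y /eball_subset_ccube /cM.
Qed.

(** Enlarge the box to a ball that also contains a ball of positive mass. There [sigE] is
    integrable, hence finite almost everywhere, and it is infinite where w vanishes. *)
Let w_gt0_on_box M : {ae mu, forall y, @box R n M y -> (0 < w y)%R}.
Proof.
have [x [r xr]] := w_neq0; have [N xN] := eball_subset_box x r.
have [s s0 Ns] := @box_subset_eball R n (Num.max M N).
have ws : 0 < wmeas w (eball 0%R s).
  apply: (lt_le_trans xr); apply: subset_ge0_integral => [y _|y yr].
    by rewrite lee_fin.
  by apply: Ns; apply: box_subset (xN y yr); rewrite le_max lexx orbT.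
have [Yfin _] := ap_ball s0 ws.
have : mu.-integrable (eball 0%R s) sigE.
  apply/integrableP; split; first exact: measurable_funTS.
  by under eq_integral do rewrite gee0_abs//.
move=> /(integrable_ae (measurable_eball _ _)); apply: filterS => y h yM.
apply: sigE_fin; have /h : eball 0%R s y.
  by apply: Ns; apply: box_subset yM; rewrite le_max lexx.
by rewrite ge0_fin_numE.
Qed.

Lemma weight_gt0 : {ae mu, forall y, (0 < w y)%R}.
Proof.
have : forall k : nat, {ae mu, forall y, @box R n k%:R y -> (0 < w y)%R}.
  by move=> k; exact: w_gt0_on_box.
move=> /ae_foralln; apply: filterS => y h.
apply: (h (Num.Def.trunc (enorm y)).+1) => i; rewrite /= in_itv/=.
have := ltW (le_lt_trans (norm_coor_le_enorm y i) (truncnS_gt (enorm y))).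
by rewrite ler_norml.
Qed.

Lemma wmeas_gt0 (S : set Rn) : measurable S -> 0 < mu S -> 0 < wmeas w S.
Proof.
move=> mS S0; rewrite lt_neqAle integral_ge0 ?andbT; last first.
  by move=> y _; rewrite lee_fin.
apply/eqP => /esym S00.
have w00 : {ae mu, forall y, S y -> (w y)%:E = 0}.
  by apply: (ge0_integral_eq0 mS (@mwE S)) S00 => y _; rewrite lee_fin.
have [N [mN N0 SN]] := filterI w00 weight_gt0.
move: S0; rewrite (_ : mu S = 0) ?ltxx//; apply: (subset_measure0 mS mN _ N0).
move=> y Sy; apply: SN => -[/(_ Sy) [] -> ].
by rewrite ltxx.
Qed.

(** The final constant is divided by a power of the A_p constant. Positivity is read off the unit
    ball, where w and [sigE] both have positive integral. *)
Lemma Ap_const_gt0 : 0 < Ap_const p w.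
Proof.
pose B := eball (0 : Rn)%R 1%R.
have mB : measurable B by exact: measurable_eball.
have B0 : 0 < mu B by exact: lebesgue_eball_gt0.
have [m /andP[m0 mr] mE] := lebesgue_eball (0 : Rn)%R ltr01.
have X0 : 0 < \int[mu]_(y in B) (w y)%:E by exact: wmeas_gt0.
have sig_gt0 y : 0 < sigE y.
  apply: poweR_gt0; rewrite inver; case: eqP => [_|/eqP wy]; first exact: ltry.
  by rewrite lte_fin invr_gt0 lt_neqAle eq_sym wy w0.
have Y0 : 0 < \int[mu]_(y in B) sigE y.
  rewrite lt_neqAle integral_ge0 ?andbT//.
  apply/eqP => /esym YB.
  have [N [mN N0 SN]] : {ae mu, forall y, B y -> sigE y = 0}.
    by apply: ge0_integral_eq0 YB => //; exact: measurable_funTS.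
  move: B0; rewrite (_ : mu B = 0) ?ltxx//; apply: (subset_measure0 mB mN _ N0).
  by move=> y By; apply: SN => /(_ By) sy; have := sig_gt0 y; rewrite sy ltxx.
apply: (@lt_le_trans _ _ (average B (fun y => (w y)%:E) *
        (average B sigE) `^ (p - 1))); last first.
  by apply: ereal_sup_ubound; exists (0 : Rn)%R, 1%R.
have mV : 0 < (mu B)^-1 by rewrite mE inver gt_eqF// lte_fin invr_gt0.
by rewrite /average mule_gt0 ?poweR_gt0// mule_gt0.
Qed.

Lemma muckenhoupt_pair : exists2 K : R, (1 <= K)%R & Ap_pair p^-1 K w dual_weight.
Proof.
have p0 : (0 < p)%R by exact: lt_trans p1.
have be0 : (0 < 1 - p^-1)%R by rewrite subr_gt0 invf_lt1.
have sQ (c : Rn) (l : R) : (0 < l)%R -> cube c l `<=` eball c (2 * n.+1%:R * l).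
  move=> l0; apply: cube_subset_eball => //.
  by have : (0 < n.+1%:R * l :> R)%R; [rewrite mulr_gt0|lra].
have dl0 (l : R) : (0 < l)%R -> (0 < 2 * n.+1%:R * l :> R)%R by move=> l0; rewrite !mulr_gt0.
have wQ (c : Rn) (l : R) : (0 < l)%R -> \int[mu]_(y in cube c l) (w y)%:E <=
    wmeas w (eball c (2 * n.+1%:R * l)).
  move=> l0; apply: subset_ge0_integral => [y _|]; first by rewrite lee_fin.
  exact: sQ.
have gQ (c : Rn) (l : R) : (0 < l)%R -> \int[mu]_(y in cube c l) (dual_weight y)%:E <=
    \int[mu]_(y in eball c (2 * n.+1%:R * l)) sigE y.
  move=> l0; apply: (@le_trans _ _ (\int[mu]_(y in cube c l) sigE y)).
    by apply: le_ge0_integral => y _ //; rewrite lee_fin powR_ge0.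
  by apply: subset_ge0_integral => [y _|]; [exact: sigE_ge0|exact: sQ].
have ap (c : Rn) (l : R) : (0 < l)%R -> _ := fun l0 => ap_ball (dl0 l l0)
  (wmeas_gt0 (measurable_eball c _) (lebesgue_eball_gt0 c (dl0 l l0))).
(* A cube of side l lies in the ball of radius 2(n+1)l about its corner, of measure at most
   (4(n+1)l)^(n+1). The maximum with 1 serves [Ap_pair_Ainfty]. *)
set K := Num.max 1%R (fine (Ap_const p w) `^ p^-1 * (2 * (2 * n.+1%:R)) ^+ n.+1)%R.
exists K; first by rewrite le_max lexx.
split.
- by split => // y; exact: powR_ge0.
- by split => //; exact: measurable_dual_weight.
- apply: filterS weight_gt0 => y wy.
  rewrite /dual_weight -powRrM (_ : - (p - 1)^-1 * (1 - p^-1) = - p^-1)%R; last first.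
    by field; rewrite !gt_eqF.
  by rewrite powRN mulfV// gt_eqF// powR_gt0.
- move=> c l l0; split; first exact: integral_weight_fin.
  exact: le_lt_trans (gQ c l l0) (ap c l l0).1.
- move=> c l l0; have [_ h] := ap c l l0.
  have hK : (fine (Ap_const p w) `^ p^-1 * (2 * (2 * n.+1%:R * l)) ^+ n.+1 <=
      K * l ^+ n.+1)%R.
    rewrite (_ : 2 * (2 * n.+1%:R * l) = 2 * (2 * n.+1%:R) * l)%R; last by ring.
    rewrite exprMn [leLHS]mulrA ler_wpM2r ?exprn_ge0 ?(ltW l0)//.
    by rewrite /K le_max lexx orbT.
  rewrite -lee_fin in hK; apply: le_trans hK; apply: le_trans h.
  apply: lee_pmul; rewrite ?poweR_ge0//; apply: lee_poweR2; rewrite ?invr_ge0 ?(ltW p0) ?(ltW be0)//.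
  + by apply: integral_ge0 => y _; rewrite lee_fin.
  + exact: wQ.
  + by apply: integral_ge0 => y _; rewrite lee_fin powR_ge0.
  + exact: gQ.
Qed.

End muckenhoupt.

(** * The part of the function far from the ball *)

Section far_part.
Variables (R : realType) (n : nat).
Local Notation Rn := 'rV[R]_n.+1.
Local Notation mu := (lebesgue_rV R n.+1).
Local Notation hs := (@halfspace R n).
Local Open Scope ereal_scope.

(** Any constants close to [a] in mean will do. Here [u c l] is the mean over a ball of radius
    2(n+1)l that contains the cube, so that the bound on balls applies directly; that ball has
    measure at most (4(n+1)l)^(n+1). *)
Lemma bmo_cube_oscillation (a : Rn -> R) (A : R) : bmo_norm a <= A%:E ->
  exists u : Rn -> R -> R, forall c l, (0 < l)%R ->
  \int[mu]_(y in cube c l) (`|a y - u c l|)%:E <=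
    ((4 * n.+1%:R) ^+ n.+1 * A * l ^+ n.+1)%:E.
Proof.
move=> aA; exists (fun c l => mean a (eball c (2 * n.+1%:R * l))) => c l l0.
set B := eball c _; have r0 : (0 < 2 * n.+1%:R * l)%R by rewrite !mulr_gt0.
have QB : cube c l `<=` B.
  apply: cube_subset_eball => //.
  by have : (0 < n.+1%:R * l :> R)%R; [rewrite mulr_gt0|lra].
apply: (@le_trans _ _ (\int[mu]_(y in B) (`|a y - mean a B|)%:E)).
  by apply: subset_ge0_integral.
have : average B (fun y => `|a y - mean a B|%:E) <= A%:E.
  apply: le_trans aA; apply: ereal_sup_ubound.
  by exists c, (2 * n.+1%:R * l)%R.
have := lebesgue_eball_gt0 c r0; have := lebesgue_eball_le c (ltW r0).
rewrite -/B /average; case: (mu B) => [m||]//; rewrite lte_fin lee_fin => mle m0.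
rewrite inver gt_eqF// lee_pdivrMl// -EFinM => /le_trans; apply; rewrite lee_fin.
have A0 : (0 <= A)%R.
  rewrite -lee_fin; apply: le_trans aA.
  apply: (@le_trans _ _ (average B (fun y => `|a y - mean a B|%:E))).
    by rewrite mule_ge0 ?inve_ge0//; exact: integral_ge0.
  by apply: ereal_sup_ubound; exists c, (2 * n.+1%:R * l)%R.
rewrite mulrAC -exprMn ler_wpM2r//; apply: (le_trans mle).
by rewrite (_ : 2 * (2 * n.+1%:R * l) = 4 * n.+1%:R * l)%R//; ring.
Qed.

Variables (p K : R) (w g : Rn -> R).
Hypotheses (p1 : (1 < p)%R) (K0 : (0 < K)%R) (wg : Ap_pair p^-1 K w g).

Let p0 : (0 < p)%R. Proof. exact: lt_trans p1. Qed.
Let al0 : (0 < p^-1)%R. Proof. by rewrite invr_gt0. Qed.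
Let be0 : (0 < 1 - p^-1)%R. Proof. by rewrite subr_gt0 invf_lt1. Qed.
Let w0 x : (0 <= w x)%R. Proof. by case: wg => -[]. Qed.
Let g0 x : (0 <= g x)%R. Proof. by case: wg => -[]. Qed.
Let mw : measurable_fun setT w. Proof. by case: wg => _ []. Qed.
Let mg : measurable_fun setT g. Proof. by case: wg => _ []. Qed.

(** Since w^(1/p) g^(1-1/p) = 1 almost everywhere, |f| b is the product of (|f|^p w)^(1/p) and (b^p'
    g)^(1/p'), where p' = 1/(1-1/p) is the conjugate exponent. *)
Lemma weighted_hoelder (S : set Rn) (f b : Rn -> R) :
  measurable S -> measurable_fun S f -> measurable_fun S b ->
  (forall x, S x -> 0 <= b x)%R ->
  \int[mu]_(y in S) (`|f y| * b y)%:E <=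
  (\int[mu]_(y in S) (`|f y| `^ p * w y)%:E) `^ p^-1 *
  (\int[mu]_(y in S) (b y `^ (1 - p^-1)^-1 * g y)%:E) `^ (1 - p^-1).
Proof.
move=> mS mf mb b0.
have mpw (h : Rn -> R) (s : R) : measurable_fun S h -> measurable_fun S (fun y => h y `^ s)%R.
  by move=> mh; exact: (measurableT_comp (measurable_powR _)).
have := @hoelder_integral _ _ _ mu S (fun y => `|f y| `^ p * w y)%R
  (fun y => b y `^ (1 - p^-1)^-1 * g y)%R p^-1%R (1 - p^-1)%R mS.
have m1 : measurable_fun S (fun y => `|f y| `^ p * w y)%R.
  apply: measurable_funM; last exact: measurable_funTS.
  by apply: mpw; exact: measurableT_comp.
have m2 : measurable_fun S (fun y => b y `^ (1 - p^-1)^-1 * g y)%R.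
  by apply: measurable_funM; [exact: mpw|exact: measurable_funTS].
have F0 y : S y -> (0 <= `|f y| `^ p * w y)%R by rewrite mulr_ge0// powR_ge0.
have G0 y : S y -> (0 <= b y `^ (1 - p^-1)^-1 * g y)%R by rewrite mulr_ge0// powR_ge0.
move=> /(_ m1 m2 F0 G0 al0 be0 (subrKC _ _)); apply: le_trans.
apply: ae_le_ge0_integral => //.
- apply/measurable_EFinP; apply: measurable_funM => //.
  exact: measurableT_comp.
- by move=> x Sx; rewrite lee_fin mulr_ge0// b0.
- by move=> x Sx; rewrite lee_fin mulr_ge0// powR_ge0.
have [_ _ wg1 _ _] := wg; apply: filterS wg1 => y /= wg1 Sy; rewrite lee_fin.
rewrite !powRM ?powR_ge0// -!powRrM mulfV ?gt_eqF// mulVf ?gt_eqF// !powRr1 ?b0//.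
by rewrite mulrACA wg1 mulr1.
Qed.

Variables (a : Rn -> R) (u : Rn -> R -> R) (A L : R).
Hypotheses (ma : measurable_fun setT a).
Hypotheses (A0 : (0 < A)%R) (AL : (A * (1 + 2 ^+ n.+1) <= L)%R).
Hypothesis osc : forall c l, (0 < l)%R ->
  \int[mu]_(y in cube c l) (`|a y - u c l|)%:E <= (A * l ^+ n.+1)%:E.
Hypothesis oscg : forall c l, (0 < l)%R ->
  \int[mu]_(y in cube c l) (`|a y - u c l| `^ (1 - p^-1)^-1 * g y)%:E <=
  (L `^ (1 - p^-1)^-1)%:E * \int[mu]_(y in cube c l) (g y)%:E.
Variables (x0 : Rn) (r : R).
Hypothesis r0 : (0 < r)%R.

Definition gcube j : set Rn := ccube x0 (2 ^+ j * r)%R.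
Definition gmean j : R := (u (x0 - const_mx (2 ^+ j * r)) (2 * (2 ^+ j * r)))%R.

Let rj j : (0 < 2 ^+ j * r)%R. Proof. by rewrite mulr_gt0// exprn_gt0. Qed.
Let rj2 j : (0 < 2 * (2 ^+ j * r))%R. Proof. by rewrite mulr_gt0. Qed.
Let L0 : (0 < L)%R.
Proof.
apply: lt_le_trans AL; rewrite mulr_gt0// ltr_wpDr// exprn_ge0//.
Qed.

Lemma gcube_subset j k : (j <= k)%N -> gcube j `<=` gcube k.
Proof.
move=> jk y /ccubeP yj; apply/ccubeP => i; have := yj i.
have : (2 ^+ j * r <= 2 ^+ k * r)%R by rewrite ler_pM2r// ler_eXn2l// ltr1n.
by lra.
Qed.

(** Both constants are compared on the smaller cube; the larger one has 2^(n+1) times its volume,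
    whence the lower bound [AL] on L. *)
Lemma gmean_succ j : (`|gmean j.+1 - gmean j| <= L)%R.
Proof.
have := @constants_close _ _ _ mu (gcube j) a (gmean j.+1) (gmean j)
 (A * (2 * (2 ^+ j.+1 * r)) ^+ n.+1)%R (A * (2 * (2 ^+ j * r)) ^+ n.+1)%R
 ((2 * (2 ^+ j * r)) ^+ n.+1)%R.
have mQ : measurable (gcube j) by exact: measurable_cube.
move=> /(_ mQ (measurable_funTS ma)).
have h1 : \int[mu]_(x in gcube j) `|a x - gmean j.+1|%:E <=
   (A * (2 * (2 ^+ j.+1 * r)) ^+ n.+1)%:E.
  apply: le_trans (osc _ (rj2 j.+1)); apply: subset_ge0_integral => //.
  exact: gcube_subset.
have muQ : ((2 * (2 ^+ j * r)) ^+ n.+1)%:E <= mu (gcube j).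
  by rewrite lebesgue_cube// ltW.
move=> /(_ h1 (osc _ (rj2 j)) muQ) h.
have d0 : (0 < (2 * (2 ^+ j * r)) ^+ n.+1)%R by rewrite exprn_gt0.
rewrite -(ler_pM2r d0); apply: (le_trans h).
rewrite (_ : 2 * (2 ^+ j.+1 * r) = 2 * (2 * (2 ^+ j * r)))%R; last by rewrite exprS; lra.
rewrite [X in (A * X + _ <= _)%R]exprMn.
apply: le_trans (_ : A * (1 + 2 ^+ n.+1) * (2 * (2 ^+ j * r)) ^+ n.+1 <= _)%R.
  by rewrite le_eqVlt; apply/orP; left; apply/eqP; ring.
by rewrite ler_wpM2r// ltW.
Qed.

Lemma gmean_diff j : (`|gmean j - gmean 0| <= j%:R * L)%R.
Proof.
elim: j => [|j IHj]; first by rewrite subrr normr0 mul0r.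
rewrite -natr1 mulrDl mul1r.
rewrite (_ : gmean j.+1 - gmean 0 = (gmean j - gmean 0) + (gmean j.+1 - gmean j))%R; last by lra.
by apply: (le_trans (ler_normD _ _)); apply: lerD => //; exact: gmean_succ.
Qed.

(** Some coordinate of y is at distance at least 2^(j+1) r from that of x0, while x is within r <=
    2^j r of x0, so |x_i - y_i| >= 2^j r. If i is the reflected coordinate, x_i and y_i are positive
    and x_i + y_i >= |x_i - y_i|. *)
Lemma kernel_lower_bound j x y : half_ball x0 r x -> hs y -> ~ gcube j.+1 y ->
  (2 ^+ j * r <= enorm (mirror x - y))%R.
Proof.
move=> [xr hx] hy yj.
have [i yi] : exists i, ~ (x0 ord0 i - 2 ^+ j.+1 * r <= y ord0 i < x0 ord0 i + 2 ^+ j.+1 * r)%R.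
  by apply/existsNP => h; apply: yj; apply/ccubeP.
apply: le_trans (norm_coor_le_enorm _ i).
have r2 : (r <= 2 ^+ j * r)%R by rewrite ler_peMl ?exprn_ege1 ?ler1n// ltW.
have := le_lt_trans (norm_coor_le_enorm (x - x0) i) xr.
rewrite !mxE ltr_norml => xi; move: yi; rewrite exprS -mulrA; move: r2.
set s := (2 ^+ j * r)%R => r2 /negP; rewrite negb_and -ltNge -leNgt => yi.
rewrite /halfspace/= in hx hy.
have h1 : (s <= `|x ord0 i - y ord0 i|)%R.
  by case/orP: yi => yi; rewrite ler_normr; apply/orP; [left|right]; lra.
case: eqP => [ii|_]; last exact: h1.
subst i; apply: (le_trans h1); rewrite [X in (_ <= X)%R]ler0_norm; last by lra.
by rewrite ler_norml; lra.
Qed.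

Variables (f : Rn -> R) (e : nat -> R) (E : R).
Hypothesis mf : measurable_fun hs f.
Hypothesis e0 : forall j, (0 <= e j)%R.
Hypothesis fe : forall j,
  (\int[mu]_(y in gcube j.+2 `&` hs) (`|f y| `^ p * w y)%:E) `^ p^-1 <=
  (e j)%:E * (\int[mu]_(y in gcube j.+2) (w y)%:E) `^ p^-1.
Hypothesis eE : forall N, (\sum_(0 <= j < N) (j.+2%:R * e j) <= E)%R.

(** Hoelder followed by the A_p condition, which turns w(G)^(1/p) g(G)^(1-1/p) into K times the
    volume; the side of [gcube j.+2] is 8 (2^j r). It serves for a constant b and for b = |a -
    [gmean j.+2]|. *)
Lemma weighted_hoelder_cube j (b : Rn -> R) (B : R) : measurable_fun setT b ->
  (forall y, 0 <= b y)%R -> (0 <= B)%R ->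
  \int[mu]_(y in gcube j.+2) (b y `^ (1 - p^-1)^-1 * g y)%:E <=
  (B `^ (1 - p^-1)^-1)%:E * \int[mu]_(y in gcube j.+2) (g y)%:E ->
  \int[mu]_(y in gcube j.+2 `&` hs) (`|f y| * b y)%:E <=
  (8 ^+ n.+1 * K * e j * B * (2 ^+ j * r) ^+ n.+1)%:E.
Proof.
move=> mb b0 B0 bB.
have mQ : measurable (gcube j.+2) by exact: measurable_cube.
have mS : measurable (gcube j.+2 `&` hs).
  by apply: measurableI => //; exact: measurable_halfspace.
apply: (le_trans (weighted_hoelder mS _ _ _)) => //.
- by apply: measurable_funS mf; [exact: measurable_halfspace|exact: subIsetr].
- exact: measurable_funTS.
have [_ _ _ _ apK] := wg.
have gQ0 : 0 <= \int[mu]_(y in gcube j.+2) (g y)%:E.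
  by apply: integral_ge0 => y _; rewrite lee_fin.
apply: (@le_trans _ _ (((e j)%:E * (\int[mu]_(y in gcube j.+2) (w y)%:E) `^ p^-1) *
  (B%:E * (\int[mu]_(y in gcube j.+2) (g y)%:E) `^ (1 - p^-1)))).
  apply: lee_pmul; rewrite ?poweR_ge0//.
  apply: (@le_trans _ _ (((B `^ (1 - p^-1)^-1)%:E * \int[mu]_(y in gcube j.+2) (g y)%:E)
     `^ (1 - p^-1))).
    apply: lee_poweR2; first exact: ltW.
      by apply: integral_ge0 => y _; rewrite lee_fin mulr_ge0// powR_ge0.
    apply: le_trans bB; apply: subset_ge0_integral; last exact: subIsetl.
    by move=> y _; rewrite lee_fin mulr_ge0// powR_ge0.
  rewrite poweRM ?lee_fin ?powR_ge0// poweR_EFin -powRrM mulVf ?gt_eqF// powRr1//.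
rewrite muleACA -EFinM.
apply: (le_trans (lee_wpmul2l _ (apK _ _ (rj2 j.+2)))).
  by rewrite lee_fin mulr_ge0.
rewrite -EFinM lee_fin.
rewrite (_ : 2 * (2 ^+ j.+2 * r) = 8 * (2 ^+ j * r))%R; last by rewrite !exprS; lra.
by rewrite exprMn le_eqVlt; apply/orP; left; apply/eqP; ring.
Qed.

Lemma measurable_inv_kernel x :
  measurable_fun setT (fun y : Rn => (enorm (mirror x - y) ^+ n.+1)^-1%R).
Proof.
rewrite (_ : (fun y => _) =
    (fun y => (enorm (y - mirror x) ^+ n.+1) `^ (-1))%R); last first.
  apply/funext => y; rewrite powR_inv1 ?exprn_ge0 ?sqrtr_ge0//.
  congr (_ ^+ _)^-1%R; congr Num.sqrt; apply: eq_bigr => i _.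
  by rewrite !mxE -sqrrN opprB.
apply: (measurableT_comp (measurable_powR _)).
by apply: measurable_funX; exact: measurable_enorm.
Qed.

Lemma far_part_bound (x : Rn) (h : Rn -> R) : half_ball x0 r x ->
  (forall y, hs y -> gcube 1 y -> h y = 0%R) ->
  (forall y, hs y -> `|h y| <= `|f y|)%R ->
  \int[mu]_(y in hs) (`|a x - a y| * (`|h y| / enorm (mirror x - y) ^+ n.+1))%:E
  <= (2 * 8 ^+ n.+1 * K * (`|a x - gmean 0| + L) * E)%:E.
Proof.
move=> hbx h0 hf.
pose S j := (gcube j.+2 `\` gcube j.+1) `&` hs.
have mhs : measurable hs by exact: measurable_halfspace.
have mG j : measurable (gcube j) by exact: measurable_cube.
have mS j : measurable (S j) by apply: measurableI => //; exact: measurableD.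
have Shs : \bigcup_j S j `<=` hs by move=> y [j _ []].
have tS : trivIset setT S.
  apply/ltn_trivIset => j k jk; rewrite -subset0 => y [[[yj nyj] _] [[yk nyk] _]].
  by apply: nyk; exact: (@gcube_subset _ _ _ _ yj).
have hsS y : hs y -> ~ gcube 1 y -> (\bigcup_j S j) y.
  move=> hy y1; have : exists j, `[< gcube j.+1 y >].
    exists (Num.Def.trunc ((\sum_i `|y 0 i - x0 0 i|) / r))%R.
    set m := Num.Def.trunc _; apply/asboolP/ccubeP => i.
    have h1 : (`|y ord0 i - x0 ord0 i| <= \sum_i `|y 0 i - x0 0 i|)%R.
      by rewrite (bigD1 i)//= lerDl sumr_ge0.
    have h2 : (\sum_i `|y 0 i - x0 0 i| < 2 ^+ m.+1 * r)%R.
      rewrite -ltr_pdivrMr//; apply: (lt_le_trans (truncnS_gt _)).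
      by rewrite -/m -natrX ler_nat ltnW// ltn_expl.
    by have := le_lt_trans h1 h2; rewrite ltr_norml; lra.
  move=> /ex_minnP[[|j] /asboolP yj mj] //; exists j => //; split => //; split => //.
  by move=> yj1; have := mj j; rewrite ltnn => /(_ (asboolT yj1)).
pose Psi y := (`|a x - a y| * (`|f y| * (enorm (mirror x - y) ^+ n.+1)^-1))%R.
have Psi0 y : (0 <= Psi y)%R.
  by rewrite !mulr_ge0// invr_ge0 exprn_ge0// sqrtr_ge0.
apply: (@le_trans _ _ (\int[mu]_(y in \bigcup_j S j) (Psi y)%:E)).
  rewrite [leLHS]integral_mkcond [leRHS]integral_mkcond.
  apply: le_ge0_integral => y _; rewrite /patch.
    case: ifP => // _; rewrite lee_fin !mulr_ge0//.
    by rewrite invr_ge0 exprn_ge0// sqrtr_ge0.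
  case: ifPn => [|_]; last by case: ifPn => // _; rewrite lee_fin.
  rewrite inE => hy; have [y1|y1] := pselect (gcube 1 y).
    rewrite h0// normr0 mul0r mulr0; case: ifPn => // _; by rewrite lee_fin.
  rewrite mem_set; last exact: hsS.
  rewrite lee_fin ler_wpM2l// ler_wpM2r ?hf//.
  by rewrite invr_ge0 exprn_ge0// sqrtr_ge0.
have mPsi : measurable_fun hs (EFin \o Psi).
  apply/measurable_EFinP; apply: measurable_funM.
    apply: measurableT_comp => //; apply: measurable_funB => //.
    exact: measurable_funTS.
  apply: measurable_funM; first exact: measurableT_comp.
  by apply: measurable_funTS; exact: measurable_inv_kernel.
rewrite ge0_integral_bigcup//; last 2 first.
- by apply: measurable_funS mPsi.
- by move=> y _; rewrite lee_fin.
have Sj j : \int[mu]_(y in S j) (Psi y)%:E <=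
    (2 * 8 ^+ n.+1 * K * (`|a x - gmean 0| + L) * (j.+2%:R * e j))%:E.
  (* Collects what does not depend on y in the bound of |a x - a y|. *)
  set X := (`|a x - gmean 0| + j.+2%:R * L)%R.
  have X0 : (0 <= X)%R by rewrite addr_ge0// mulr_ge0// ltW.
  pose b := (fun y => `|a y - gmean j.+2|)%R.
  have mb : measurable_fun setT b.
    by apply: measurableT_comp => //; exact: measurable_funB.
  have dj0 : (0 < (2 ^+ j * r) ^+ n.+1)%R by rewrite exprn_gt0.
  set c := ((2 ^+ j * r) ^+ n.+1)^-1%R; have c0 : (0 <= c)%R by rewrite invr_ge0 ltW.
  have mS2 : measurable (gcube j.+2 `&` hs) by exact: measurableI.
  have mfS : measurable_fun (gcube j.+2 `&` hs) f.
    by apply: measurable_funS mf => //; exact: subIsetr.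
  have SG : S j `<=` gcube j.+2 `&` hs by move=> y [[]].
  have fb0 y : (0 <= `|f y| * X)%R by rewrite mulr_ge0.
  have fb1 y : (0 <= `|f y| * b y)%R by rewrite /b mulr_ge0.
  have mfX : measurable_fun (gcube j.+2 `&` hs) (fun y => (`|f y| * X)%:E).
    by apply/measurable_EFinP; apply: measurable_funM => //; exact: measurableT_comp.
  have mfb : measurable_fun (gcube j.+2 `&` hs) (fun y => (`|f y| * b y)%:E).
    apply/measurable_EFinP; apply: measurable_funM; first exact: measurableT_comp.
    exact: measurable_funTS.
  apply: (@le_trans _ _ (\int[mu]_(y in gcube j.+2 `&` hs)
      (c%:E * ((`|f y| * X)%:E + (`|f y| * b y)%:E)))).
    apply: (@le_trans _ _ (\int[mu]_(y in S j)
      (c%:E * ((`|f y| * X)%:E + (`|f y| * b y)%:E)))); last first.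
      apply: subset_ge0_integral SG => y _.
      by rewrite -EFinD -EFinM lee_fin mulr_ge0// addr_ge0.
    apply: le_ge0_integral => y Sy; first by rewrite lee_fin.
    rewrite -EFinD -EFinM lee_fin /Psi mulrA mulrC mulrC -mulrDr.
    have [[_ yj] hy] := Sy; have kl := kernel_lower_bound hbx hy yj.
    rewrite [leLHS]mulrC; apply: ler_pM => //.
    - by rewrite invr_ge0 exprn_ge0// sqrtr_ge0.
    - rewrite /c lef_pV2 ?posrE//; last first.
        by rewrite exprn_gt0// (lt_le_trans _ kl).
      by rewrite lerXn2r// ?nnegrE ?sqrtr_ge0// ltW.
    - rewrite [leLHS]mulrC; apply: ler_wpM2l => //.
      have := gmean_diff j.+2; rewrite /X /b.
      rewrite (_ : a x - a y = (a x - gmean 0) - (gmean j.+2 - gmean 0) - (a y - gmean j.+2))%R; last by lra.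
      move=> gd; apply: (le_trans (ler_normB _ _)); rewrite lerD2r.
      by apply: (le_trans (ler_normB _ _)); rewrite lerD2l.
  rewrite ge0_integralZl_EFin//; last 2 first.
  - by move=> y _; rewrite -EFinD lee_fin addr_ge0.
  - exact: emeasurable_funD.
  rewrite ge0_integralD//; last 2 first.
  - by move=> y _; rewrite lee_fin.
  - by move=> y _; rewrite lee_fin.
  have h1 : \int[mu]_(y in gcube j.+2 `&` hs) (`|f y| * X)%:E <=
      (8 ^+ n.+1 * K * e j * X * (2 ^+ j * r) ^+ n.+1)%:E.
    apply: (@weighted_hoelder_cube j (cst X)) => //.
    under eq_integral do rewrite /= EFinM.
    rewrite ge0_integralZl_EFin// ?powR_ge0//.
    - by move=> y _; rewrite lee_fin.
    - by apply/measurable_EFinP; exact: measurable_funTS.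
  have h2 : \int[mu]_(y in gcube j.+2 `&` hs) (`|f y| * b y)%:E <=
      (8 ^+ n.+1 * K * e j * L * (2 ^+ j * r) ^+ n.+1)%:E.
    apply: weighted_hoelder_cube => //; [by move=> y; exact: normr_ge0|exact: ltW|].
    exact: oscg.
  apply: (le_trans (lee_wpmul2l _ (leeD h1 h2))); first by rewrite lee_fin.
  rewrite -EFinD -EFinM lee_fin [leLHS](_ : _ = 8 ^+ n.+1 * K * e j * (X + L))%R; last first.
    by rewrite /c; field; rewrite gt_eqF.
  have K8 : (0 <= 8 ^+ n.+1 * K * e j)%R by rewrite !mulr_ge0 ?exprn_ge0// ltW.
  (* The factor j+2 is pulled out of X + L, leaving a factor free of j; 2 <= j+2 is what absorbs the
     second L. *)
  apply: (@le_trans _ _ (8 ^+ n.+1 * K * e j * (2 * (`|a x - gmean 0| + L) * j.+2%:R))%R).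
    apply: ler_wpM2l => //; rewrite /X.
    have j2 : (2 <= j.+2%:R :> R)%R by rewrite ler_nat.
    set s := (`|a x - gmean 0|)%R; have s0 : (0 <= s)%R by exact: normr_ge0.
    have : (s * 1 <= s * j.+2%:R)%R by apply: ler_wpM2l => //; lra.
    have : (L * 2 <= L * j.+2%:R)%R by apply: ler_wpM2l => //; exact: ltW.
    move: (j.+2%:R)%R j2 => t; move: s s0 L L0 => s s0 l l0 t2 h3 h4. nra.
  by rewrite le_eqVlt; apply/orP; left; apply/eqP; ring.
apply: (@le_trans _ _ (\sum_(j <oo)
    (2 * 8 ^+ n.+1 * K * (`|a x - gmean 0| + L) * (j.+2%:R * e j))%:E)).
  by apply: lee_nneseries => [j _ _|j _]; [apply: integral_ge0 => y _; rewrite lee_fin|exact: Sj].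
have C0 : (0 <= 2 * 8 ^+ n.+1 * K * (`|a x - gmean 0| + L))%R.
  by rewrite !mulr_ge0 ?exprn_ge0 ?addr_ge0 ?(ltW K0) ?(ltW L0).
apply: lime_le; last first.
  by apply: nearW => N; rewrite sumEFin lee_fin -mulr_sumr ler_wpM2l.
apply: is_cvg_nneseries => j _ _; rewrite lee_fin mulr_ge0 // mulr_ge0 //.
Qed.

End far_part.

(** * From the integral condition on the pair of weights to a dyadic sum *)

(** The intervals [2^j t0, 2^(j+1) t0[ are disjoint, of length 2^j t0, so finite step functions lie
    below F. Only these need to be measurable, F being compared with them by monotonicity. *)
Lemma dyadic_integral_lower_bound (R : realType) (r t0 : R) (F : R -> \bar R)
    (k : nat -> R) : r < t0 -> 0 < t0 -> (forall t, r < t -> (0 <= F t)%E) ->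
  (forall j, 0 <= k j) ->
  (forall j t, 2 ^+ j * t0 <= t < 2 ^+ j.+1 * t0 -> ((k j)%:E <= F t)%E) ->
  forall N, ((\sum_(0 <= j < N) k j * (2 ^+ j * t0))%:E <=
    \int[@lebesgue_measure R]_(t in `]r, +oo[) F t)%E.
Proof.
move=> rt0 t00 F0 k0 kF N.
pose I j := `[2 ^+ j * t0, 2 ^+ j.+1 * t0[%classic.
have tj0 j : 0 < 2 ^+ j * t0 by rewrite mulr_gt0// exprn_gt0.
have tjS j : 2 ^+ j.+1 * t0 = 2 ^+ j * t0 + 2 ^+ j * t0 by rewrite exprS; lra.
have rtj j : r < 2 ^+ j * t0.
  by rewrite (lt_le_trans rt0)// ler_peMl ?exprn_ege1 ?ler1n// ltW.
have mI j : measurable (I j : set (measurableTypeR R)) by exact: measurable_itv.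
have muI j : (lebesgue_measure (I j) = (2 ^+ j * t0)%:E)%E.
  rewrite lebesgue_measure_itv/= lte_fin ltr_pM2r// ltr_eXn2l ?ltr1n// ltnSn.
  by rewrite -EFinB tjS addrK.
have IS j : I j `<=` `]r, +oo[.
  by move=> t; rewrite /I /= !in_itv/= andbT => /andP[+ _]; exact: lt_le_trans.
have tle i j : (i <= j)%N -> 2 ^+ i * t0 <= 2 ^+ j * t0.
  by move=> ij; rewrite ler_pM2r// ler_eXn2l// ltr1n.
have hF t : `]r, +oo[%classic t ->
    ((\sum_(0 <= j < N) k j * \1_(I j) t)%:E <= F t)%E.
  move=> rt; have {}rt : r < t by move: rt; rewrite /= in_itv/= andbT.
  elim: N => [|N IHN]; first by rewrite big_nil; exact: F0.
  rewrite big_nat_recr//=.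
  have [tN|tN] := pselect (I N t); last by rewrite indicE memNset// mulr0 addr0.
  rewrite big_nat_cond big1 ?add0r => [|j /andP[/andP[_ jN] _]].
    by rewrite indicE mem_set// mulr1; apply: kF; move: tN; rewrite /I /= in_itv.
  rewrite indicE memNset ?mulr0//.
  move: tN; rewrite /I /= !in_itv/= => /andP[h1 _] /andP[_ h2].
  by have := lt_le_trans h2 (le_trans (tle _ _ jN) h1); rewrite ltxx.
have mi j : measurable_fun setT (fun t : measurableTypeR R => (k j * \1_(I j) t)%:E).
  by apply/measurable_EFinP; apply: measurable_funM => //; exact: measurable_indic.
apply: (@le_trans _ _ (\int[@lebesgue_measure R]_(t in `]r, +oo[)
   \sum_(0 <= j < N) (k j * \1_(I j) t)%:E)%E); last first.
  apply: le_ge0_integral => t rt.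
    by rewrite sume_ge0// => j _; rewrite lee_fin mulr_ge0// indicE.
  by rewrite sumEFin; exact: hF.
rewrite ge0_integral_sum//; last 2 first.
- by move=> j; apply: measurable_funTS.
- by move=> j t _; rewrite lee_fin mulr_ge0.
rewrite -sumEFin; apply: lee_sum => j _.
under eq_integral do rewrite EFinM.
rewrite ge0_integralZl_EFin//; last first.
  by apply/measurable_EFinP; apply: measurable_funTS; exact: measurable_indic.
rewrite integral_indic// setIidl; last exact: IS.
by rewrite EFinM -muI; exact: lexx.
Qed.

Lemma ess_inf_above (R : realType) (t b : R) (F : R -> \bar R) :
  (forall s, t < s -> (b%:E <= F s)%E) -> (b%:E <= ess_inf (leb_above t) F)%E.
Proof.
move=> bF; apply/ess_infP; exists `]-oo, t]%classic; split.
- exact: measurable_itv.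
- rewrite [LHS](_ : _ = lebesgue_measure (`]-oo, t]%classic `&` `]t, +oo[%classic))//.
  rewrite (_ : _ `&` _ = set0) ?measure0//.
  rewrite -subset0 => s [/=]; rewrite !in_itv/= andbT => st ts.
  by have := lt_le_trans ts st; rewrite ltxx.
move=> s /= nb; rewrite in_itv/= leNgt; apply/negP => ts; apply: nb; exact: bF.
Qed.

Section pair_condition.
Variables (R : realType) (n : nat) (p C1 K : R) (w g : 'rV[R]_n.+1 -> R).
Variables (phi1 phi2 : 'rV[R]_n.+1 -> R -> R).
Local Notation Rn := 'rV[R]_n.+1.
Local Notation mu := (lebesgue_rV R n.+1).
Local Notation hs := (@halfspace R n).
Hypotheses (p1 : 1 < p) (K0 : 0 < K) (wg : Ap_pair p^-1 K w g).
Hypothesis w_gt0 : forall S : set Rn, measurable S -> (0 < mu S)%E -> (0 < wmeas w S)%E.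
Hypothesis phi1_gt0 : forall x r, hs x -> 0 < r -> 0 < phi1 x r.
Hypothesis pair : weight_pair_cond p w phi1 phi2 C1.
Local Open Scope ereal_scope.

Let p0 : (0 < p)%R. Proof. exact: lt_trans p1. Qed.
Let al01 : (0 < p^-1 < 1)%R. Proof. by rewrite invr_gt0 p0/= invf_lt1. Qed.
Let w0 x : (0 <= w x)%R. Proof. by case: wg => -[]. Qed.

Lemma wmeas_subset (S S' : set Rn) : S `<=` S' -> wmeas w S <= wmeas w S'.
Proof. by apply: subset_ge0_integral => y _; rewrite lee_fin. Qed.

Lemma wmeas_ge0 (S : set Rn) : 0 <= wmeas w S.
Proof. by apply: integral_ge0 => y _; rewrite lee_fin. Qed.

Lemma wmeas_bounded (S : set Rn) (c : Rn) (l : R) : (0 < l)%R -> S `<=` cube c l ->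
  measurable S -> 0 < mu S -> exists2 m : R, (0 < m)%R & wmeas w S = m%:E.
Proof.
move=> l0 Sc mS muS; have := w_gt0 mS muS; have := wmeas_subset Sc.
have [_ _ _ fin _] := wg; have [+ _] := fin c l l0; rewrite -/(wmeas _ _).
move=> cf /le_lt_trans/(_ cf); case: (wmeas w S) => [m||]//= _.
by rewrite lte_fin => m0; exists m.
Qed.

Lemma wmeas_eball_pos x r : (0 < r)%R ->
  exists2 m : R, (0 < m)%R & wmeas w (eball x r) = m%:E.
Proof.
move=> r0; apply: wmeas_bounded (@eball_subset_ccube R n x r) _ _.
- by rewrite mulr_gt0.
- exact: measurable_eball.
- exact: lebesgue_eball_gt0.
Qed.

Lemma wmeas_half_ball_pos x r : hs x -> (0 < r)%R ->
  exists2 m : R, (0 < m)%R & wmeas w (half_ball x r) = m%:E.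
Proof.
move=> hx r0; have d0 : (0 < n.+1%:R :> R)%R by [].
have l0 : (0 < r / (2 * n.+1%:R))%R by rewrite divr_gt0// mulr_gt0.
apply: (@wmeas_bounded _ (x - const_mx r) (2 * r)%R).
- by rewrite mulr_gt0.
- by move=> y [/eball_subset_ccube].
- exact: measurable_half_ball.
apply: (@lt_le_trans _ _ (mu (cube x (r / (2 * n.+1%:R))))).
  by rewrite lebesgue_cube ?(ltW l0)// lte_fin exprn_gt0.
apply: le_measure; rewrite ?inE; [exact: measurable_cube|exact: measurable_half_ball|].
exact: cube_subset_half_ball.
Qed.

Lemma wmeas_cube_pos c l : (0 < l)%R ->
  exists2 m : R, (0 < m)%R & wmeas w (cube c l) = m%:E.
Proof.
move=> l0; apply: wmeas_bounded (@subset_refl _ (cube c l)) _ _ => //.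
- exact: measurable_cube.
- by rewrite lebesgue_cube ?(ltW l0)// lte_fin exprn_gt0.
Qed.

Variables (f : Rn -> R) (M : R).
Hypotheses (M0 : (0 < M)%R) (fM : morrey_norm p phi1 w f <= M%:E).

Let Fb x t := (\int[mu]_(y in half_ball x t) (`|f y| `^ p * w y)%:E).

Let fw0 y : 0 <= (`|f y| `^ p * w y)%:E.
Proof. by rewrite lee_fin mulr_ge0// powR_ge0. Qed.

Let Fb_ge0 x t : 0 <= Fb x t. Proof. exact: integral_ge0. Qed.

Lemma morrey_half_ball x s : hs x -> (0 < s)%R ->
  Fb x s `^ p^-1 <= (M * phi1 x s)%:E * (wmeas w (half_ball x s)) `^ p^-1.
Proof.
move=> hx s0; have [m m0 mE] := wmeas_half_ball_pos hx s0.
have : ((phi1 x s)^-1)%:E * ((wmeas w (half_ball x s))^-1 * Fb x s) `^ p^-1 <= M%:E.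
  by apply: le_trans fM; apply: ereal_sup_ubound; exists x, s.
have ph0 := phi1_gt0 hx s0.
rewrite mE inver gt_eqF// lee_pdivrMl// -EFinM.
rewrite [X in X <= _ -> _]poweRM ?lee_fin ?invr_ge0 ?(ltW m0)//.
rewrite !poweR_EFin -(powR_inv1 (ltW m0)) -powRrM mulN1r powRN => h.
have mp0 : (0 < m `^ p^-1)%R by rewrite powR_gt0.
by move: h; rewrite lee_pdivrMl// -EFinM -EFinM mulrC (mulrC M).
Qed.

(** On [t_j, 2 t_j[ the integrand is bounded below factor by factor: the logarithm by (j+2) ln 2,
    the essential infimum by b_j, 1/w(B_t)^(1/p) by the value for radius 2 t_j, and 1/t by 1/(2
    t_j). The interval has length t_j, whence the constant 2 / ln 2. *)
Lemma pair_condition_sum x r : hs x -> (0 < r)%R ->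
  exists e : nat -> R, [/\ (forall j, 0 <= e j)%R,
    (forall j, (\int[mu]_(y in gcube x r j.+2 `&` hs) (`|f y| `^ p * w y)%:E) `^ p^-1 <=
      (e j)%:E * (\int[mu]_(y in gcube x r j.+2) (w y)%:E) `^ p^-1) &
    forall N, (\sum_(0 <= j < N) (j.+2%:R * e j) <=
      K * (2 * 2 ^+ n.+1) ^+ n.+1 * 2 / ln 2 * M * (C1 * phi2 x r))%R].
Proof.
move=> hx r0.
(* As n+1 < 2^(n+1), the ball of radius t_j = 2^(n+1) 2^(j+2) r contains [gcube x r j.+2]; also t_j
   >= 2^(j+2) r, as the logarithm requires. *)
pose t j : R := (2 ^+ j * (2 ^+ (n.+3) * r))%R.
have t0 j : (0 < t j)%R by rewrite mulr_gt0 ?exprn_gt0 // mulr_gt0 ?exprn_gt0.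
have rt0 j : (r < t j)%R.
  rewrite /t mulrA -exprD ltr_pMl// exprn_egt1 ?ltr1n//.
  by rewrite addnS.
have tE j : t j = (2 ^+ n.+1 * (2 ^+ j.+2 * r))%R by rewrite /t !exprS; lra.
have rho0 j : (0 < 2 ^+ j * r)%R by rewrite mulr_gt0// exprn_gt0.
have /choice[G GE] : forall j, exists m : R, (0 < m)%R /\
    wmeas w (gcube x r j.+2) = m%:E.
  move=> j; have [|m m0 mE] := @wmeas_cube_pos (x - const_mx (2 ^+ j.+2 * r)%R) (2 * (2 ^+ j.+2 * r))%R.
    by rewrite mulr_gt0.
  by exists m.
have /choice[W WE] : forall j, exists m : R, (0 < m)%R /\
    wmeas w (eball x (2 * t j)%R) = m%:E.
  move=> j; have [|m m0 mE] := @wmeas_eball_pos x (2 * t j)%R; first by rewrite mulr_gt0.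
  by exists m.
have Fbfin j : Fb x (t j) `^ p^-1 < +oo.
  apply: (le_lt_trans (morrey_half_ball hx (t0 j))).
  have [m m0 ->] := wmeas_half_ball_pos hx (t0 j).
  by rewrite poweR_EFin -EFinM ltry.
(* The norm of f on the half ball of radius t_j over M. For v > t_j it is at most phi1(x,v)
   w(B_v)^(1/p), so it bounds the essential infimum from below. *)
pose b j := (fine (Fb x (t j) `^ p^-1) / M)%R.
have bE j : (M * b j)%:E = Fb x (t j) `^ p^-1.
  rewrite /b mulrC divfK ?gt_eqF// fineK// ge0_fin_numE//; exact: poweR_ge0.
have b0 j : (0 <= b j)%R.
  by rewrite divr_ge0 ?(ltW M0)// fine_ge0// poweR_ge0.
clearbody b.
pose e j := (M * b j / G j `^ p^-1)%R.
have Gp j : (0 < G j `^ p^-1)%R by rewrite powR_gt0//; case: (GE j).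
have Wp j : (0 < W j `^ p^-1)%R by rewrite powR_gt0//; case: (WE j).
(* Doubling: the ball of radius 2 t_j lies in a cube whose side is 2 * 2^(n+1) times that of
   [gcube x r j.+2]. *)
have GW j : (W j `^ p^-1 <= K * (2 * 2 ^+ n.+1) ^+ n.+1 * G j `^ p^-1)%R.
  have l0 : (0 < 2 * (2 * t j))%R by rewrite mulr_gt0 // mulr_gt0.
  have mG : measurable (gcube x r j.+2) by exact: measurable_cube.
  have Gsub : gcube x r j.+2 `<=` cube (x - const_mx (2 * t j))%R (2 * (2 * t j))%R.
    move=> y /ccubeP yj; apply/ccubeP => i; have := yj i.
    have : (2 ^+ j.+2 * r <= 2 * t j)%R.
      rewrite tE; set s := (2 ^+ j.+2 * r)%R; have s0 : (0 <= s)%R by exact: ltW (rho0 j.+2).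
      rewrite mulrA; apply: ler_peMl => //.
      by rewrite -exprS exprn_ege1// ler1n.
    lra.
  have z0 : (0 < (2 * (2 ^+ j.+2 * r)) ^+ n.+1)%R by rewrite exprn_gt0// mulr_gt0.
  have zG : ((2 * (2 ^+ j.+2 * r)) ^+ n.+1)%:E <= mu (gcube x r j.+2).
    by rewrite lebesgue_cube// ltW// mulr_gt0.
  have := Ap_pair_subset al01 K0 wg l0 mG Gsub z0 zG.
  move=> /(le_trans (wmeas_subset (@eball_subset_ccube R n x (2 * t j)%R))).
  have [_ ->] := WE j; have [G0 GEj] := GE j; rewrite -/(wmeas _ _) GEj.
  rewrite -EFinM lee_fin invrK.
  rewrite (_ : K * (2 * (2 * t j)) ^+ n.+1 / (2 * (2 ^+ j.+2 * r)) ^+ n.+1 =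
     K * (2 * 2 ^+ n.+1) ^+ n.+1)%R; last first.
    move: z0; set z := (2 * (2 ^+ j.+2 * r))%R => z0.
    rewrite (_ : 2 * (2 * t j) = (2 * 2 ^+ n.+1) * z)%R; last by rewrite tE /z; ring.
    by rewrite exprMn mulrA mulfK// gt_eqF.
  have KK : (0 <= K * (2 * 2 ^+ n.+1) ^+ n.+1)%R.
    by rewrite mulr_ge0 ?(ltW K0)// exprn_ge0// mulr_ge0// exprn_ge0.
  have KK0 : (0 <= (K * (2 * 2 ^+ n.+1) ^+ n.+1) `^ p * G j)%R.
    by rewrite mulr_ge0 ?powR_ge0// ltW.
  have [Wj0 _] := WE j.
  move=> /(@ge0_ler_powR _ p^-1%R); rewrite !nnegrE KK0 (ltW Wj0) invr_ge0 (ltW p0).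
  move=> /(_ isT isT isT) /le_trans; apply.
  move: KK KK0; set c := (K * _)%R => KK KK0.
  by rewrite powRM ?powR_ge0 ?(ltW G0)// -powRrM mulfV ?gt_eqF// powRr1.
have Gt j : gcube x r j.+2 `<=` eball x (t j).
  apply: ccube_subset_eball => //; rewrite tE ltr_pM2r//.
  by rewrite -natrX ltr_nat ltn_expl.
exists e; split.
- by move=> j; rewrite /e divr_ge0 ?powR_ge0// mulr_ge0// ltW.
- move=> j; have [_ GEj] := GE j; rewrite -/(wmeas w _) GEj poweR_EFin -EFinM /e.
  rewrite divfK ?gt_eqF// bE; apply: lee_poweR2.
  + by rewrite invr_ge0 ltW.
  + exact: integral_ge0.
  + by apply: subset_ge0_integral => // y [/Gt yt hy]; split.
move=> N.
have ln20 : (0 < ln 2 :> R)%R by rewrite ln_gt0// ltr1n.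
pose c : R := (K * (2 * 2 ^+ n.+1) ^+ n.+1)%R.
have c0 : (0 < c)%R by rewrite mulr_gt0// exprn_gt0// mulr_gt0// exprn_gt0.
pose k j : R := (j.+2%:R * ln 2 * (b j / W j `^ p^-1) * (2 * t j)^-1)%R.
have k0 j : (0 <= k j)%R.
  have tj := t0 j; have bj := b0 j; have Wj := Wp j.
  have tj2 : (0 <= 2 * t j)%R by rewrite mulr_ge0// ltW.
  rewrite /k mulr_ge0 ?invr_ge0// mulr_ge0//; first by rewrite mulr_ge0// ltW.
  by rewrite mulr_ge0 ?b0// invr_ge0 ltW.
have tS j : (2 ^+ j * t 0 = t j)%R by rewrite /t expr0 mul1r.
have := pair hx r0; set F := (fun s : R => _ * _) => pairxr.
have F0 s : (r < s)%R -> 0 <= F s.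
  move=> rs; have s0 : (0 < s)%R by exact: lt_trans rs.
  rewrite /F !mule_ge0 ?inve_ge0 ?poweR_ge0//.
  - rewrite lee_fin addr_ge0// ln_ge0// ler_pdivlMr// mul1r ltW//.
  - apply: ess_inf_above => v sv; rewrite mule_ge0 ?poweR_ge0// lee_fin ltW//.
    by apply: phi1_gt0 => //; exact: lt_trans sv.
  - by rewrite lee_fin invr_ge0 ltW.
have kF j s : (2 ^+ j * t 0 <= s < 2 ^+ j.+1 * t 0)%R -> (k j)%:E <= F s.
  rewrite exprS -mulrA tS => /andP[ts st].
  have s0 : (0 < s)%R by exact: lt_le_trans ts.
  have [Wj0 Wj] := WE j.
  have [m m0 mE] := wmeas_eball_pos x s0.
  have mW : (m <= W j)%R.
    rewrite -lee_fin -mE -Wj; apply: wmeas_subset => y ys.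
    by rewrite /eball /=; apply: lt_trans ys st.
  rewrite /F mE poweR_EFin inver gt_eqF ?powR_gt0//.
  rewrite /k EFinM; apply: lee_pmul.
  - by rewrite lee_fin !mulr_ge0 ?invr_ge0 ?powR_ge0 ?b0 ?(ltW ln20).
  - by rewrite lee_fin invr_ge0 mulr_ge0// ltW.
  - rewrite EFinM; apply: lee_pmul.
    + by rewrite lee_fin mulr_ge0 ?(ltW ln20).
    + by rewrite lee_fin mulr_ge0 ?invr_ge0 ?powR_ge0 ?b0.
    + rewrite lee_fin; apply: (@le_trans _ _ (ln (2 ^+ j.+2)%R)).
        by rewrite lnXn// mulr_natl.
      rewrite -[leLHS]add0r lerD// ler_ln ?posrE ?exprn_gt0 ?divr_gt0//.
      rewrite ler_pdivlMr//; apply: le_trans ts; rewrite tE.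
      by rewrite ler_peMl ?(ltW (rho0 _))// exprn_ege1// ler1n.
    + rewrite EFinM; apply: lee_pmul.
      * by rewrite lee_fin b0.
      * by rewrite lee_fin invr_ge0 powR_ge0.
      * apply: ess_inf_above => v sv; have v0 : (0 < v)%R by exact: lt_trans sv.
        have tv : (t j <= v)%R by exact: le_trans ts (ltW sv).
        rewrite -(@lee_pmul2l _ M%:E)// -EFinM bE muleA -EFinM.
        apply: (@le_trans _ _ (Fb x v `^ p^-1)).
          apply: lee_poweR2 => //; first by rewrite invr_ge0 ltW.
          apply: subset_ge0_integral => // y [yt hy]; split => //.
          exact: lt_le_trans yt tv.
        apply: (le_trans (morrey_half_ball hx v0)); apply: lee_wpmul2l.
          by rewrite lee_fin mulr_ge0// ltW// phi1_gt0.
        apply: lee_poweR2; rewrite ?wmeas_ge0 ?invr_ge0 ?(ltW p0)//.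
        by apply: wmeas_subset; exact: subIsetl.
      * rewrite lee_fin lef_pV2 ?posrE ?powR_gt0//.
        by apply: ge0_ler_powR; rewrite ?nnegrE ?invr_ge0 ?(ltW p0) ?(ltW m0) ?(ltW Wj0).
  - rewrite lee_fin lef_pV2 ?posrE //; [exact: ltW|by rewrite mulr_gt0].
have := dyadic_integral_lower_bound (rt0 0%N) (t0 0%N) F0 k0 kF N.
move=> /le_trans/(_ pairxr); rewrite lee_fin => sumk.
apply: (@le_trans _ _ (c * 2 / ln 2 * M * \sum_(0 <= j < N) k j * (2 ^+ j * t 0))%R).
  rewrite mulr_sumr; apply: ler_sum => j _; rewrite tS /k /e.
  rewrite [leRHS](_ : _ = j.+2%:R * (M * b j) * (c / W j `^ p^-1))%R; last first.
    by field; rewrite !gt_eqF.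
  rewrite mulrA ler_wpM2l//; first by rewrite !mulr_ge0 ?b0// ltW.
  rewrite ler_pdivlMr// mulrC ler_pdivrMr//.
apply: ler_wpM2l sumk; apply: mulr_ge0; last exact: ltW.
by rewrite divr_ge0 ?(ltW ln20)// mulr_ge0// ltW.
Qed.

End pair_condition.

Lemma powR_addr_le (R : realType) (p x y : R) : 0 <= p -> 0 <= x -> 0 <= y ->
  (x + y) `^ p <= 2 `^ p * (x `^ p + y `^ p).
Proof.
move=> p0 x0 y0; wlog xy : x y x0 y0 / x <= y.
  move=> h; case: (leP x y) => [|/ltW] xy; first exact: h.
  by rewrite addrC (addrC (x `^ p)); exact: h.
apply: (@le_trans _ _ ((2 * y) `^ p)).
  by apply: ge0_ler_powR => //; rewrite ?nnegrE ?addr_ge0 ?mulr_ge0//; lra.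
by rewrite powRM// ler_wpM2l ?powR_ge0// lerDr powR_ge0.
Qed.

(** * Weighted mean oscillation *)

Section weighted_bmo.
Variables (R : realType) (n : nat).
Local Notation Rn := 'rV[R]_n.
Local Notation mu := (lebesgue_rV R n).
Local Open Scope ereal_scope.

(** Cs comes from the weight alone and the bound is linear in A, so that it can be fixed before a.
    Any larger L is allowed: one L then serves w, the dual weight and the comparison of consecutive
    means. *)
Lemma weighted_john_nirenberg (al K s : R) (f g : Rn -> R) :
  (0 < al < 1)%R -> (1 <= K)%R -> Ap_pair al K f g -> (0 < s)%R ->
  exists2 Cs : R, (0 < Cs)%R & forall (a : Rn -> R) (u : Rn -> R -> R) (A : R),
    (0 < A)%R -> measurable_fun setT a ->
    (forall c l, (0 < l)%R ->
      \int[mu]_(x in cube c l) (`|a x - u c l|)%:E <= (A * l ^+ n)%:E) ->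
    forall c l L, (0 < l)%R -> (Cs * A <= L)%R ->
    \int[mu]_(x in cube c l) (`|a x - u c l| `^ s * f x)%:E <=
    (L `^ s)%:E * \int[mu]_(x in cube c l) (f x)%:E.
Proof.
move=> al01 K1 fg s0; have [th /andP[th0 th1] wth] := Ap_pair_Ainfty al01 K1 fg.
have [[f0 g0] [mf mg] _ _ _] := fg.
have [|S S0 thS] := powR_geometric_bounded s0 (th := th); first by rewrite th0.
have S1 : (0 < 1 + S)%R by rewrite ltr_pwDl.
have D0 : (0 < 19 + 2 ^+ n :> R)%R by rewrite addr_gt0// exprn_gt0.
exists ((19 + 2 ^+ n) * (1 + S) `^ s^-1)%R; first by rewrite mulr_gt0// powR_gt0.
move=> a u A A0 ma osc c l L l0 CL.
have := @john_nirenberg_moment R n s th (1 + S)%R A a f u s0 th0 (ltW S1) _ A0 ma osc f0 mf wth c l l0.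
move=> h; apply: (le_trans (h _)) => [N|].
  by apply: (le_trans (thS N)); rewrite lerDr.
apply: lee_wpmul2r; first by apply: integral_ge0 => x _; rewrite lee_fin.
rewrite lee_fin; apply: (@le_trans _ _ (((19 + 2 ^+ n) * (1 + S) `^ s^-1 * A) `^ s)%R).
  rewrite mulrAC [leRHS]powRM ?powR_ge0//; last by rewrite mulr_ge0 ?ltW.
  by rewrite -powRrM mulVf ?gt_eqF// powRr1 ?(ltW S1).
apply: ge0_ler_powR; rewrite ?nnegrE ?(ltW s0)//.
  by rewrite !mulr_ge0 ?powR_ge0 ?(ltW D0) ?(ltW A0).
by apply: le_trans CL; rewrite !mulr_ge0 ?powR_ge0 ?(ltW D0) ?(ltW A0).
Qed.

End weighted_bmo.

(** * Estimates on a half ball *)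

Section half_ball_estimate.
Variables (R : realType) (n : nat) (p K : R) (w g : 'rV[R]_n.+1 -> R).
Local Notation Rn := 'rV[R]_n.+1.
Local Notation mu := (lebesgue_rV R n.+1).
Local Notation hs := (@halfspace R n).
Hypotheses (p1 : 1 < p) (K0 : 0 < K) (wg : Ap_pair p^-1 K w g).
Local Open Scope ereal_scope.

Let p0 : (0 < p)%R. Proof. exact: lt_trans p1. Qed.
Let al01 : (0 < p^-1 < 1)%R. Proof. by rewrite invr_gt0 p0/= invf_lt1. Qed.
Let w0 x : (0 <= w x)%R. Proof. by case: wg => -[]. Qed.
Let mw : measurable_fun setT w. Proof. by case: wg => _ []. Qed.

(** The half ball contains a cube of side r / (2(n+1)), and 8r, the side of [gcube x r 2], is
    16(n+1) times that. *)
Lemma gcube_half_ball_doubling x r : hs x -> (0 < r)%R ->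
  wmeas w (gcube x r 2) <= ((K * (16 * n.+1%:R) ^+ n.+1) `^ p)%:E * wmeas w (half_ball x r).
Proof.
move=> hx r0; have d0 : (0 < n.+1%:R :> R)%R by [].
have l0 : (0 < r / (2 * n.+1%:R))%R by rewrite divr_gt0// mulr_gt0.
have ln0 : (0 < (r / (2 * n.+1%:R)) ^+ n.+1)%R by rewrite exprn_gt0.
have G0 : (0 < 2 * (2 ^+ 2 * r))%R by rewrite !mulr_gt0// exprn_gt0.
have sub : half_ball x r `<=` cube (x - const_mx (2 ^+ 2 * r))%R (2 * (2 ^+ 2 * r))%R.
  move=> y [/eball_subset_ccube /ccubeP yr _]; apply/ccubeP => i.
  by have := yr i; rewrite expr2; lra.
have muhb : ((r / (2 * n.+1%:R)) ^+ n.+1)%:E <= mu (half_ball x r).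
  rewrite -(lebesgue_cube x (ltW l0)); apply: le_measure; rewrite ?inE.
  - exact: measurable_cube.
  - exact: measurable_half_ball.
  - exact: cube_subset_half_ball.
have := Ap_pair_subset al01 K0 wg G0 (measurable_half_ball x r) sub ln0 muhb.
rewrite invrK (_ : K * (2 * (2 ^+ 2 * r)) ^+ n.+1 / (r / (2 * n.+1%:R)) ^+ n.+1 =
  K * (16 * n.+1%:R) ^+ n.+1)%R//.
rewrite -mulrA -expr_div_n; congr (_ * _ ^+ _)%R.
by field; rewrite !gt_eqF.
Qed.

Variables (a : Rn -> R) (u : Rn -> R -> R) (L : R) (x : Rn) (r : R).
Hypotheses (ma : measurable_fun setT a) (L0 : (0 < L)%R) (hx : hs x) (r0 : (0 < r)%R).
Hypothesis oscw : forall c l, (0 < l)%R ->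
  \int[mu]_(y in cube c l) (`|a y - u c l| `^ p * w y)%:E <=
  (L `^ p)%:E * \int[mu]_(y in cube c l) (w y)%:E.
Variables (f v G H : Rn -> R) (B1 B2 E : R).
Hypotheses (mv : measurable_fun hs v) (mG : measurable_fun hs G) (mH : measurable_fun hs H).
Hypotheses (B10 : (0 <= B1)%R) (B20 : (0 <= B2)%R) (E0 : (0 <= E)%R).
Hypothesis vGH : {ae mu, forall y, hs y -> (`|v y| <= `|G y| + `|H y|)%R}.
Hypothesis Gf : \int[mu]_(y in hs) (`|G y| `^ p * w y)%:E <=
  (B1 `^ p)%:E * \int[mu]_(y in gcube x r 2 `&` hs) (`|f y| `^ p * w y)%:E.
Hypothesis fE : (\int[mu]_(y in gcube x r 2 `&` hs) (`|f y| `^ p * w y)%:E) `^ p^-1 <=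
  E%:E * (wmeas w (gcube x r 2)) `^ p^-1.
Hypothesis HE : {ae mu, forall y, half_ball x r y ->
  (`|H y| <= B2 * (`|a y - gmean u x r 0| + L) * E)%R}.

(** The outer 2^p splits |G| + |H|; the inner 2^p splits |a - k| + L, and the 2 after it counts the
    two resulting terms, each at most L^p times the weight of a cube. The last factor is the
    doubling constant. *)
Definition half_ball_constant : R :=
  (2 `^ p * (B1 `^ p + B2 `^ p * (2 `^ p * 2) * L `^ p) *
   (K * (16 * n.+1%:R) ^+ n.+1) `^ p)%R.

(** In use, v is the image of a truncation of f, G that of its part in [gcube x r 1] and H that of
    the rest. The same E controls the size of f near the ball and the tail sum. *)
Lemma half_ball_estimate :
  \int[mu]_(y in half_ball x r) (`|v y| `^ p * w y)%:E <=
  (half_ball_constant * E `^ p)%:E * wmeas w (half_ball x r).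
Proof.
have mhb := measurable_half_ball x r; have mhs := @measurable_halfspace R n.
have hbhs : half_ball x r `<=` hs by move=> y [].
have mpw (D : set Rn) (h : Rn -> R) : measurable_fun D h ->
    measurable_fun D (fun y => (`|h y| `^ p * w y)%:E).
  move=> mh; apply/measurable_EFinP; apply: measurable_funM; last exact: measurable_funTS.
  apply: (measurableT_comp (measurable_powR _)) => //; exact: measurableT_comp.
have mS (h : Rn -> R) : measurable_fun hs h -> measurable_fun (half_ball x r) h.
  by apply: measurable_funS.
have pw0 (h : Rn -> R) y : (0 <= `|h y| `^ p * w y)%R by rewrite mulr_ge0// powR_ge0.
have W0 (D : set Rn) : 0 <= wmeas w D by apply: integral_ge0 => y _; rewrite lee_fin.
set D := ((K * (16 * n.+1%:R) ^+ n.+1) `^ p)%R.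
have dbl : wmeas w (gcube x r 2) <= D%:E * wmeas w (half_ball x r).
  exact: gcube_half_ball_doubling.
have dbl0 : wmeas w (gcube x r 0) <= D%:E * wmeas w (half_ball x r).
  apply: le_trans dbl; apply: subset_ge0_integral; last exact: gcube_subset.
  by move=> y _; rewrite lee_fin.
have D0 : (0 <= D)%R by exact: powR_ge0.
have DW0 : 0 <= D%:E * wmeas w (half_ball x r) by rewrite mule_ge0.
have hG : \int[mu]_(y in half_ball x r) (`|G y| `^ p * w y)%:E <=
    (B1 `^ p * E `^ p)%:E * (D%:E * wmeas w (half_ball x r)).
  apply: (@le_trans _ _ (\int[mu]_(y in hs) (`|G y| `^ p * w y)%:E)).
    by apply: subset_ge0_integral => // y _; rewrite lee_fin.
  apply: (le_trans Gf); rewrite EFinM -muleA; apply: lee_wpmul2l.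
    by rewrite lee_fin powR_ge0.
  have F0 : 0 <= \int[mu]_(y in gcube x r 2 `&` hs) (`|f y| `^ p * w y)%:E.
    by apply: integral_ge0 => y _; rewrite lee_fin.
  have := lee_poweR2 (ltW p0) (poweR_ge0 _ _) fE.
  rewrite -poweRrM mulVf ?gt_eqF// poweRe1// => /le_trans; apply.
  rewrite poweRM ?poweR_ge0// poweR_EFin -poweRrM mulVf ?gt_eqF// poweRe1//.
  by apply: lee_wpmul2l => //; rewrite lee_fin powR_ge0.
pose k := gmean u x r 0.
have hH : \int[mu]_(y in half_ball x r) (`|H y| `^ p * w y)%:E <=
    (B2 `^ p * (2 `^ p * 2) * L `^ p * E `^ p)%:E * (D%:E * wmeas w (half_ball x r)).
  have mosc (S : set Rn) : measurable_fun S (fun y => (`|a y - k| `^ p * w y)%:E).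
    apply: (mpw _ (fun y => a y - k)%R); apply: measurable_funB => //.
    exact: measurable_funTS.
  apply: (@le_trans _ _ (\int[mu]_(y in half_ball x r)
     ((B2 `^ p * 2 `^ p * E `^ p)%:E *
      ((`|a y - k| `^ p * w y)%:E + (L `^ p)%:E * (w y)%:E)))).
    apply: ae_le_ge0_integral => //.
    - by apply: mpw; exact: mS.
    - by move=> y _; rewrite lee_fin.
    - move=> y _; rewrite -!EFinM lee_fin mulr_ge0 ?mulr_ge0 ?powR_ge0//.
      by rewrite addr_ge0 ?mulr_ge0 ?powR_ge0.
    apply: filterS HE => y HEy hby; have {}HEy := HEy hby.
    rewrite -!EFinM lee_fin -mulrDl mulrA ler_wpM2r//.
    apply: (@le_trans _ _ ((B2 * (`|a y - k| + L) * E) `^ p)%R).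
      apply: ge0_ler_powR; rewrite ?nnegrE ?(ltW p0)//.
      exact: le_trans HEy.
    rewrite powRM ?mulr_ge0 ?addr_ge0 ?(ltW L0)// powRM ?addr_ge0 ?(ltW L0)//.
    rewrite mulrAC [leRHS](_ : _ = (B2 `^ p * E `^ p * (2 `^ p * (`|a y - k| `^ p + L `^ p)))%R); last by ring.
    rewrite ler_wpM2l ?mulr_ge0 ?powR_ge0//.
    by apply: powR_addr_le => //; exact: ltW.
  rewrite ge0_integralZl_EFin//; last 3 first.
  - by move=> y _; rewrite -EFinM -EFinD lee_fin addr_ge0 ?mulr_ge0 ?powR_ge0.
  - apply: emeasurable_funD => //; apply: measurable_funeM.
    by apply/measurable_EFinP; exact: measurable_funTS.
  - by rewrite !mulr_ge0 ?powR_ge0.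
  rewrite ge0_integralD//; last 3 first.
  - by move=> y _; rewrite lee_fin mulr_ge0 ?powR_ge0.
  - by move=> y _; rewrite -EFinM lee_fin mulr_ge0 ?powR_ge0.
  - by apply: measurable_funeM; apply/measurable_EFinP; exact: measurable_funTS.
  rewrite ge0_integralZl_EFin ?powR_ge0//; last 2 first.
  - by move=> y _; rewrite lee_fin.
  - by apply/measurable_EFinP; exact: measurable_funTS.
  have hb0 : half_ball x r `<=` gcube x r 0.
    by move=> y [/eball_subset_ccube]; rewrite /gcube expr0 mul1r.
  have r20 : (0 < 2 * (2 ^+ 0 * r))%R by rewrite expr0 mul1r mulr_gt0.
  have o1 : \int[mu]_(y in half_ball x r) (`|a y - k| `^ p * w y)%:E <=
      (L `^ p)%:E * (D%:E * wmeas w (half_ball x r)).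
    apply: (@le_trans _ _ (\int[mu]_(y in gcube x r 0) (`|a y - k| `^ p * w y)%:E)).
      by apply: subset_ge0_integral => // y _; rewrite lee_fin mulr_ge0 ?powR_ge0.
    apply: (le_trans (oscw _ r20)); apply: lee_wpmul2l => //.
    by rewrite lee_fin powR_ge0.
  have o2 : (L `^ p)%:E * \int[mu]_(y in half_ball x r) (w y)%:E <=
      (L `^ p)%:E * (D%:E * wmeas w (half_ball x r)).
    apply: lee_wpmul2l; first by rewrite lee_fin powR_ge0.
    by apply: le_trans dbl0; apply: subset_ge0_integral => // y _; rewrite lee_fin.
  apply: (le_trans (lee_wpmul2l _ (leeD o1 o2))).
    by rewrite lee_fin !mulr_ge0 ?powR_ge0.
  rewrite -ge0_muleDl ?lee_fin ?powR_ge0// muleA -EFinD -EFinM.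
  apply: lee_wpmul2r => //; rewrite lee_fin.
  by rewrite le_eqVlt; apply/orP; left; apply/eqP; ring.
apply: (@le_trans _ _ (\int[mu]_(y in half_ball x r)
   ((2 `^ p)%:E * ((`|G y| `^ p * w y)%:E + (`|H y| `^ p * w y)%:E)))).
  apply: ae_le_ge0_integral => //.
  - by apply: mpw; exact: mS.
  - by move=> y _; rewrite lee_fin.
  - by move=> y _; rewrite -EFinD -EFinM lee_fin mulr_ge0 ?powR_ge0 ?addr_ge0.
  apply: filterS vGH => y GHy hby; have {}GHy := GHy (hbhs _ hby).
  rewrite -EFinD -EFinM lee_fin -mulrDl mulrA ler_wpM2r//.
  apply: le_trans (powR_addr_le _ _ _); rewrite ?(ltW p0)//.
  by apply: ge0_ler_powR; rewrite ?nnegrE ?(ltW p0) ?addr_ge0.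
rewrite ge0_integralZl_EFin ?powR_ge0//; last 2 first.
- by move=> y _; rewrite -EFinD lee_fin addr_ge0.
- by apply: emeasurable_funD; apply: mpw; exact: mS.
rewrite ge0_integralD//; last 4 first.
- by move=> y _; rewrite lee_fin.
- by apply: mpw; exact: mS.
- by move=> y _; rewrite lee_fin.
- by apply: mpw; exact: mS.
apply: (le_trans (lee_wpmul2l _ (leeD hG hH))); first by rewrite lee_fin powR_ge0.
rewrite -ge0_muleDl ?lee_fin ?mulr_ge0 ?powR_ge0// -EFinD !muleA -!EFinM.
apply: lee_wpmul2r => //; rewrite lee_fin /half_ball_constant -/D.
by rewrite le_eqVlt; apply/orP; left; apply/eqP; ring.
Qed.

End half_ball_estimate.

(** * Fatou's lemma for weighted powers *)

Section weighted_fatou.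
Context d (T : measurableType d) (R : realType).
Variable mu : {measure set T -> \bar R}.
Local Open Scope ereal_scope.

Lemma powR_continuous_at (p x : R) : (0 < x)%R -> {for x, continuous (@powR R ^~ p)}.
Proof.
move=> x0; apply: differentiable_continuous; apply/derivable1_diffP.
by have [] := is_derive1_powR p x0.
Qed.

Lemma fatou_powR (p : R) (D : set T) (w v : T -> R) (V : nat -> T -> R) (B : \bar R) :
  (0 < p)%R -> measurable D -> (forall x, 0 <= w x)%R -> measurable_fun D w ->
  measurable_fun D v -> (forall k, measurable_fun D (V k)) ->
  {ae mu, forall x, D x -> `|V k x|%R @[k --> \oo] --> `|v x|%R} ->
  (forall k, \int[mu]_(x in D) (`|V k x| `^ p * w x)%:E <= B) ->
  \int[mu]_(x in D) (`|v x| `^ p * w x)%:E <= B.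
Proof.
move=> p0 mD w0 mw mv mV Vv VB.
have mpw (h : T -> R) : measurable_fun D h ->
    measurable_fun D (fun y => (`|h y| `^ p * w y)%:E).
  move=> mh; apply/measurable_EFinP; apply: measurable_funM => //.
  apply: (measurableT_comp (measurable_powR _)) => //; exact: measurableT_comp.
have pw0 (h : T -> R) y : (0 <= `|h y| `^ p * w y)%R by rewrite mulr_ge0// powR_ge0.
pose F k x := (`|V k x| `^ p * w x)%:E.
have einf_le (u : nat -> \bar R) b : (forall k, u k <= b) -> limn_einf u <= b.
  move=> ub; rewrite limn_einf_lim; apply: lime_le; first exact: is_cvg_einfs.
  apply: nearW => k; apply: le_trans (ub k); apply: ereal_inf_lbound.
  by exists k => /=.
have einf_ge0 (u : nat -> \bar R) : (forall k, 0 <= u k) -> 0 <= limn_einf u.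
  move=> u0; rewrite limn_einf_lim; apply: lime_ge; first exact: is_cvg_einfs.
  by apply: nearW => k; apply: le_ereal_inf_tmp => _ [j _ <-].
apply: (@le_trans _ _ (\int[mu]_(x in D) limn_einf (F^~ x))); last first.
  apply: (@le_trans _ _ (limn_einf (fun k => \int[mu]_(x in D) F k x))).
    apply: fatou => // [k|k x _]; first exact: mpw.
    by rewrite lee_fin.
  exact: einf_le.
apply: ae_le_ge0_integral => //.
- exact: mpw.
- by move=> x _; rewrite lee_fin.
- by move=> x _; apply: einf_ge0 => k; rewrite lee_fin.
apply: filterS Vv => x Vx Dx; have {}Vx := Vx Dx.
(* Continuity of the power is established at positive points only; where v vanishes, nonnegativity
   of the lower limit is enough. *)
have [vx0|vx0] := eqVneq `|v x|%R 0%R.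
  rewrite vx0 powR0 ?gt_eqF// mul0r; apply: einf_ge0 => k.
  by rewrite lee_fin.
have vgt0 : (0 < `|v x|)%R by rewrite lt_neqAle eq_sym vx0 normr_ge0.
have cF : F k x @[k --> \oo] --> (`|v x| `^ p * w x)%:E.
  apply: cvg_EFin; first exact: nearW.
  apply: cvgM; last exact: cvg_cst.
  apply: (@cvg_comp _ _ _ (fun k => `|V k x|%R) (fun z => z `^ p)%R _ _ _ Vx).
  exact: powR_continuous_at.
by rewrite (cvg_limn_einf_sup cF).1.
Qed.

End weighted_fatou.

(** * Truncations and their near and far parts *)

Section truncations.
Variables (R : realType) (n : nat) (p K : R) (w g : 'rV[R]_n.+1 -> R).
Local Notation Rn := 'rV[R]_n.+1.
Local Notation mu := (lebesgue_rV R n.+1).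
Local Notation hs := (@halfspace R n).
Hypotheses (p1 : 1 < p) (wg : Ap_pair p^-1 K w g).
Local Open Scope ereal_scope.

Let p0 : (0 < p)%R. Proof. exact: lt_trans p1. Qed.
Let w0 x : (0 <= w x)%R. Proof. by case: wg => -[]. Qed.
Let mw : measurable_fun setT w. Proof. by case: wg => _ []. Qed.

Let itv (k : nat) (i : 'I_n.+1) : set R :=
  if i == ord_max then `[(k.+1%:R^-1)%R, k%:R%R]%classic else `[(- k%:R)%R, k%:R%R]%classic.

(** A product of segments, hence compact, that contains the k-th truncation set and stays in the
    open half-space. *)
Definition kbox (k : nat) : set Rn := [set v | forall i, itv k i (v ord0 i)].

Lemma compact_kbox k : compact (kbox k).
Proof.
apply: (@rV_compact _ _ (itv k)) => i.
by rewrite /itv; case: ifP => _; exact: segment_compact.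
Qed.

Lemma closed_kbox k : closed (kbox k).
Proof. by apply: compact_closed; [exact: norm_hausdorff|exact: compact_kbox]. Qed.

Lemma measurable_kbox k : measurable (kbox k).
Proof.
rewrite (_ : kbox k = \bigcap_(i in [set: 'I_n.+1]) [set x : Rn | itv k i (x ord0 i)]); last first.
  by apply/seteqP; split => x h i; [move=> _|]; exact: h.
apply: fin_bigcap_measurable => // i _; apply: measurable_coor_itv.
by rewrite /itv; case: ifP => _; exact: measurable_itv.
Qed.

Lemma kbox_halfspace k : kbox k `<=` hs.
Proof.
move=> x /(_ ord_max); rewrite /itv eqxx /= in_itv/= => /andP[+ _].
by rewrite /halfspace /=; apply: lt_le_trans; rewrite invr_gt0.
Qed.

Lemma kbox_subset_box k : kbox k `<=` box k%:R%R.
Proof.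
move=> x xk i; have := xk i; rewrite /itv /=; case: ifP => // _.
rewrite /= !in_itv/= => /andP[h ->]; rewrite andbT; apply: le_trans h.
by rewrite lerNl (le_trans _ (ler0n _ k))// oppr_le0 invr_ge0.
Qed.

Lemma truncation_set_subset_kbox k :
  [set y : Rn | (enorm y <= k%:R /\ k.+1%:R^-1 <= y ord0 ord_max)%R] `<=` kbox k.
Proof.
move=> y /= [yk y1] i; have := le_trans (norm_coor_le_enorm y i) yk.
rewrite ler_norml => /andP[h1 h2]; rewrite /itv; case: eqP => [->|_] /=.
  by rewrite in_itv/= y1/= (le_trans (ler_norm _))// (le_trans (norm_coor_le_enorm y _)).
by rewrite in_itv/= h1 h2.
Qed.

Lemma measurable_truncation_set k : measurable
  [set y : Rn | (enorm y <= k%:R /\ k.+1%:R^-1 <= y ord0 ord_max)%R].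
Proof.
rewrite (_ : mkset _ = (setT `&` (fun y => enorm (y - 0)%R) @^-1` `]-oo, k%:R%R]%classic) `&`
    [set y : Rn | `[(k.+1%:R^-1)%R, +oo[%classic (y ord0 ord_max)]); last first.
  apply/seteqP; split => y /=; rewrite !in_itv/= subr0 andbT.
    by move=> [].
  by move=> [[]].
apply: measurableI; first exact: measurable_enorm.
by apply: measurable_coor_itv; exact: measurable_itv.
Qed.

Variable f : Rn -> R.
Hypothesis floc : wLp_loc p w hs f.

Definition cut (Z : set Rn) k : Rn -> R := fun y => (truncate f k y * \1_Z y)%R.

Lemma cut_supportE Z k y : ~ kbox k y -> cut Z k y = 0%R.
Proof.
move=> nk; rewrite /cut /truncate /= indicE memNset ?mulr0 ?mul0r//.
by move=> /truncation_set_subset_kbox.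
Qed.

Lemma norm_cut_le Z k y : (`|cut Z k y| <= `|f y|)%R.
Proof.
rewrite /cut /truncate /= !normrM -mulrA ler_piMr// !indicE.
by case: (_ \in _); case: (_ \in _); rewrite ?normr0 ?normr1 ?mulr0 ?mul0r ?mulr1.
Qed.

Lemma cut_outside Z k y : ~ Z y -> cut Z k y = 0%R.
Proof. by move=> Zy; rewrite /cut indicE memNset// mulr0. Qed.

Lemma cutD Z k : (fun y => cut Z k y + cut (~` Z) k y)%R = truncate f k.
Proof.
apply/funext => y; rewrite /cut -mulrDr !indicE in_setC.
by case: (y \in Z); rewrite ?addr0 ?add0r mulr1.
Qed.

Lemma measurable_cut Z k : measurable Z -> measurable_fun hs (cut Z k).
Proof.
move=> mZ; apply: measurable_funM; last exact: measurable_indic.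
apply: measurable_funM; first by case: floc.
exact: (measurable_indic (measurable_truncation_set k)).
Qed.

Let mpw (D : set Rn) (h : Rn -> R) : measurable_fun D h ->
  measurable_fun D (fun y => (`|h y| `^ p * w y)%:E).
Proof.
move=> mh; apply/measurable_EFinP; apply: measurable_funM; last exact: measurable_funTS.
apply: (measurableT_comp (measurable_powR _)) => //; exact: measurableT_comp.
Qed.

Lemma kbox_lty k : \int[mu]_(y in kbox k) (`|f y| `^ p * w y)%:E < +oo.
Proof.
have [_ /(_ (kbox k) (@compact_kbox k) (@kbox_halfspace k))] := floc.
by apply: lty_poweRy; rewrite invr_eq0 gt_eqF.
Qed.

Lemma le_integral_cut Z k (F F' : Rn -> R) :
  (forall y, 0 <= F y)%R -> (forall y, 0 <= F' y)%R -> (forall y, F y <= F' y)%R ->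
  (forall y, ~ kbox k y -> F y = 0%R) ->
  \int[mu]_(y in Z) (F y)%:E <= \int[mu]_(y in kbox k) (F' y)%:E.
Proof.
move=> F0 F'0 FF' Fk; rewrite [leLHS]integral_mkcond [leRHS]integral_mkcond.
apply: le_ge0_integral => y _; rewrite /patch.
  by case: ifP => // _; rewrite lee_fin.
have [yk|yk] := pselect (kbox k y).
  by rewrite (mem_set yk); case: ifP => // _; rewrite lee_fin.
by rewrite (memNset yk); case: ifP => // _; rewrite Fk.
Qed.

Lemma wLp_cut Z k : measurable Z -> wLp p w hs (cut Z k).
Proof.
move=> mZ; split; first exact: measurable_cut.
apply: poweR_lty; apply: le_lt_trans (kbox_lty k).
apply: le_integral_cut => y.
- by rewrite mulr_ge0// powR_ge0.
- by rewrite mulr_ge0// powR_ge0.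
- rewrite ler_wpM2r//; apply: ge0_ler_powR; rewrite ?nnegrE ?(ltW p0)//.
  exact: norm_cut_le.
- by move=> yk; rewrite cut_supportE// normr0 powR0 ?mul0r// gt_eqF.
Qed.

(** Integrability is Hoelder with b = 1: f has finite weighted norm on the compact box and the dual
    weight is integrable there. *)
Lemma L1_compact_cut Z k : measurable Z -> L1_compact (cut Z k).
Proof.
move=> mZ.
have sk : supp (cut Z k) `<=` kbox k.
  rewrite (_ : kbox k = closure (kbox k)); last by apply/closure_id; exact: closed_kbox.
  apply: closure_subset => y [_ /eqP h0]; apply: contrapT => yk; apply: h0.
  exact: cut_supportE.
split; last 2 first.
- apply: subclosed_compact sk; [exact: closed_closure|exact: compact_kbox].
- exact: subset_trans sk (@kbox_halfspace k).
apply/integrableP; split; first by apply/measurable_EFinP; exact: measurable_cut.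
apply: (@le_lt_trans _ _ (\int[mu]_(y in kbox k) (`|f y| * (cst 1%R : Rn -> R) y)%:E)).
  apply: le_integral_cut => y /=; rewrite ?mulr1//; first exact: norm_cut_le.
  by move=> yk; rewrite cut_supportE// normr0.
apply: le_lt_trans (weighted_hoelder p1 wg (measurable_kbox k) _ _ _) _ => //.
  by apply: measurable_funS floc.1; [exact: measurable_halfspace|exact: kbox_halfspace].
have [_ _ _ fin _] := wg.
have kc : kbox k `<=` cube (const_mx (- k.+1%:R)%R) (2 * k.+1%:R)%R.
  move=> y /kbox_subset_box yk; apply/cubeP => i; have := yk i; rewrite /= in_itv/= mxE.
  by rewrite -natr1; lra.
have k20 : (0 < 2 * k.+1%:R :> R)%R by rewrite mulr_gt0.
have [_ gfin] := fin (const_mx (- k.+1%:R)%R) _ k20.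
apply: lte_mul_pinfty; first exact: poweR_ge0.
- rewrite ge0_fin_numE ?poweR_ge0//; apply: poweR_lty; exact: kbox_lty.
- apply: poweR_lty; apply: le_lt_trans gfin.
  apply: (@le_trans _ _ (\int[mu]_(y in kbox k) (g y)%:E)).
    apply: le_ge0_integral => y _; rewrite /= powR1 mul1r//.
    by rewrite lee_fin; case: wg => -[].
  by apply: subset_ge0_integral => // y _; rewrite lee_fin; case: wg => -[].
Qed.

(** The support is a closure, so a whole neighbourhood of x is needed: the sup-norm ball of radius r
    about x lies in [gcube x0 r 1], of half-side 2r. *)
Lemma notin_supp_cut x0 r k x : (0 < r)%R -> half_ball x0 r x ->
  ~ supp (cut (~` gcube x0 r 1) k) x.
Proof.
move=> r0 [xr _] /(_ _ (nbhsx_ballx x r r0))[y [[_ /eqP h0] xy]]; apply: h0.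
apply: cut_outside => /=; apply; apply/ccubeP => i.
have := le_lt_trans (norm_coor_le_enorm (x - x0) i) xr.
by have := xy.2 ord0 i; rewrite /ball/= !mxE expr1 !ltr_norml; lra.
Qed.

Lemma compact_subset_half_ball (A : set Rn) : compact A -> A `<=` hs ->
  exists x r, [/\ hs x, (0 < r)%R & A `<=` half_ball x r].
Proof.
move=> /compact_bounded [M [_ AM]] Ahs.
have AB : A `<=` box (`|M| + 1)%R.
  move=> x Ax i; rewrite /= in_itv/= -ler_norml.
  have : (`|x| <= `|M| + 1)%R.
    by apply: AM => //; rewrite (le_lt_trans (ler_norm _))// ltrDl.
  apply: le_trans.
  rewrite [leRHS]mx_normrE; exact: (le_bigmax _ (fun ij => `|x ij.1 ij.2|%R) (ord0, i)).
exists (const_mx 1%R), (n.+1%:R * (`|M| + 2) + 1)%R; split.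
- by rewrite /halfspace /= mxE.
- by rewrite ltr_wpDl// mulr_ge0// addr_ge0.
move=> x Ax; split; last exact: Ahs.
apply: (@le_lt_trans _ _ (n.+1%:R * (`|M| + 2))%R); last by rewrite ltrDl.
apply: enorm_le => i; have := AB x Ax i; rewrite /= in_itv/= !mxE ler_norml; lra.
Qed.

End truncations.

(** The estimates require strictly positive bounds of the two norms, which may be 0; they are
    applied with b + e and m + e, and e tends to 0. *)
Lemma lee_product_limit (R : realType) (X : \bar R) (c b m : R) :
  0 <= c -> 0 <= b -> 0 <= m ->
  (forall e, 0 < e -> (X <= (c * (b + e) * (m + e))%:E)%E) ->
  (X <= (c * b * m)%:E)%E.
Proof.
move=> c0 b0 m0 Xe; apply/lee_addgt0Pr => t t0.
pose s := c * (b + m + 1) + 1; have s0 : 0 < s.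
  by rewrite ltr_pwDr// mulr_ge0// !addr_ge0.
pose e := Num.min 1 (t / s).
have e0 : 0 < e by rewrite lt_min ltr01 divr_gt0.
have e1 : e <= 1 by rewrite ge_min lexx.
have es : e * s <= t by rewrite -ler_pdivlMr// ge_min lexx orbT.
apply: (le_trans (Xe e e0)); rewrite -EFinD lee_fin.
have : c * e * e <= c * e * 1 by rewrite ler_wpM2l// mulr_ge0// ltW.
by move: es; rewrite /s; nra.
Qed.

Lemma ereal_ge0_fin (R : realType) (x : \bar R) : (0 <= x < +oo)%E ->
  exists2 r : R, 0 <= r & x = r%:E.
Proof.
move=> /andP[x0 xy]; exists (fine x); first exact: fine_ge0.
by rewrite fineK// ge0_fin_numE.
Qed.

(** * The bound on Morrey spaces *)

Section main.
Variables (R : realType) (n : nat) (p : R) (w : 'rV[R]_n.+1 -> R).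
Variables (phi1 phi2 : 'rV[R]_n.+1 -> R -> R) (C0 C1 : R).
Local Notation Rn := 'rV[R]_n.+1.
Local Notation mu := (lebesgue_rV R n.+1).
Local Notation hs := (@halfspace R n).
Hypotheses (p1 : 1 < p) (Apw : Muckenhoupt p w).
Hypotheses (ph1 : weight_xr phi1) (ph2 : weight_xr phi2).
Hypothesis pair : weight_pair_cond p w phi1 phi2 C1.
Local Open Scope ereal_scope.

Let p0 : (0 < p)%R. Proof. exact: lt_trans p1. Qed.
Let w0 x : (0 <= w x)%R. Proof. by case: Apw => -[]. Qed.
Let mw : measurable_fun setT w. Proof. by case: Apw => -[_ []]. Qed.

Lemma morrey_norm_ge0 phi f : weight_xr phi -> 0 <= morrey_norm p phi w f.
Proof.
move=> [phi0 _ _]; set x : Rn := const_mx 1%R.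
have hx : hs x by rewrite /halfspace /= mxE.
apply: le_trans (ereal_sup_ubound _); last by exists x, 1%R; split.
by rewrite mule_ge0 ?poweR_ge0// lee_fin invr_ge0 ltW// phi0.
Qed.

Lemma bmo_norm_ge0 (a : Rn -> R) : 0 <= bmo_norm a.
Proof.
apply: le_trans (ereal_sup_ubound _); last by exists (0 : Rn)%R, 1%R.
by rewrite mule_ge0 ?inve_ge0//; exact: integral_ge0.
Qed.

(* Here the A_p constant may vanish: w = 0 a.e. satisfies Muckenhoupt, since
   0 * +oo = 0. *)
Lemma degenerate_weight_integral (f : Rn -> R) (S : set Rn) :
  (forall x r, wmeas w (eball x r) <= 0) -> measurable_fun hs f -> S `<=` hs ->
  \int[mu]_(y in S) (`|f y| `^ p * w y)%:E = 0.
Proof.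
move=> wE mf Shs.
have w00 : {ae mu, forall y, w y = 0%R}.
  have h (k : nat) : {ae mu, forall y, eball (0 : Rn)%R k%:R%R y -> (w y)%:E = 0}.
    apply: ge0_integral_eq0.
    - exact: measurable_eball.
    - by apply/measurable_EFinP; exact: measurable_funTS.
    - by move=> y _; rewrite lee_fin.
    - by apply/eqP; rewrite eq_le wE integral_ge0// => y _; rewrite lee_fin.
  move/ae_foralln: h; apply: filterS => y /(_ (Num.Def.trunc (enorm y)).+1) h.
  by have [] : (w y)%:E = 0 by apply: h; rewrite /eball/= subr0 truncnS_gt.
apply/eqP; rewrite eq_le; apply/andP; split; last first.
  by apply: integral_ge0 => y _; rewrite lee_fin mulr_ge0// powR_ge0.
apply: (@le_trans _ _ (\int[mu]_(y in hs) (`|f y| `^ p * w y)%:E)).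
  by apply: subset_ge0_integral => // y _; rewrite lee_fin mulr_ge0// powR_ge0.
rewrite -[leRHS](integral0 mu hs); apply: ae_le_ge0_integral => //.
- exact: measurable_halfspace.
- apply/measurable_EFinP; apply: measurable_funM; last exact: measurable_funTS.
  by apply: (measurableT_comp (measurable_powR _)) => //; exact: measurableT_comp.
- by move=> y _; rewrite lee_fin mulr_ge0// powR_ge0.
- by apply: filterS w00 => y -> _; rewrite mulr0.
Qed.

Lemma degenerate_morrey phi (f : Rn -> R) :
  (forall x r, wmeas w (eball x r) <= 0) -> measurable_fun hs f -> weight_xr phi ->
  morrey p phi w f /\ morrey_norm p phi w f = 0.
Proof.
move=> wE mf phw.
have n0 : morrey_norm p phi w f = 0.
  apply/eqP; rewrite eq_le morrey_norm_ge0// andbT.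
  apply: ge_ereal_sup => _ [x [r [hx r0 ->]]].
  rewrite degenerate_weight_integral//; last by move=> y [].
  by rewrite mule0 poweR0r ?mule0// invr_eq0 gt_eqF.
split; last exact: n0.
split; last by rewrite n0.
split=> // A cA Ahs; rewrite /wLp_norm degenerate_weight_integral//.
by rewrite poweR0r// invr_eq0 gt_eqF.
Qed.

Section nondegenerate.
Hypothesis w_neq0 : exists x r, 0 < wmeas w (eball x r).
Variables (K Cw Cg : R).
Local Notation g := (dual_weight p w).
Local Notation q := ((1 - p^-1)^-1)%R.
Hypotheses (K1 : (1 <= K)%R) (wg : Ap_pair p^-1 K w g).
Hypotheses (Cw0 : (0 < Cw)%R) (Cg0 : (0 < Cg)%R).
Hypothesis JNw : forall (a : Rn -> R) (u : Rn -> R -> R) (A : R),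
  (0 < A)%R -> measurable_fun setT a ->
  (forall c l, (0 < l)%R ->
    \int[mu]_(x in cube c l) (`|a x - u c l|)%:E <= (A * l ^+ n.+1)%:E) ->
  forall c l L, (0 < l)%R -> (Cw * A <= L)%R ->
  \int[mu]_(x in cube c l) (`|a x - u c l| `^ p * w x)%:E <=
  (L `^ p)%:E * \int[mu]_(x in cube c l) (w x)%:E.
Hypothesis JNg : forall (a : Rn -> R) (u : Rn -> R -> R) (A : R),
  (0 < A)%R -> measurable_fun setT a ->
  (forall c l, (0 < l)%R ->
    \int[mu]_(x in cube c l) (`|a x - u c l|)%:E <= (A * l ^+ n.+1)%:E) ->
  forall c l L, (0 < l)%R -> (Cg * A <= L)%R ->
  \int[mu]_(x in cube c l) (`|a x - u c l| `^ q * g x)%:E <=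
  (L `^ q)%:E * \int[mu]_(x in cube c l) (g x)%:E.

Let cd : R := ((4 * n.+1%:R) ^+ n.+1)%R.
(** With L = [lam] A, the summands meet the three demands on L: consecutive means, oscillation for
    w, oscillation for the dual weight. [cd] is the loss from balls to cubes. *)
Let lam : R := ((1 + 2 ^+ n.+1 + Cw + Cg) * cd)%R.
Let kap : R := (K * (2 * 2 ^+ n.+1) ^+ n.+1 * 2 / ln 2)%R.
Let B1 : R := (`|C0| * fine (Ap_const p w) `^ p^-1)%R.
Let B2 : R := (`|C0| * (2 * 8 ^+ n.+1 * K))%R.
Let Gam : R := (half_ball_constant n p K lam B1 B2 `^ p^-1)%R.

(** The absolute value makes it nonnegative whatever the sign of C1. *)
Definition morrey_constant : R := `|Gam * kap * C1|%R.

Variables (D : set (Rn -> R)) (S : (Rn -> R) -> Rn -> R) (a : Rn -> R).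
Hypothesis BMOa : BMO a.
Hypothesis subS : sublinear_operator D S.
Hypothesis kernelS : forall f, D f -> L1_compact f ->
  {ae mu, forall x, halfspace x -> ~ supp f x ->
     (`|S f x|%:E <= C0%:E * \int[mu]_(y in halfspace)
        (`|a x - a y| * (`|f y| / enorm (mirror x - y) ^+ n.+1))%:E)%E}.
Hypothesis boundS : forall f, wLp p w halfspace f ->
  [/\ D f, wLp p w halfspace (S f) &
      (wLp_norm p w halfspace (S f) <=
       C0%:E * (Ap_const p w) `^ p^-1 * bmo_norm a * wLp_norm p w halfspace f)%E].
Variable f : Rn -> R.
Hypothesis locf : wLp_loc p w hs f.
Hypothesis Df : D f.
Hypothesis limS : {ae mu, forall x, halfspace x ->
  `|S (truncate f k) x|%R @[k --> \oo] --> `|S f x|%R}.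

Let K0 : (0 < K)%R. Proof. exact: lt_le_trans K1. Qed.
Let phi1_gt0 x r : hs x -> (0 < r)%R -> (0 < phi1 x r)%R.
Proof. by case: ph1 => + _ _; exact. Qed.
Let phi2_gt0 x r : hs x -> (0 < r)%R -> (0 < phi2 x r)%R.
Proof. by case: ph2 => + _ _; exact. Qed.

Let cd0 : (0 < cd)%R. Proof. by rewrite exprn_gt0// mulr_gt0. Qed.
Let lam0 : (0 < lam)%R.
Proof. by rewrite mulr_gt0// !addr_gt0// exprn_gt0. Qed.
Let B10 : (0 <= B1)%R. Proof. by rewrite mulr_ge0// powR_ge0. Qed.
Let B20 : (0 <= B2)%R.
Proof. by rewrite mulr_ge0// mulr_ge0 ?(ltW K0)// mulr_ge0// exprn_ge0. Qed.

(** A enters through B1 and L, each term containing exactly one of them to the power p. After a p-th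
    root the bound is linear in A, and [Gam] does not involve a. *)
Lemma half_ball_constant_homog A : (0 < A)%R ->
  half_ball_constant n p K (lam * A) (B1 * A) B2 = ((Gam * A) `^ p)%R.
Proof.
move=> A0; rewrite (powRM _ (powR_ge0 _ _) (ltW A0)) /Gam -powRrM mulVf ?gt_eqF//.
have hc0 : (0 <= half_ball_constant n p K lam B1 B2)%R.
  by rewrite !mulr_ge0 ?addr_ge0 ?mulr_ge0 ?powR_ge0.
rewrite powRr1// /half_ball_constant (powRM _ B10 (ltW A0)) (powRM _ (ltW lam0) (ltW A0)).
by ring.
Qed.

(** The sign of the right-hand factor is returned too: [commutator_morrey_bound] takes the p-th root
    of its p-th power. *)
Lemma commutator_half_ball A M x r : (0 < A)%R -> bmo_norm a <= A%:E ->
  (0 < M)%R -> morrey_norm p phi1 w f <= M%:E -> hs x -> (0 < r)%R ->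
  (0 <= kap * M * (C1 * phi2 x r))%R /\
  \int[mu]_(y in half_ball x r) (`|S f y| `^ p * w y)%:E <=
  (((Gam * A) * (kap * M * (C1 * phi2 x r))) `^ p)%:E * wmeas w (half_ball x r).
Proof.
move=> A0 aA M0 fM hx r0.
have ma : measurable_fun setT a by case: BMOa => -[].
have [u osc] := bmo_cube_oscillation aA; rewrite -/cd in osc.
have cA0 : (0 < cd * A)%R by rewrite mulr_gt0.
set L := (lam * A)%R.
have L0 : (0 < L)%R by rewrite mulr_gt0.
have twon : (0 <= 2 ^+ n.+1 :> R)%R by rewrite exprn_ge0.
have LE : L = ((1 + 2 ^+ n.+1) * (cd * A) + Cw * (cd * A) + Cg * (cd * A))%R.
  by rewrite /L /lam; ring.
have h1 : (0 <= (1 + 2 ^+ n.+1) * (cd * A))%R by rewrite mulr_ge0 ?addr_ge0// ltW.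
have h2 : (0 <= Cw * (cd * A))%R by rewrite mulr_ge0// ltW.
have h3 : (0 <= Cg * (cd * A))%R by rewrite mulr_ge0// ltW.
have L1 : (cd * A * (1 + 2 ^+ n.+1) <= L)%R by rewrite mulrC LE; lra.
have L2 : (Cw * (cd * A) <= L)%R by rewrite LE; lra.
have L3 : (Cg * (cd * A) <= L)%R by rewrite LE; lra.
have oscw c l : (0 < l)%R -> \int[mu]_(y in cube c l) (`|a y - u c l| `^ p * w y)%:E <=
    (L `^ p)%:E * \int[mu]_(y in cube c l) (w y)%:E.
  by move=> l0; apply: (JNw cA0 ma osc).
have oscg c l : (0 < l)%R -> \int[mu]_(y in cube c l) (`|a y - u c l| `^ q * g y)%:E <=
    (L `^ q)%:E * \int[mu]_(y in cube c l) (g y)%:E.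
  by move=> l0; apply: (JNg cA0 ma osc).
have wS := wmeas_gt0 p1 Apw w_neq0.
have [e [e0 fe eE]] := pair_condition_sum p1 K0 wg wS phi1_gt0 pair M0 fM hx r0.
rewrite -/kap in eE; set E := (kap * M * (C1 * phi2 x r))%R in eE *.
(* The empty partial sum already gives the sign of C1 phi2. *)
have E0 : (0 <= E)%R by have := eE 0%N; rewrite big_geq.
split => //.
(* The first term of the sum is 2 e_0, so E also controls the near part. *)
have e0E : (e 0%N <= E)%R.
  apply: le_trans (eE 1%N); rewrite big_nat1.
  by rewrite ler_peMl// ler1n.
have fE0 : (\int[mu]_(y in gcube x r 2 `&` hs) (`|f y| `^ p * w y)%:E) `^ p^-1 <=
    E%:E * (wmeas w (gcube x r 2)) `^ p^-1.
  apply: (le_trans (fe 0%N)); apply: lee_wpmul2r; first exact: poweR_ge0.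
  by rewrite lee_fin.
have mf : measurable_fun hs f by case: locf.
have mZ : measurable (gcube x r 1) by exact: measurable_cube.
have mZC : measurable (~` gcube x r 1) by exact: measurableC.
have [mS addS homS] := subS.
have hbhs : half_ball x r `<=` hs by move=> y [].
pose G k := S (cut f (gcube x r 1) k); pose H k := S (cut f (~` gcube x r 1) k).
(* The boundedness hypothesis also places both pieces, hence their sum, in the domain D. *)
have gD k := boundS (wLp_cut p1 wg locf k mZ).
have hD k := boundS (wLp_cut p1 wg locf k mZC).
have dgk k : D (cut f (gcube x r 1) k) by have [] := gD k.
have dhk k : D (cut f (~` gcube x r 1) k) by have [] := hD k.
have dk k : D (truncate f k).
  by rewrite -(cutD f (gcube x r 1) k); have [] := addS _ _ (dgk k) (dhk k).
have GA0 : (0 <= Gam * A)%R by apply: mulr_ge0; [exact: powR_ge0|exact: ltW].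
rewrite (powRM _ GA0 E0) -(half_ball_constant_homog A0).
apply: (@fatou_powR _ _ _ mu p (half_ball x r) w (S f) (fun k => S (truncate f k))) => //.
- exact: measurable_half_ball.
- exact: measurable_funTS.
- by apply: measurable_funS (mS f Df).2 => //; exact: measurable_halfspace.
- by move=> k; apply: measurable_funS (mS _ (dk k)).2 => //; exact: measurable_halfspace.
- by apply: filterS limS => y + /hbhs; apply.
move=> k.
apply: (@half_ball_estimate R n p K w g p1 K0 wg a u L x r ma L0 hx r0 oscw f
  (S (truncate f k)) (G k) (H k) (B1 * A)%R B2 E) => //.
- exact: (mS _ (dk k)).2.
- exact: (mS _ (dgk k)).2.
- exact: (mS _ (dhk k)).2.
- have [_] := addS _ _ (dgk k) (dhk k).
  by rewrite cutD.
- have [_ _] := gD k.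
  set N := \int[mu]_(y in gcube x r 2 `&` hs) _.
  have pw0 (h : Rn -> R) y : (0 <= `|h y| `^ p * w y)%R by rewrite mulr_ge0// powR_ge0.
  have N0 : 0 <= N by apply: integral_ge0 => y _; rewrite lee_fin.
  have gN : wLp_norm p w hs (cut f (gcube x r 1) k) <= N `^ p^-1.
    apply: lee_poweR2; first by rewrite invr_ge0 ltW.
      by apply: integral_ge0 => y _; rewrite lee_fin.
    rewrite [leLHS]integral_mkcond [leRHS]integral_mkcond; apply: le_ge0_integral => y _.
      by rewrite /patch; case: ifP => // _; rewrite lee_fin.
    rewrite /patch; case: ifPn => [/[!inE] hy|_]; last first.
      by case: ifP => // _; rewrite lee_fin.
    have [yZ|yZ] := pselect (gcube x r 1 y).
      rewrite mem_set; last by split => //; exact: gcube_subset yZ.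
      rewrite lee_fin ler_wpM2r//; apply: ge0_ler_powR; rewrite ?nnegrE ?(ltW p0)//.
      exact: norm_cut_le.
    rewrite cut_outside// normr0 powR0 ?gt_eqF// mul0r.
    by case: ifP => // _; rewrite lee_fin.
  have Apfin : Ap_const p w < +oo by case: Apw.
  have Ap0 := Ap_const_gt0 p1 Apw w_neq0.
  have [Ar Ar0 ArE] : exists2 r : R, (0 <= r)%R & Ap_const p w = r%:E.
    by apply: ereal_ge0_fin; rewrite Apfin ltW.
  have [b b0 bE] : exists2 r : R, (0 <= r)%R & bmo_norm a = r%:E.
    by apply: ereal_ge0_fin; rewrite bmo_norm_ge0 (le_lt_trans aA)// ltry.
  move=> Gle.
  have {}Gle : wLp_norm p w hs (G k) <= (B1 * A)%:E * N `^ p^-1.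
    apply: (le_trans Gle).
    apply: (@le_trans _ _ ((B1 * A)%:E * wLp_norm p w hs (cut f (gcube x r 1) k))).
      apply: lee_wpmul2r; first exact: poweR_ge0.
      rewrite /B1 ArE bE poweR_EFin -!EFinM lee_fin /=.
      rewrite bE lee_fin in aA.
      apply: (@le_trans _ _ (`|C0| * Ar `^ p^-1 * b)%R).
        by rewrite !ler_wpM2r ?powR_ge0// ler_norm.
      by rewrite ler_wpM2l// mulr_ge0// powR_ge0.
    by apply: lee_wpmul2l => //; rewrite lee_fin mulr_ge0// ltW.
  have Gn0 : 0 <= \int[mu]_(y in hs) (`|G k y| `^ p * w y)%:E.
    by apply: integral_ge0 => y _; rewrite lee_fin.
  have BA0 : (0 <= B1 * A)%R by rewrite mulr_ge0// ltW.
  have := lee_poweR2 (ltW p0) (poweR_ge0 _ _) Gle.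
  rewrite -poweRrM mulVf ?gt_eqF// poweRe1// => /le_trans; apply.
  rewrite poweRM ?poweR_ge0// poweR_EFin -poweRrM mulVf ?gt_eqF// poweRe1//.
- have hk := kernelS (dhk k) (L1_compact_cut p1 wg locf k mZC).
  apply: filterS hk => y ky hby.
  have hy := hbhs _ hby.
  have ns := @notin_supp_cut _ _ f x r k y r0 hby.
  have := ky hy ns.
  have far := @far_part_bound R n p K w g p1 K0 wg a u (cd * A)%R L ma cA0 L1 osc oscg x r r0
    f e E mf e0 fe eE y (cut f (~` gcube x r 1) k) hby.
  set I := \int[mu]_(_ in _) _ => HI.
  have I0 : 0 <= I.
    apply: integral_ge0 => z _; rewrite lee_fin !mulr_ge0// invr_ge0 exprn_ge0//.
    exact: sqrtr_ge0.
  have {}HI : `|H k y|%:E <= `|C0|%:E * I.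
    apply: (le_trans HI); apply: lee_wpmul2r => //; rewrite lee_fin; exact: ler_norm.
  rewrite -lee_fin; apply: (le_trans HI).
  apply: (@le_trans _ _ (`|C0|%:E *
     (2 * 8 ^+ n.+1 * K * (`|a y - gmean u x r 0| + L) * E)%:E)).
    apply: lee_wpmul2l; first by rewrite lee_fin.
    apply: far => z hz; last exact: norm_cut_le.
    by move=> z1; apply: cut_outside => /=; apply.
  rewrite -EFinM lee_fin /B2 le_eqVlt; apply/orP; left; apply/eqP; ring.
Qed.

Lemma commutator_morrey_bound A M : (0 < A)%R -> bmo_norm a <= A%:E ->
  (0 < M)%R -> morrey_norm p phi1 w f <= M%:E ->
  morrey_norm p phi2 w (S f) <= (morrey_constant * A * M)%:E.
Proof.
move=> A0 aA M0 fM; apply: ge_ereal_sup => _ [x [r [hx r0 ->]]].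
have [E0 h] := commutator_half_ball A0 aA M0 fM hx r0.
have wS := wmeas_gt0 p1 Apw w_neq0.
have [m m0 mE] := wmeas_half_ball_pos wg wS hx r0.
move: E0 h; rewrite mE; set E := (kap * M * _)%R => E0 h.
have ph0 := phi2_gt0 hx r0.
have GA0 : (0 <= Gam * A)%R by apply: mulr_ge0; [exact: powR_ge0|exact: ltW].
have hm : (wmeas w (half_ball x r))^-1 *
   \int[mu]_(y in half_ball x r) (`|S f y| `^ p * w y)%:E <= ((Gam * A * E) `^ p)%:E.
  by rewrite mE inver gt_eqF// lee_pdivrMl// muleC.
rewrite mE in hm.
have hp := lee_poweR2 (_ : (0 <= p^-1)%R) _ hm.
rewrite lee_pdivrMl//; apply: (le_trans (hp _ _)).
- by rewrite invr_ge0 ltW.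
- rewrite mule_ge0 ?inve_ge0 ?lee_fin ?(ltW m0)//.
  by apply: integral_ge0 => y _; rewrite lee_fin mulr_ge0// powR_ge0.
rewrite poweR_EFin -powRrM mulfV ?gt_eqF// (powRr1 (mulr_ge0 GA0 E0)) -EFinM lee_fin.
rewrite [leLHS](_ : _ = (phi2 x r * (A * M)) * (Gam * kap * C1))%R; last by rewrite /E; ring.
rewrite [leRHS](_ : _ = (phi2 x r * (A * M)) * morrey_constant)%R; last by ring.
apply: ler_wpM2l; last exact: ler_norm.
by rewrite mulr_ge0 ?(ltW ph0)// mulr_ge0 ?(ltW A0) ?(ltW M0).
Qed.

End nondegenerate.
End main.

Theorem theorem1 (R : realType) (n : nat) (p : R) (w : 'rV[R]_n.+1 -> R)
    (phi1 phi2 : 'rV[R]_n.+1 -> R -> R) (C0 C1 : R)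
    (D : set ('rV[R]_n.+1 -> R))
    (T : ('rV[R]_n.+1 -> R) -> ('rV[R]_n.+1 -> R)) :
  1 < p -> Muckenhoupt p w ->
  weight_xr phi1 -> weight_xr phi2 -> weight_pair_cond p w phi1 phi2 C1 ->
  sublinear_operator D T ->
  (forall f, D f -> L1_compact f ->
     {ae lebesgue_rV R n.+1, forall x, halfspace x ->
        (`|T f x|%:E <= C0%:E * \int[lebesgue_rV R n.+1]_(y in halfspace)
           (`|f y| / enorm (mirror x - y) ^+ n.+1)%:E)%E}) ->
  exists C : R, 0 < C /\
  forall a : 'rV[R]_n.+1 -> R, BMO a ->
  sublinear_operator (commutator_dom a D) (commutator a T) ->
  (forall f, commutator_dom a D f -> L1_compact f ->
     {ae lebesgue_rV R n.+1, forall x, halfspace x -> ~ supp f x ->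
        (`|commutator a T f x|%:E <=
         C0%:E * \int[lebesgue_rV R n.+1]_(y in halfspace)
           (`|a x - a y| * (`|f y| / enorm (mirror x - y) ^+ n.+1))%:E)%E}) ->
  (forall f, wLp p w halfspace f ->
     [/\ commutator_dom a D f, wLp p w halfspace (commutator a T f) &
      (wLp_norm p w halfspace (commutator a T f) <=
       C0%:E * (Ap_const p w) `^ p^-1 * bmo_norm a *
       wLp_norm p w halfspace f)%E]) ->
  (forall f, morrey p phi1 w f -> commutator_dom a D f /\
     {ae lebesgue_rV R n.+1, forall x, halfspace x ->
        `|commutator a T (truncate f k) x| @[k --> \oo]
          --> `|commutator a T f x|}) ->
  forall f, morrey p phi1 w f ->
    morrey p phi2 w (commutator a T f) /\
    (morrey_norm p phi2 w (commutator a T f) <=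
     C%:E * (Ap_const p w) `^ p^-1 * bmo_norm a * morrey_norm p phi1 w f)%E.
Proof.
move=> p1 Apw ph1 ph2 pair subT _.
have p0 : 0 < p by exact: lt_trans p1.
(* If no ball has positive mass, w is zero almost everywhere: the image has Morrey norm 0 and any C
   will do. *)
have [wpos|wdeg] := pselect (exists x r, (0 < wmeas w (eball x r))%E); last first.
  exists 1; split; first exact: ltr01.
  move=> a _ [mS _ _] _ _ limS f morf.
  have [df _] := limS f morf; have [_ mSf] := mS f df.
  have wE x r : (wmeas w (eball x r) <= 0)%E.
    by rewrite leNgt; apply/negP => xr; apply: wdeg; exists x, r.
  have [mor n0] := degenerate_morrey p1 Apw wE mSf ph2.
  split; first exact: mor.
  rewrite n0; apply: mule_ge0; last exact: morrey_norm_ge0.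
  by rewrite mule_ge0 ?bmo_norm_ge0// mul1e poweR_ge0.
have [K K1 wg] := muckenhoupt_pair p1 Apw wpos.
have al01 : 0 < p^-1 < 1 by rewrite invr_gt0 p0/= invf_lt1.
have be01 : 0 < 1 - p^-1 < 1 by case/andP: al01 => h1 h2; lra.
have q0 : 0 < (1 - p^-1)^-1 by rewrite invr_gt0; case/andP: be01.
have [Cw Cw0 JNw] := weighted_john_nirenberg al01 K1 wg p0.
have [Cg Cg0 JNg] := weighted_john_nirenberg be01 K1 (Ap_pair_sym wg) q0.
pose c := morrey_constant p w C0 C1 K Cw Cg.
have c0 : 0 <= c by exact: normr_ge0.
have Ap_fin : (Ap_const p w < +oo)%E by case: Apw.
have Ap0 := Ap_const_gt0 p1 Apw wpos.
have [Ar Ar0 ArE] : exists2 r : R, 0 <= r & Ap_const p w = r%:E.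
  by apply: ereal_ge0_fin; rewrite Ap_fin ltW.
have Arp : 0 < Ar `^ p^-1 by rewrite powR_gt0// -lte_fin -ArE.
(* The 1 ensures C > 0, as c may be 0; the denominator cancels the power of the A_p constant in the
   conclusion. *)
exists ((c + 1) / Ar `^ p^-1); split; first by rewrite divr_gt0// ltr_wpDl.
move=> a BMOa subS kernelS boundS limS f morf.
have [df lim_f] := limS f morf.
have [locf morf_fin] := morf.
have [_ mSf] := (let: And3 m _ _ := subS in m f df).
have [b b0 bE] : exists2 r : R, 0 <= r & bmo_norm a = r%:E.
  by apply: ereal_ge0_fin; rewrite bmo_norm_ge0; case: BMOa.
have [m m0 mE] : exists2 r : R, 0 <= r & morrey_norm p phi1 w f = r%:E.
  by apply: ereal_ge0_fin; apply/andP; split; [exact: morrey_norm_ge0|].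
have bound : (morrey_norm p phi2 w (commutator a T f) <= (c * b * m)%:E)%E.
  apply: lee_product_limit => // e e0.
  apply: (commutator_morrey_bound p1 Apw ph1 ph2 pair wpos K1 wg Cw0 Cg0 JNw JNg
    BMOa subS kernelS boundS locf df lim_f).
  - by rewrite ltr_wpDl.
  - by rewrite bE lee_fin lerDl ltW.
  - by rewrite ltr_wpDl.
  - by rewrite mE lee_fin lerDl ltW.
split; last first.
  apply: (le_trans bound); rewrite ArE bE mE poweR_EFin -!EFinM lee_fin.
  rewrite divfK ?gt_eqF// -!mulrA ler_wpM2r ?mulr_ge0//.
  by rewrite lerDl.
split; last by rewrite (le_lt_trans bound)// ltry.
split; first exact: mSf.
(* Local membership: a compact subset of the half-space lies in a single half ball, where the
   estimate is finite. *)
move=> A cA Ahs; have [x [r [hx r0 Axr]]] := compact_subset_half_ball cA Ahs.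
have b1 : 0 < b + 1 by rewrite ltr_wpDl.
have m1 : 0 < m + 1 by rewrite ltr_wpDl.
have ab : (bmo_norm a <= (b + 1)%:E)%E by rewrite bE lee_fin lerDl.
have fm : (morrey_norm p phi1 w f <= (m + 1)%:E)%E by rewrite mE lee_fin lerDl.
have [_ hb] := commutator_half_ball p1 Apw ph1 pair wpos K1 wg Cw0 Cg0 JNw JNg
    BMOa subS kernelS boundS locf df lim_f b1 ab m1 fm hx r0.
apply: poweR_lty.
have pw0 y : (0 <= (`|commutator a T f y| `^ p * w y)%:E)%E.
  by rewrite lee_fin mulr_ge0 ?powR_ge0//; case: Apw => -[].
apply: (le_lt_trans (subset_ge0_integral _ (fun y _ => pw0 y) Axr)).
apply: (le_lt_trans hb).
have [M M0 ->] := wmeas_half_ball_pos wg (wmeas_gt0 p1 Apw wpos) hx r0.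
by rewrite -EFinM ltry.
Qed.
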